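(* Assume the problem, the standing assumptions (A1)–(A3) and the Acc-ZOM algorithm described in the context, with $\mathcal{X}=\mathbb{R}^d$. Let $\{x_t\}_{t=1}^T$ be generated by the algorithm with $\eta_t=\frac{k}{(m+t)^{1/3}}$ for all $t\ge 0$, $0<\gamma\le\min\big(\frac{m^{1/3}}{2Lk},\frac{1}{2\sqrt{6d}L}\big)$, $c\ge\frac{2}{3k^3}+\frac54$, $k>0$, $m\ge\max\big(2,k^3,(ck)^3\big)$ and $0<\mu\le\frac{1}{d(m+T)^{2/3}}$. Then $$\frac1T\sum_{t=1}^T\mathbb{E}\|\nabla f(x_t)\|\le\frac{\sqrt{2M}\,m^{1/6}}{T^{1/2}}+\frac{\sqrt{2M}}{T^{1/3}}+\frac{L}{2(m+T)^{2/3}},$$ where $M=\frac{f_\mu(x_1)-f^*}{k\gamma}+\frac{m^{1/3}\sigma^2}{k^2}+\frac{9L^2}{4k^2}+2k^2c^2\sigma^2\ln(m+T)$.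
   Context: Problem: $\min_{x\in\mathcal{X}}f(x)$, $f(x)=\mathbb{E}_{\xi\sim\mathcal{D}}[f(x;\xi)]$, where $f(\cdot;\xi):\mathbb{R}^d\to\mathbb{R}$ is differentiable and possibly nonconvex, $\xi$ is a random variable with distribution $\mathcal{D}$, and here $\mathcal{X}=\mathbb{R}^d$. $\|\cdot\|$ is the Euclidean norm. Smoothing: for a smoothing parameter $\mu>0$ and $u$ uniformly distributed on the unit sphere of $\mathbb{R}^d$, the stochastic zeroth-order gradient is $\hat\nabla f(x;\xi)=\frac{f(x+\mu u;\xi)-f(x;\xi)}{\mu/d}u$. Let $f_\mu(x)=\mathbb{E}_{u\sim U_B}[f(x+\mu u)]$, with $U_B$ the uniform distribution over the unit Euclidean ball $B\subset\mathbb{R}^d$. Standing assumptions. (A1) There is $\sigma>0$ with $\mathbb{E}\|\hat\nabla f(x;\xi)-\nabla f_\mu(x)\|^2\le\sigma^2$ for all $x$. (A2) $\|\nabla f(x;\xi)-\nabla f(x';\xi)\|\le L\|x-x'\|$ for all $x,x'\in\mathcal{X}$. (A3) $f^*=\inf_{x\in\mathcal{X}}f(x)>-\infty$. Acc-ZOM algorithm (case $\mathcal{X}=\mathbb{R}^d$), with parameters $\gamma,k,m,c$, horizon $T$ and initial point $x_1$: draw $\xi_1$ and $u$ uniform on the unit sphere, and set $v_1=\hat\nabla f(x_1;\xi_1)$. For $t=1,\dots,T$: set $\eta_t=\frac{k}{(m+t)^{1/3}}$; set $x_{t+1}=x_t-\gamma\eta_tv_t$; set $\alpha_{t+1}=c\eta_t^2$;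 draw a fresh independent sample $\xi_{t+1}\sim\mathcal{D}$ and a fresh independent $u$ uniform on the unit sphere, and set $v_{t+1}=\hat\nabla f(x_{t+1};\xi_{t+1})+(1-\alpha_{t+1})\big[v_t-\hat\nabla f(x_t;\xi_{t+1})\big]$, both zeroth-order gradients using the same $u$. *)

(* Defs.v *)
From HB Require Import structures.
From mathcomp Require Import all_boot all_order all_algebra.
From mathcomp Require Import all_classical all_reals all_analysis measurable_realfun.
Import Order.TTheory GRing.Theory Num.Theory.
Import numFieldNormedType.Exports.

Set Implicit Arguments.
Unset Strict Implicit.
Unset Printing Implicit Defensive.

Local Open Scope classical_set_scope.
Local Open Scope ring_scope.

(* R^n is 'rV[R]_n. The library norm on 'rV[R]_n is the sup norm; it induces
   the same topology and the same notion of differentiability as the Euclidean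
   norm, which is the only norm that appears in inequalities. *)
Definition norm2 {R : realType} {n : nat} (x : 'rV[R]_n) : R :=
  Num.sqrt (\sum_(i < n) x ord0 i ^+ 2).

Definition grad {R : realType} {n : nat} (f : 'rV[R]_n -> R) (x : 'rV[R]_n) :
    'rV[R]_n :=
  \row_i 'D_(delta_mx ord0 i) f x.

Definition rV_coord {R : realType} {n : nat} (i : 'I_n) (x : 'rV[R]_n) : R :=
  x ord0 i.

(* Borel sigma-algebra of R^n: the one generated by the coordinates. *)
Definition measurable_rV (R : realType) (n : nat) : set (set 'rV[R]_n) :=
  g_sigma_preimage (@rV_coord R n).

Lemma measurable_rV0 (R : realType) (n : nat) : @measurable_rV R n set0.
Proof. exact: sigma_algebra0. Qed.

Lemma measurable_rVC (R : realType) (n : nat) (A : set 'rV[R]_n) :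
  measurable_rV A -> measurable_rV (~` A).
Proof. exact: sigma_algebraC. Qed.

Lemma measurable_rV_bigcup (R : realType) (n : nat) (F : (set 'rV[R]_n)^nat) :
  (forall i, measurable_rV (F i)) -> measurable_rV (\bigcup_i F i).
Proof. exact: sigma_algebra_bigcup. Qed.

HB.instance Definition _ (R : realType) (n : nat) :=
  @isMeasurable.Build default_measure_display 'rV[R]_n
    (@measurable_rV R n) (@measurable_rV0 R n) (@measurable_rVC R n)
    (@measurable_rV_bigcup R n).

Lemma measurable_rV_coord (R : realType) (n : nat) (i : 'I_n) :
  measurable_fun [set: 'rV[R]_n] (@rV_coord R n i).
Proof.
move=> _ A mA; rewrite setTI; apply: sub_sigma_algebra.
rewrite -bigcup_seq/=; exists i => /=; first by rewrite mem_index_enum.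
by exists A => //; rewrite setTI.
Qed.

Lemma measurable_fun_rVP (R : realType) (n : nat) (d : measure_display)
    (T : measurableType d) (f : T -> 'rV[R]_n) :
  measurable_fun [set: T] f <->
  forall i, measurable_fun [set: T] (fun x => f x ord0 i).
Proof.
split=> [mf i|mf].
  exact: measurableT_comp (measurable_rV_coord i) mf.
have sub : g_sigma_preimage (fun i => @rV_coord R n i \o f) `<=` measurable.
  apply: smallest_sub; first exact: sigma_algebra_measurable.
  rewrite -bigcup_seq/=; apply: bigcup_sub => i _ A [B mB <-].
  exact: (mf i).
move=> _ A mA; apply: sub; rewrite g_sigma_preimage_comp.
by exists A.
Qed.

Lemma measurable_norm2 (R : realType) (n : nat) :
  measurable_fun [set: 'rV[R]_n] (@norm2 R n).
Proof.
rewrite (_ : norm2 = fun x => (\sum_(i < n) x ord0 i ^+ 2) `^ 2^-1).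
  apply: (measurableT_comp (measurable_powR _)).
  apply: measurable_sum => i; apply: measurable_funX.
  exact: measurable_rV_coord.
by apply/funext => x; rewrite powR12_sqrt// sumr_ge0// => i _; exact: sqr_ge0.
Qed.

Definition rV_cons {R : realType} {n : nat} (z : 'rV[R]_n * measurableTypeR R) :
    'rV[R]_n.+1 :=
  \row_i oapp (z.1 ord0) z.2 (unlift ord0 i).

Lemma measurable_rV_cons (R : realType) (n : nat) :
  measurable_fun [set: 'rV[R]_n * measurableTypeR R] (@rV_cons R n).
Proof.
apply/measurable_fun_rVP => i; under eq_fun do rewrite mxE.
case: (unliftP ord0 i) => [j _|_] /=; last exact: measurable_snd.
exact: measurableT_comp (measurable_rV_coord j) measurable_fst.
Qed.

(* The image of mu \x lebesgue_measure under [rV_cons], as a measure. *)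
Definition lebesgue_rV_succ (R : realType) (n : nat)
    (mu : {measure set 'rV[R]_n -> \bar R}) :
    {measure set 'rV[R]_n.+1 -> \bar R} :=
  measure_function_pushforward__canonical__measure_function_Measure
    (mu \x lebesgue_measure)%E (@measurable_rV_cons R n).

Fixpoint lebesgue_rV (R : realType) (n : nat) :
    {measure set 'rV[R]_n -> \bar R} :=
  match n with
  | 0 => \d_(0 : 'rV[R]_0)
  | n'.+1 => lebesgue_rV_succ (lebesgue_rV R n')
  end.

Lemma lebesgue_rV_cube (R : realType) (n : nat) (a : R) : 0 < a ->
  let cube := [set x : 'rV[R]_n | forall i, x ord0 i \in `[- a, a]] in
  measurable cube /\ lebesgue_rV R n cube = ((a *+ 2) ^+ n)%:E.
Proof.
move=> a0; elim: n => [|n [mC IH]] /=.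
  rewrite (_ : [set _ | _] = setT).
    by split => //; rewrite diracT expr0.
  by apply/seteqP; split => // x _ [].
have -> : [set x : 'rV[R]_n.+1 | forall i, x ord0 i \in `[- a, a]] =
    \bigcap_(i in [set: 'I_n.+1]) (@rV_coord R n.+1 i @^-1` `[- a, a]).
  apply/seteqP; split => [x h i _|x h i]; first exact: h.
  exact: (h i I).
split.
  apply: fin_bigcap_measurable => [|i _]; first exact: finite_finset.
  rewrite -[X in measurable X]setTI.
  by apply: measurable_rV_coord => //; exact: measurable_itv.
rewrite /lebesgue_rV_succ /pushforward.
set C := (X in rV_cons @^-1` X).
have -> : rV_cons @^-1` C =
    [set x : 'rV[R]_n | forall i, x ord0 i \in `[- a, a]] `*` `[- a, a].
  apply/seteqP; split => -[x y] /=.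
    move=> h; split => [i|].
      by have := h (lift ord0 i) I; rewrite /= /rV_coord mxE liftK.
    by have := h ord0 I; rewrite /= /rV_coord mxE unlift_none.
  move=> [hx hy] i _ /=; rewrite /rV_coord mxE.
  by case: unliftP => [j _|_] /=; [exact: hx|exact: hy].
rewrite product_measure1E//.
rewrite IH [X in (_ * X)%E](lebesgue_measure_itv `[- a, a])/= lte_fin gtrN//.
by rewrite -EFinB -EFinM opprK -mulr2n exprSr.
Qed.

Definition unit_ball (R : realType) (n : nat) : set 'rV[R]_n :=
  [set x | norm2 x <= 1].

Lemma measurable_unit_ball (R : realType) (n : nat) :
  measurable (@unit_ball R n).
Proof.
have -> : @unit_ball R n = setT `&` @norm2 R n @^-1` `]-oo, 1].
  by apply/seteqP; rewrite setTI; split => x /=; rewrite in_itv.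
by apply: measurable_norm2 => //; exact: measurable_itv.
Qed.

Lemma lebesgue_unit_ball_gt0 (R : realType) (n : nat) :
  (0 < lebesgue_rV R n (@unit_ball R n))%E.
Proof.
have a0 : 0 < (n.+1%:R : R)^-1 by rewrite invr_gt0.
have [mC CE] := lebesgue_rV_cube n a0.
apply: (@lt_le_trans _ _ (((n.+1%:R : R)^-1 *+ 2) ^+ n)%:E).
  by rewrite lte_fin exprn_gt0// pmulrn_lgt0.
rewrite -CE; apply: le_measure.
- by rewrite inE.
- by rewrite inE; exact: measurable_unit_ball.
move=> x /= h; rewrite /unit_ball/= /norm2 -[leRHS]sqrtr1 ler_wsqrtr//.
apply: (@le_trans _ _ (\sum_(i < n) (n.+1%:R : R)^-1)).
  apply: ler_sum => i _; have := h i; rewrite in_itv/= -ler_norml => xi.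
  rewrite -real_normK ?num_real//; apply: (@le_trans _ _ `|x ord0 i|) => //.
  rewrite expr2 ler_piMl//; apply: le_trans xi _.
  by rewrite invf_le1// ler1n.
rewrite sumr_const card_ord -[leLHS]mulr_natr ler_pdivrMl// mulr1 ler_nat.
exact: leqnSn.
Qed.

Lemma lebesgue_unit_ball_lty (R : realType) (n : nat) :
  (lebesgue_rV R n (@unit_ball R n) < +oo)%E.
Proof.
have [mC CE] := @lebesgue_rV_cube R n 1 ltr01.
apply: (@le_lt_trans _ _ ((1 *+ 2 : R) ^+ n)%:E); last exact: ltry.
rewrite -CE; apply: le_measure.
- by rewrite inE; exact: measurable_unit_ball.
- by rewrite inE.
move=> x /= h i; rewrite in_itv/= -ler_norml.
rewrite -(@ler_pXn2r _ 2)// ?nnegrE// expr1n real_normK ?num_real//.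
apply: (@le_trans _ _ (\sum_(i < n) x ord0 i ^+ 2)).
  by rewrite (bigD1 i)//= lerDl sumr_ge0// => j _; exact: sqr_ge0.
move: h; rewrite /unit_ball/= /norm2 -[leRHS]sqrtr1 ler_psqrt// nnegrE ?ler01//.
by apply: sumr_ge0 => j _; exact: sqr_ge0.
Qed.

(* The Dirac mass is only the default value of [mnormalize]; by the two lemmas
   above it is not used. *)
Definition unif_ball (R : realType) (n : nat) : probability 'rV[R]_n R :=
  mnormalize (mrestr (lebesgue_rV R n) (@measurable_unit_ball R n))
    \d_(0 : 'rV[R]_n).

Lemma unif_ballE (R : realType) (n : nat) (A : set 'rV[R]_n) :
  unif_ball R n A = (lebesgue_rV R n (A `&` @unit_ball R n) *
    (fine (lebesgue_rV R n (@unit_ball R n)))^-1%:E)%E.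
Proof.
rewrite /unif_ball/= /mnormalize/= /mrestr setTI.
by rewrite gt_eqF ?lebesgue_unit_ball_gt0//= lt_eqF ?lebesgue_unit_ball_lty.
Qed.

Definition normalize_rV {R : realType} {n : nat} (x : 'rV[R]_n) : 'rV[R]_n :=
  (norm2 x)^-1 *: x.

Lemma measurable_normalize_rV (R : realType) (n : nat) :
  measurable_fun [set: 'rV[R]_n] (@normalize_rV R n).
Proof.
apply/measurable_fun_rVP => i.
rewrite (_ : (fun _ => _) = fun x => norm2 x `^ (-1) * rV_coord i x); last first.
  by apply/funext => x; rewrite mxE powR_inv1// sqrtr_ge0.
apply: measurable_funM; last exact: measurable_rV_coord.
exact: measurableT_comp (measurable_powR _) (@measurable_norm2 R n).
Qed.

HB.instance Definition _ (R : realType) (n : nat) :=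
  isMeasurableFun.Build _ _ _ _ (@normalize_rV R n)
    (@measurable_normalize_rV R n).

(* Uniform probability on the unit sphere, i.e. normalized surface measure,
   as the cone measure: a Borel set A of the sphere has mass
   vol {r a | 0 < r <= 1, a in A} / vol (unit_ball). For n > 0 it is carried
   by the unit sphere; the origin, sent to 0 by [normalize_rV], is null. *)
Definition unif_sphere (R : realType) (n : nat) : probability 'rV[R]_n R :=
  distribution (unif_ball R n) (@normalize_rV R n).

Definition mutually_independent (d : measure_display) (T : measurableType d)
    (R : realType) (P : probability T R) (I : finType) (F : I -> set (set T)) :
    Prop :=
  forall (J : {set I}) (A : I -> set T), (forall i, i \in J -> F i (A i)) ->
    P (\bigcap_(i in [set` J]) A i) = (\prod_(i in J) fine (P (A i)))%:E.

Definition sigma_of (d d' : measure_display) (T : measurableType d)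
    (U : measurableType d') (X : T -> U) : set (set T) :=
  preimage_set_system [set: T] X measurable.

Definition has_law (d d' : measure_display) (T : measurableType d)
    (U : measurableType d') (R : realType) (P : probability T R) (X : T -> U)
    (Q : probability U R) : Prop :=
  forall A, measurable A -> P (X @^-1` A) = Q A.

(* The draws (xi_t, u_t), 1 <= t <= T.+1, are i.i.d. with xi_t ~ D independent
   of u_t ~ unif_sphere; draws at other indices are unconstrained (apart from
   being random variables) and never used. *)
Definition fresh_draws (R : realType) (n : nat) (dO dX : measure_display)
    (Omega : measurableType dO) (Xi : measurableType dX)
    (P : probability Omega R) (D : probability Xi R) (T : nat)
    (xi : nat -> {RV P >-> Xi}) (u : nat -> {RV P >-> 'rV[R]_n}) : Prop :=
  [/\ forall t, (1 <= t <= T.+1)%N -> has_law P (xi t) D,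
      forall t, (1 <= t <= T.+1)%N -> has_law P (u t) (unif_sphere R n) &
      mutually_independent P (fun i : 'I_T.+1 + 'I_T.+1 =>
        match i with
        | inl j => sigma_of (xi j.+1)
        | inr j => sigma_of (u j.+1)
        end)].

Definition objective (R : realType) (n : nat) (dX : measure_display)
    (Xi : measurableType dX) (D : probability Xi R) (F : 'rV[R]_n -> Xi -> R)
    (x : 'rV[R]_n) : R :=
  fine ('E_D[F x])%E.

Definition smoothing (R : realType) (n : nat) (mu : R) (f : 'rV[R]_n -> R)
    (x : 'rV[R]_n) : R :=
  fine ('E_(unif_ball R n)[fun u => f (x + mu *: u)%R])%E.

Definition zo_grad (R : realType) (n : nat) (mu : R) (g : 'rV[R]_n -> R)
    (u x : 'rV[R]_n) : 'rV[R]_n :=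
  ((g (x + mu *: u) - g x) / (mu / n%:R)) *: u.

Definition step_size (R : realType) (k m : R) (t : nat) : R :=
  k / (m + t%:R) `^ (1 / 3).

Definition momentum (R : realType) (c k m : R) (t : nat) : R :=
  c * step_size k m t.-1 ^+ 2.

Definition acc_zom_run (R : realType) (n : nat) (Xi : Type)
    (F : 'rV[R]_n -> Xi -> R) (mu gamma k m c : R) (T : nat) (x1 : 'rV[R]_n)
    (xi : nat -> Xi) (u x v : nat -> 'rV[R]_n) : Prop :=
  let zo t y := zo_grad mu (F^~ (xi t)) (u t) y in
  [/\ x 1%N = x1,
      v 1%N = zo 1%N x1 &
      forall t, (1 <= t <= T)%N ->
        x t.+1 = x t - (gamma * step_size k m t) *: v t /\
        v t.+1 = zo t.+1 (x t.+1) +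
          (1 - momentum c k m t.+1) *: (v t - zo t.+1 (x t))].

(* Main.v *)
(* For an L-smooth function the divergence theorem on the unit ball,
   E_ball[d_i g] = n E_sphere[g(s) s_i], shows that the zeroth-order gradient is an
   unbiased estimator of grad f_mu, and with g linear it gives the second moment of
   <a, s> on the sphere.  Since the uniform law on the sphere is the radial projection
   of the uniform law on the ball, no surface measure is needed: translation and
   dilation invariance of Lebesgue measure are both tested against a radial C^1
   cutoff of the ball, the two resulting integrals over a shell of width 1/N around the
   sphere differ by O(1/N), and N tends to infinity.

   Let e_t = v_t - grad f_mu(x_t).  The draws of step t+1 are independent of x_t,
   x_{t+1} and v_t, so integrating them out first gives
     E|e_{t+1}|^2 <= (1-a)^2 E|e_t|^2 + 2 a^2 sigma^2
       + 2 (1-a)^2 (3 n L^2 gamma^2 eta_t^2 E|v_t|^2 + (3/2) L^2 n^2 mu^2),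
   where a = alpha_{t+1}.  Hence the potential
   E f_mu(x_t) - f^* + (gamma/eta_{t-1}) E|e_t|^2 decreases by
   (gamma eta_t/2) E|grad f_mu(x_t)|^2 up to a variance term, summing to a logarithm,
   and a smoothing bias.  In the bias the factor (1-a)/eta_t <= 1/eta_{t-1} is kept, so
   that the bound sum_t (m+t-1)^{1/3} <= (3/4)(m+T)^{4/3} yields the constant 9/4 in M.
   Finally |grad f - grad f_mu| <= n L mu / 2. *)
From HB Require Import structures.
Require Import Defs.
From mathcomp Require Import all_boot all_order all_algebra.
From mathcomp Require Import all_classical all_reals all_analysis.
From mathcomp Require Import measurable_realfun ring lra.
Import Order.TTheory GRing.Theory Num.Theory.
Import numFieldNormedType.Exports.
Local Open Scope classical_set_scope.
Local Open Scope ring_scope.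

Set Implicit Arguments.
Unset Strict Implicit.
Unset Printing Implicit Defensive.

(** * Smooth functions *)

(** Two obstacles shape the development. [F] is measurable in the sample only for each fixed point,
    and the objective and its smoothing are expectations. So smoothness is carried as two
    inequalities on a pair (g, G), a quadratic Taylor bound and a Lipschitz bound: both pass through
    an expectation by mere integration, they force G to be the gradient, and they give joint
    measurability in point and sample. Finiteness of E|v_t|^2 and E|e_t|^2 is not assumed either; it
    is proved by induction along the run, from the descent inequality and then the error recursion,
    whose left side stays an extended real until then.

    Constants: gamma <= m^{1/3}/(2Lk) gives L gamma eta_t <= 1/2, which leaves (gamma
    eta_t/4)|v_t|^2 in the descent; gamma <= 1/(2 sqrt(6d) L) makes the |v_t|^2 term of the
    recursion fit into it. In c, the summand 2/(3k^3) pays for the growth of 1/eta_t and 5/4 covers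
    the error term of the descent. The term with m^{1/6} comes from (m+T)^{1/3} <=
    (m^{1/6}+T^{1/6})^2. *)

Section euclid.
Context {R : realType} {n : nat}.
Implicit Types (x y z : 'rV[R]_n) (a : R).

Definition dot x y : R := \sum_(i < n) x ord0 i * y ord0 i.

Lemma dotC x y : dot x y = dot y x.
Proof. by apply: eq_bigr => i _; rewrite mulrC. Qed.

Lemma dotDl x y z : dot (x + y) z = dot x z + dot y z.
Proof. by rewrite -big_split; apply: eq_bigr => i _; rewrite mxE mulrDl. Qed.

Lemma dotZl a x y : dot (a *: x) y = a * dot x y.
Proof. by rewrite mulr_sumr; apply: eq_bigr => i _; rewrite mxE mulrA. Qed.

Lemma dotNl x y : dot (- x) y = - dot x y.
Proof. by rewrite -scaleN1r dotZl mulN1r. Qed.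

Lemma dotBl x y z : dot (x - y) z = dot x z - dot y z.
Proof. by rewrite dotDl dotNl. Qed.

Lemma dotDr x y z : dot z (x + y) = dot z x + dot z y.
Proof. by rewrite dotC dotDl !(dotC z). Qed.

Lemma dotZr a x y : dot x (a *: y) = a * dot x y.
Proof. by rewrite dotC dotZl dotC. Qed.

Lemma dotNr x y : dot x (- y) = - dot x y.
Proof. by rewrite dotC dotNl dotC. Qed.

Lemma dotBr x y z : dot z (x - y) = dot z x - dot z y.
Proof. by rewrite dotDr dotNr. Qed.

Lemma dot0r x : dot x 0 = 0.
Proof. by rewrite -(scale0r 0) dotZr mul0r. Qed.

Lemma dot_delta x i : dot x (delta_mx ord0 i) = x ord0 i.
Proof.
rewrite /dot (bigD1 i)//= big1 ?mxE ?eqxx ?mulr1 ?addr0// => j ji.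
by rewrite mxE eqxx (negbTE ji) mulr0.
Qed.

Lemma dotxx_ge0 x : 0 <= dot x x.
Proof. by apply: sumr_ge0 => i _; rewrite -expr2 sqr_ge0. Qed.

Lemma norm2_ge0 x : 0 <= norm2 x.
Proof. exact: sqrtr_ge0. Qed.

Lemma norm2_sqr x : norm2 x ^+ 2 = dot x x.
Proof.
rewrite /norm2 sqr_sqrtr; last by apply: sumr_ge0 => i _; exact: sqr_ge0.
by apply: eq_bigr => i _; rewrite expr2.
Qed.

Lemma norm2_le x a : 0 <= a -> dot x x <= a ^+ 2 -> norm2 x <= a.
Proof.
by move=> a0 xa; rewrite -(@ler_pXn2r _ 2)// ?nnegrE ?norm2_ge0// norm2_sqr.
Qed.

Lemma norm2Z a x : norm2 (a *: x) = `|a| * norm2 x.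
Proof.
apply/eqP; rewrite -(@eqrXn2 _ 2)// ?mulr_ge0 ?norm2_ge0//.
by rewrite exprMn !norm2_sqr dotZl dotZr real_normK ?num_real// mulrA expr2.
Qed.

Lemma norm2N x : norm2 (- x) = norm2 x.
Proof. by rewrite -scaleN1r norm2Z normrN1 mul1r. Qed.

Lemma norm2_0 : norm2 (0 : 'rV[R]_n) = 0.
Proof. by rewrite -(scale0r 0) norm2Z normr0 mul0r. Qed.

Lemma norm2_eq0 x : (norm2 x == 0) = (x == 0).
Proof.
apply/eqP/eqP => [x0|->]; last exact: norm2_0.
have : dot x x == 0 by rewrite -norm2_sqr x0 expr0n.
rewrite /dot psumr_eq0 => [/allP h|i _]; last by rewrite -expr2 sqr_ge0.
apply/rowP => i; rewrite mxE; apply/eqP.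
by have := h i (mem_index_enum i); rewrite mulf_eq0 orbb.
Qed.

Lemma dot_le_norm2 x y : `|dot x y| <= norm2 x * norm2 y.
Proof.
rewrite -(@ler_pXn2r _ 2)// ?nnegrE ?mulr_ge0 ?norm2_ge0//.
rewrite real_normK ?num_real// exprMn !norm2_sqr.
have [->|x0] := eqVneq x 0; first by rewrite dotC !dot0r expr0n mul0r.
have xx : 0 < dot x x.
  by rewrite lt_neqAle dotxx_ge0 andbT eq_sym -norm2_sqr sqrf_eq0 norm2_eq0.
have := dotxx_ge0 (dot x x *: y - dot x y *: x).
rewrite !(dotBl, dotBr, dotZl, dotZr) (dotC y x).
set A := dot x x in xx *; set B := dot x y; set C := dot y y => h.
have : 0 <= A * (A * C - B ^+ 2) by move: h; congr (0 <= _); ring.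
by rewrite pmulr_rge0// subr_ge0.
Qed.

Lemma coord_le_norm2 x i : `|x ord0 i| <= norm2 x.
Proof.
rewrite -(@ler_pXn2r _ 2)// ?nnegrE ?norm2_ge0//.
rewrite real_normK ?num_real// norm2_sqr /dot (bigD1 i)//= -expr2 lerDl.
by apply: sumr_ge0 => j _; rewrite -expr2 sqr_ge0.
Qed.

Lemma norm2_le_sum x : norm2 x <= \sum_(i < n) `|x ord0 i|.
Proof.
have s0 : 0 <= \sum_(i < n) `|x ord0 i| by exact: sumr_ge0.
apply: norm2_le => //; rewrite expr2 mulr_suml; apply: ler_sum => i _.
rewrite -expr2 -[leLHS]ger0_norm ?sqr_ge0// normrX expr2 ler_wpM2l//.
by rewrite (bigD1 i)//= lerDl sumr_ge0.
Qed.

Lemma dotxxD x y : dot (x + y) (x + y) = dot x x + dot x y *+ 2 + dot y y.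
Proof. by rewrite !dotDl !dotDr (dotC y x) mulr2n; ring. Qed.

Lemma norm2D x y : norm2 (x + y) <= norm2 x + norm2 y.
Proof.
apply: norm2_le; first by rewrite addr_ge0 ?norm2_ge0.
rewrite dotxxD -!norm2_sqr.
have := le_trans (ler_norm _) (dot_le_norm2 x y); rewrite mulr2n => h.
by rewrite sqrrD mulr2n; lra.
Qed.

Lemma norm2_delta i : norm2 (delta_mx ord0 i : 'rV[R]_n) = 1.
Proof.
apply/eqP; rewrite -(@eqrXn2 _ 2)// ?norm2_ge0// norm2_sqr dot_delta.
by rewrite mxE !eqxx expr1n.
Qed.

End euclid.

Section smooth.
Context {R : realType} {n : nat}.
Implicit Types (g : 'rV[R]_n -> R) (G : 'rV[R]_n -> 'rV[R]_n).

(** No derivative appears: two inequalities are stable under averaging, a derivative would have to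
    be exchanged with the integral. By [smooth_grad] any such [G] is the gradient, so a formula for
    [G] identifies [grad g]. *)
Definition smooth (L : R) g G :=
  (forall x y, `|g y - g x - dot (G x) (y - x)| <= L / 2 * norm2 (y - x) ^+ 2)
  /\ (forall x y, norm2 (G x - G y) <= L * norm2 (x - y)).

(** A Lipschitz bound at one point, with a constant depending on that point. It holds for [g] and
    for the coordinates of [G] alike, and it is the form of continuity from which measurability is
    derived. *)
Definition calm g := forall x, exists C, forall y, norm2 (y - x) <= 1 ->
  `|g y - g x| <= C * norm2 (y - x).

Lemma smooth_calm L g G : 0 <= L -> smooth L g G -> calm g.
Proof.
move=> L0 [h _] x; exists (norm2 (G x) + L) => y yx1.
have := h x y; have := dot_le_norm2 (G x) (y - x).
set N := norm2 (y - x) in yx1 *; have N0 : 0 <= N by exact: norm2_ge0.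
set D := dot _ _; set A := g y - g x => h1 h2.
have -> : A = (A - D) + D by lra.
apply: le_trans (ler_normD _ _) _.
have : L / 2 * N ^+ 2 <= L * N.
  rewrite expr2 mulrA ler_wpM2r// -[leRHS]mulr1 ler_pM// ?divr_ge0//; lra.
by rewrite mulrDl; lra.
Qed.

Lemma smooth_calm_grad L g G i : smooth L g G -> calm (fun x => G x ord0 i).
Proof.
move=> [_ h] x; exists L => y _; have := h y x; apply: le_trans.
by have := coord_le_norm2 (G y - G x) i; rewrite !mxE.
Qed.

Lemma smooth_diff_quot L g G x v : 0 <= L -> smooth L g G ->
  (fun h : R => h^-1 *: (g (h *: v + x) - g x)) @ 0^' --> dot (G x) v.
Proof.
move=> L0 [h _]; apply/cvgrPdist_le => /= e e0.
(* The added 1 keeps [C] positive when [L] or [v] vanishes, so that e / C is a legitimate radius. *)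
pose C := L / 2 * norm2 v ^+ 2 + 1.
have C0 : 0 < C by rewrite ltr_wpDl// mulr_ge0 ?sqr_ge0// divr_ge0.
near=> t.
have t0 : t != 0 by near: t; exact: nbhs_dnbhs_neq.
have := h x (t *: v + x); rewrite addrK dotZr norm2Z exprMn.
rewrite real_normK ?num_real// => H.
rewrite distrC -(ler_pM2l (_ : 0 < `|t|)) ?normr_gt0//.
rewrite -normrM mulrBr /GRing.scale/= mulrA divff// mul1r.
apply: le_trans H _.
have tt : `|t| <= e / C.
  near: t; apply: dnbhs0_le; exact: divr_gt0.
have -> : L / 2 * (t ^+ 2 * norm2 v ^+ 2) = `|t| * (`|t| * (C - 1)).
  by rewrite /C addrK mulrA -expr2 real_normK ?num_real//; ring.
rewrite ler_wpM2l//; apply: le_trans (_ : `|t| * C <= _).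
  by rewrite ler_wpM2l//; lra.
by rewrite -ler_pdivlMr.
Unshelve. all: by end_near. Qed.

Lemma smooth_grad L g G : 0 <= L -> smooth L g G -> grad g = G.
Proof.
move=> L0 sm; apply/funext => x; apply/rowP => i; rewrite mxE -dot_delta.
by apply: cvg_lim; [exact: norm_hausdorff|exact: smooth_diff_quot sm].
Qed.

(** A monotonicity argument on the segment from x to y. The sign s, equal to 1 or -1, gives the two
    halves of the absolute value by the same computation. *)
Lemma smooth_derive L g : 0 <= L ->
  (forall x, differentiable g x) ->
  (forall x y, norm2 (grad g x - grad g y) <= L * norm2 (x - y)) ->
  smooth L g (grad g).
Proof.
move=> L0 df lip; split => // x y.
have Dv z v : 'D_v g z = dot (grad g z) v.
  rewrite deriveE// {1}(row_sum_delta v) linear_sum/=; apply: eq_bigr => i _.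
  by rewrite linearZ/= mxE -deriveE// mulrC.
set v := y - x.
have dg (t : R) : is_derive t 1 (fun t : R => g (x + t *: v))
    (dot (grad g (x + t *: v)) v).
  rewrite -Dv; have E : (fun h : R => h^-1 *: (g (x + (h *: (1 : R) + t) *: v) -
      g (x + t *: v))) = (fun h : R => h^-1 *: (g (h *: v + (x + t *: v)) -
      g (x + t *: v))).
    apply/funext => h; congr (_ *: (g _ - _)).
    by rewrite scalerDl [h *: _]mulr1 addrCA addrA addrC addrA.
  split; last by rewrite /derive; congr (lim _); rewrite -E.
  have : derivable g (x + t *: v) v by exact: diff_derivable.
  by rewrite /derivable/= -E.
have key s : `|s| = 1 ->
    s * (g y - g x - dot (grad g x) v) <= L / 2 * norm2 v ^+ 2.
  move=> s1.
  (* The signed Taylor remainder along the segment, less the quadratic that should dominate it. The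
     Lipschitz bound makes its derivative nonpositive on ]0, 1[, and psi 1 <= psi 0 is the claim. *)
  pose psi (t : R) := s * (g (x + t *: v) - t * dot (grad g x) v)
     - L / 2 * norm2 v ^+ 2 * t ^+ 2.
  have dpsi (t : R) : is_derive t 1 psi
      (s * (dot (grad g (x + t *: v)) v - dot (grad g x) v) -
       L / 2 * norm2 v ^+ 2 * (t *+ 2)).
    rewrite /psi; have := dg t => ?; apply: is_derive_eq.
    by rewrite /GRing.scale/= !mulr1 mulr0 add0r mulr2n.
  have : psi 1 <= psi 0.
    have dd t : derivable psi t 1 by have [] := dpsi t.
    apply: (@ler0_derive1_le_cc _ psi 0 1) => //.
    - move=> t /[!in_itv]/= /andP[t0 _]; rewrite derive1E.
      have [_ ->] := dpsi t; rewrite -dotBl.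
      have := dot_le_norm2 (grad g (x + t *: v) - grad g x) v.
      have := lip (x + t *: v) x.
      have -> : x + t *: v - x = t *: v by rewrite addrC addKr.
      rewrite norm2Z (gtr0_norm t0).
      set D := dot _ _; set N := norm2 (_ - _); set V := norm2 v => h1 h2.
      have V0 : 0 <= V := norm2_ge0 _.
      have h3 : N * V <= L * (t * V) * V by rewrite ler_wpM2r.
      have h4 : s * D <= `|D| by rewrite (le_trans (ler_norm _))// normrM s1 mul1r.
      rewrite subr_le0 (le_trans h4)// (le_trans h2)// (le_trans h3)//.
      by rewrite le_eqVlt; apply/orP; left; apply/eqP; field.
    - by apply: derivable_within_continuous => t _.
    - by rewrite in_itv/= lexx ler01.
    - by rewrite in_itv/= lexx ler01.
  rewrite /psi !scale0r scale1r addr0 expr1n expr0n/= !mul0r mul1r mulr0 !subr0.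
  by rewrite (addrC x) subrK mulr1; lra.
have := key 1 (normr1 _); have := key (-1) (normrN1 _).
by rewrite mul1r mulN1r ler_norml lerNl => -> ->.
Qed.

End smooth.

(** * Expectations and differentiation under the expectation *)

Section caratheodory.
Context {R : realType} {n : nat} {d : measure_display} {Y : measurableType d}.

Let lattice (N : nat) (p : 'rV[int]_n) : 'rV[R]_n :=
  \row_i ((p ord0 i)%:~R / N.+1%:R).
Let round (N : nat) (x : 'rV[R]_n) : 'rV[int]_n :=
  \row_i Num.floor (x ord0 i * N.+1%:R).

Let measurable_round N p : measurable [set x | round N x = p].
Proof.
have -> : [set x | round N x = p] = \bigcap_(i in [set: 'I_n])
    ((@rV_coord R n i) @^-1` `[(p ord0 i)%:~R / N.+1%:R,
                               (p ord0 i + 1)%:~R / N.+1%:R[).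
  have E (x : 'rV[R]_n) i : (Num.floor (x ord0 i * N.+1%:R) == p ord0 i) =
      (rV_coord i x \in `[(p ord0 i)%:~R / N.+1%:R,
                          (p ord0 i + 1)%:~R / N.+1%:R[).
    by rewrite in_itv/= ler_pdivrMr// ltr_pdivlMr// floor_eq// in_itv.
  apply/seteqP; split => [x xp i _|x xp] /=.
    by have := E x i; rewrite -{1}xp mxE eqxx => /esym.
  by apply/rowP => i; rewrite mxE; apply/eqP; rewrite E; exact: (xp i I).
apply: fin_bigcap_measurable => [|i _]; first exact: finite_finset.
rewrite -[X in measurable X]setTI.
by apply: measurable_rV_coord => //; exact: measurable_itv.
Qed.

Let lattice_round N x : norm2 (lattice N (round N x) - x) <= n%:R / N.+1%:R.
Proof.
apply: le_trans (norm2_le_sum _) _.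
apply: (@le_trans _ _ (\sum_(i < n) (N.+1%:R : R)^-1)); last first.
  by rewrite sumr_const card_ord mulr_natl.
apply: ler_sum => i _; rewrite !mxE.
have := floor_itv (x ord0 i * N.+1%:R); rewrite intrD.
set k := (Num.floor _)%:~R => /andP[h1 h2].
have N0 : (0 : R) < N.+1%:R by [].
rewrite distrC ger0_norm; last by rewrite subr_ge0 ler_pdivrMr.
rewrite -(ler_pM2r N0) mulrBl divfK ?gt_eqF// mulVf ?gt_eqF//.
by rewrite lerBlDl ltW.
Qed.

(** Rounding the point to the lattice of mesh 1/(N+1) leaves countably many values of the first
    argument, so the rounded function is measurable on the product. Calmness makes it converge
    pointwise to [F]. *)
Lemma measurable_caratheodory (F : 'rV[R]_n -> Y -> R) :
  (forall x, measurable_fun setT (F x)) -> (forall y, calm (F^~ y)) ->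
  measurable_fun setT (fun z : 'rV[R]_n * Y => F z.1 z.2).
Proof.
move=> mF cF.
apply: (@measurable_fun_cvg _ _ _ setT
  (fun N (z : 'rV[R]_n * Y) => F (lattice N (round N z.1)) z.2)) => [N|[x y] _].
  move=> _ A mA; rewrite setTI.
  have -> : (fun z : 'rV[R]_n * Y => F (lattice N (round N z.1)) z.2) @^-1` A =
      \bigcup_p ([set x | round N x = p] `*` (F (lattice N p) @^-1` A)).
    apply/seteqP; split => [[x y] /= Axy|[x y] [p _] [/= <-]] //.
    by exists (round N x).
  apply: countable_bigcupT_measurable => [|p]; first exact: countableP.
  apply: measurableX; first exact: measurable_round.
  by rewrite -[X in measurable X]setTI; exact: mF.
have [C CP] := cF y x; apply/cvgrPdist_le => /= e e0.
have C0 : 0 < `|C| + 1 by rewrite ltr_wpDl.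
have m0 : 0 < Num.min 1 (e / (`|C| + 1)) by rewrite lt_min ltr01 divr_gt0.
near=> N.
have xN : norm2 (lattice N (round N x) - x) <= Num.min 1 (e / (`|C| + 1)).
  apply: le_trans (lattice_round _ _) _; rewrite ler_pdivrMr// mulrC.
  rewrite -ler_pdivrMr//; apply: le_trans (_ : N%:R <= _); last first.
    by rewrite ler_nat.
  by near: N; exact: nbhs_infty_ger.
rewrite distrC; move: xN; rewrite le_min => /andP[x1 xe].
apply: le_trans (CP _ x1) _; rewrite ler_pdivlMr// in xe.
apply: le_trans xe; rewrite mulrC ler_wpM2l ?norm2_ge0//.
by rewrite (le_trans (ler_norm _))// lerDl.
Unshelve. all: by end_near. Qed.

End caratheodory.

Lemma measurable_calm {R : realType} {n} (g : 'rV[R]_n -> R) :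
  calm g -> measurable_fun setT g.
Proof.
move=> cg; have mg := @measurable_caratheodory R n _ unit (fun x _ => g x)
  (fun x => measurable_cst _) (fun=> cg).
exact: (measurableT_comp mg (measurable_pair2 tt)).
Qed.

Section mean.
Context {R : realType} {d : measure_display} {Y : measurableType d}.
Variable mu : {measure set Y -> \bar R}.
Implicit Types f g : Y -> R.

Definition mean f : R := (\int[mu]_y f y)%R.
Definition integ f := mu.-integrable setT (EFin \o f).

Lemma integ_measurable f : integ f -> measurable_fun setT f.
Proof. by move=> /measurable_int/measurable_EFinP. Qed.

Lemma integ0 : integ (cst 0).
Proof. exact: integrable0. Qed.

Lemma integD f g : integ f -> integ g -> integ (fun y => f y + g y).
Proof. by move=> hf hg; exact: integrableD hf hg. Qed.

Lemma integZ c f : integ f -> integ (fun y => c * f y).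
Proof. by move=> hf; exact: integrableZl hf. Qed.

Lemma integB f g : integ f -> integ g -> integ (fun y => f y - g y).
Proof. by move=> hf hg; exact: integrableB hf hg. Qed.

Lemma integ_norm f : integ f -> integ (fun y => `|f y|).
Proof. exact: integrable_norm. Qed.

Lemma integ_sum {I} (r : seq I) (f : I -> Y -> R) :
  (forall i, integ (f i)) -> integ (fun y => \sum_(i <- r) f i y).
Proof.
move=> hf; elim: r => [|i r IH].
  by under eq_fun do rewrite big_nil; exact: integ0.
by under eq_fun do rewrite big_cons; exact: integD.
Qed.

Lemma integ_le f g : measurable_fun setT f -> integ g ->
  (forall y, `|f y| <= g y) -> integ f.
Proof.
move=> mf ig fg; apply: le_integrable ig => //; first exact/measurable_EFinP.
move=> y _ /=; rewrite lee_fin; exact: le_trans (fg y) (ler_norm _).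
Qed.

Lemma mean0 : mean (cst 0) = 0.
Proof. by rewrite /mean Rintegral_cst// mul0r. Qed.

Lemma meanD f g : integ f -> integ g ->
  mean (fun y => f y + g y) = mean f + mean g.
Proof. exact: RintegralD. Qed.

Lemma meanB f g : integ f -> integ g ->
  mean (fun y => f y - g y) = mean f - mean g.
Proof. exact: RintegralB. Qed.

Lemma meanZ c f : integ f -> mean (fun y => c * f y) = c * mean f.
Proof. exact: RintegralZl. Qed.

Lemma mean_sum {I} (r : seq I) (f : I -> Y -> R) :
  (forall i, integ (f i)) ->
  mean (fun y => \sum_(i <- r) f i y) = \sum_(i <- r) mean (f i).
Proof.
move=> hf; elim: r => [|i r IH].
  by under eq_fun do rewrite big_nil; rewrite big_nil mean0.
under eq_fun do rewrite big_cons.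
by rewrite meanD ?IH ?big_cons//; exact: integ_sum.
Qed.

Lemma mean_le f g : integ f -> integ g -> (forall y, f y <= g y) ->
  mean f <= mean g.
Proof. by move=> hf hg fg; exact: le_Rintegral. Qed.

Lemma mean_norm_le f g : integ f -> integ g -> (forall y, `|f y| <= g y) ->
  `|mean f| <= mean g.
Proof.
move=> hf hg fg; rewrite ler_norml; apply/andP; split.
  rewrite -mulN1r -meanZ//; apply: mean_le => // [|y]; first exact: integZ.
  by have := fg y; rewrite ler_norml mulN1r => /andP[].
by apply: mean_le => // y; exact: le_trans (ler_norm _) (fg y).
Qed.

Lemma EFin_mean f : integ f -> (mean f)%:E = (\int[mu]_y (f y)%:E)%E.
Proof. by move=> hf; rewrite fineK//; exact: integrable_fin_num hf. Qed.

End mean.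
Arguments mean {R d Y} mu f.
Arguments integ {R d Y} mu f.

Section mean_probability.
Context {R : realType} {d : measure_display} {Y : measurableType d}.
Variable Q : probability Y R.
Implicit Types f : Y -> R.

Lemma integ_cst c : integ Q (cst c).
Proof. exact: finite_measure_integrable_cst. Qed.

Lemma integ_bounded f (C : R) : measurable_fun setT f -> (forall y, `|f y| <= C) ->
  integ Q f.
Proof. by move=> mf fC; apply: integ_le (integ_cst C) fC. Qed.

Lemma mean_cst c : mean Q (cst c) = c.
Proof.
transitivity (c * fine (Q setT)); first exact: Rintegral_cst.
by rewrite probability_setT mulr1.
Qed.

Lemma mean_norm_le_cst f (C : R) : integ Q f -> (forall y, `|f y| <= C) ->
  `|mean Q f| <= C.
Proof.
move=> hf fC; rewrite -[leRHS]mean_cst.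
by apply: mean_norm_le => //; exact: integ_cst.
Qed.

End mean_probability.

Section smooth_mean.
Context {R : realType} {n : nat} {d : measure_display} {Y : measurableType d}.
Variables (Q : probability Y R) (g : Y -> 'rV[R]_n -> R)
  (G : Y -> 'rV[R]_n -> 'rV[R]_n) (L : R).
Hypotheses (L0 : 0 <= L) (gG : forall y, smooth L (g y) (G y))
  (ig : forall x, integ Q (g^~ x)).

(** Measurability comes from the difference quotients with step 1/(k+1), which converge to the
    coordinate of the gradient. Integrability comes from the Taylor bound at a step of length 1,
    which bounds the coordinate by an increment of [g] plus L/2. *)
Lemma integ_smooth_grad x i : integ Q (fun y => G y x ord0 i).
Proof.
pose e : 'rV[R]_n := delta_mx ord0 i.
have mG : measurable_fun setT (fun y => G y x ord0 i).
  apply: (@measurable_fun_cvg _ _ _ setT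
    (fun k y => (k.+1%:R^-1)^-1 * (g y (k.+1%:R^-1 *: e + x) - g y x))) => [k|y _].
    apply: measurable_funM => //; apply: measurable_funB;
    exact: integ_measurable.
  apply/cvgrPdist_le => /= eps eps0; near=> k.
  have := (gG y).1 x (k.+1%:R^-1 *: e + x).
  have k0 : (0 : R) < k.+1%:R by [].
  rewrite addrK dotZr dot_delta norm2Z norm2_delta mulr1 invrK.
  rewrite real_normK ?num_real//; set b := G y x _ _; set a := _ - g y x => h.
  have -> : b - k.+1%:R * a = - k.+1%:R * (a - k.+1%:R^-1 * b).
    by field; rewrite gt_eqF.
  rewrite normrM normrN (gtr0_norm k0) -ler_pdivlMl//.
  apply: le_trans h _; rewrite expr2 mulrA mulrC ler_wpM2l ?invr_ge0//.
  rewrite ler_pdivrMr// [leRHS]mulrC -ler_pdivrMr//.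
  apply: (@le_trans _ _ k%:R); last by rewrite ler_nat.
  by near: k; exact: nbhs_infty_ger.
apply: (@integ_le _ _ _ _ _ (fun y => `|g y (e + x) - g y x| + L / 2)) => //.
  apply: integD; last exact: integ_cst.
  by apply/integ_norm/integB.
move=> y; have := (gG y).1 x (e + x).
rewrite addrK dot_delta norm2_delta expr1n mulr1.
set a := g y _ - _; set b := G y x _ _ => h.
have -> : b = a - (a - b) by ring.
by apply: le_trans (ler_normB _ _) _; rewrite lerD2l.
Unshelve. all: by end_near. Qed.

Let mG x := \row_i mean Q (fun y => G y x ord0 i).

Let dot_mean v x : dot (mG x) v = mean Q (fun y => dot (G y x) v).
Proof.
rewrite /dot mean_sum => [|i]; last first.
  by under eq_fun do rewrite mulrC; exact/integZ/integ_smooth_grad.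
apply: eq_bigr => i _; rewrite mxE mulrC -meanZ; last exact: integ_smooth_grad.
by congr mean; apply/funext => y; rewrite mulrC.
Qed.

Let integ_dot v x : integ Q (fun y => dot (G y x) v).
Proof.
apply: integ_sum => i.
by under eq_fun do rewrite mulrC; exact/integZ/integ_smooth_grad.
Qed.

(** The Taylor bound is averaged directly. For the Lipschitz bound the difference D of the averaged
    gradients is tested against itself: |D|^2 is the mean of the sample differences paired with D,
    hence at most L |x - y| |D|, and one factor |D| cancels. *)
Lemma smooth_mean : smooth L (fun x => mean Q (g^~ x))
  (fun x => \row_i mean Q (fun y => G y x ord0 i)).
Proof.
split => [x y|x y].
  rewrite -/(mG x) dot_mean -!meanB//; last exact: integB.
  apply: mean_norm_le_cst => [|z]; last exact: (gG z).1.
  by apply: integB => //; exact: integB.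
rewrite -/(mG x) -/(mG y); set D := mG x - mG y.
have : dot D D <= norm2 D * (L * norm2 (x - y)).
  rewrite {1}/D dotBl !dot_mean -meanB//.
  apply: le_trans (ler_norm _) _.
  apply: mean_norm_le_cst => [|z]; first exact: integB.
  rewrite -dotBl mulrC; apply: le_trans (dot_le_norm2 _ _) _.
  by rewrite ler_wpM2r ?norm2_ge0//; exact: (gG z).2.
rewrite -norm2_sqr expr2.
have [->|D0] := eqVneq (norm2 D) 0; first by rewrite mulr_ge0 ?norm2_ge0.
by rewrite ler_pM2l// lt_neqAle eq_sym D0 norm2_ge0.
Qed.

End smooth_mean.

(** * The divergence theorem on the unit ball *)

Section lebesgue_affine.
Context {R : realType}.

Lemma measurable_affine (s v : R) :
  measurable_fun [set: measurableTypeR R] 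
    (fun y : measurableTypeR R => s * y + v : measurableTypeR R).
Proof. by apply: measurable_funD => //; exact: measurable_funM. Qed.

(** The image of Lebesgue measure, multiplied by s, gives every interval ]a, b] its length, so
    uniqueness identifies it with Lebesgue measure. *)
Lemma lebesgue_affine (s v : R) (A : set (measurableTypeR R)) : 0 < s ->
  measurable A ->
  (lebesgue_measure
    ((fun y : measurableTypeR R => (s * y + v)%R : measurableTypeR R) @^-1` A) =
  (s^-1)%:E * lebesgue_measure A)%E.
Proof.
move=> s0 mA.
pose nu := mscale (NngNum (ltW s0))
  (measure_function_pushforward__canonical__measure_function_Measure
    (@lebesgue_measure R) (measurable_affine s v)).
have -> : lebesgue_measure A = nu A.
  apply: lebesgue_measure_unique => // _ [[a b] _ <-] /=.
  rewrite /nu /mscale/= /pushforward.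
  have -> : (fun y : measurableTypeR R =>
      (s * y + v)%R : measurableTypeR R) @^-1` `]a, b]%classic =
      `](a - v) / s, (b - v) / s]%classic.
    apply/seteqP; split => y /=; rewrite !in_itv/=;
    by rewrite ltr_pdivrMr// ler_pdivlMr// ltrBlDr lerBrDr mulrC.
  rewrite !lebesgue_measure_itv/= !lte_fin ltr_pM2r ?invr_gt0// ltrD2r.
  case: ifPn => _; last by rewrite mule0.
  by rewrite -!EFinB -EFinM; congr _%:E; field; rewrite gt_eqF.
by rewrite /nu /mscale/= muleA -EFinM mulVf ?gt_eqF// mul1e.
Qed.

Definition affine_rV {n} (s : R) (v x : 'rV[R]_n) : 'rV[R]_n := s *: x + v.

Lemma measurable_affine_rV {n} (s : R) (v : 'rV[R]_n) :
  measurable_fun setT (affine_rV s v).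
Proof.
apply/measurable_fun_rVP => i; under eq_fun do rewrite !mxE.
apply: measurable_funD => //; apply: measurable_funM => //.
exact: measurable_rV_coord.
Qed.

(** Induction along the recursive definition of [lebesgue_rV]. Each fibre over the first n variables
    contributes one factor 1/s by the one-dimensional case; the integral over the base is a change
    of variables governed by the induction hypothesis. *)
Lemma lebesgue_rV_affine {n} (s : R) (v : 'rV[R]_n) (A : set 'rV[R]_n) : 0 < s ->
  measurable A ->
  (lebesgue_rV R n (affine_rV s v @^-1` A) =
   (s^-1 ^+ n)%:E * lebesgue_rV R n A)%E.
Proof.
move=> s0; elim: n => [|n IH] in v A *; move=> mA.
  rewrite expr0 mul1e; congr (lebesgue_rV R 0 _).
  by apply/seteqP; split => x /=; rewrite (_ : affine_rV s v x = x)//;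
    apply/rowP => -[].
rewrite [LHS]/(pushforward _ _ _)/= [in RHS]/(pushforward _ _ _)/=.
rewrite /pushforward /product_measure1/=.
set C := rV_cons @^-1` A.
have mC : measurable C.
  by rewrite -[C]setTI; exact: measurable_rV_cons.
pose v' : 'rV[R]_n := \row_j v ord0 (lift ord0 j).
pose h x := lebesgue_measure (xsection C x).
have mh : measurable_fun setT h by exact: measurable_fun_xsection.
transitivity (\int[lebesgue_rV R n]_x ((s^-1)%:E * h (affine_rV s v' x)))%E.
  apply: eq_integral => x _ /=; rewrite -(@lebesgue_affine s (v ord0 ord0))//; last first.
    exact: measurable_xsection.
  congr lebesgue_measure; apply/seteqP; split => y /=; rewrite /xsection/= !inE /C/=;
  rewrite (_ : affine_rV s v (rV_cons (x, y)) =
    rV_cons (affine_rV s v' x, s * y + v ord0 ord0))//;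
  by apply/rowP => i; rewrite !mxE; case: unliftP => [j ->|->]; rewrite /= ?mxE.
rewrite ge0_integralZl//; last 2 first.
- exact: measurableT_comp mh (measurable_affine_rV s v').
- by rewrite lee_fin invr_ge0 ltW.
rewrite exprS EFinM -muleA; congr (_ * _)%E.
transitivity (\int[pushforward (lebesgue_rV R n) (affine_rV s v')]_x h x)%E.
  rewrite (ge0_integral_pushforward (measurable_affine_rV s v'))//.
have si0 : 0 <= s^-1 ^+ n by rewrite exprn_ge0// invr_ge0 ltW.
rewrite -(@ge0_integral_mscale _ _ _ _ _ _ (NngNum si0))//.
apply: eq_measure_integral => [|mf B mB _]; first exact: measurable_affine_rV.
exact: IH.
Qed.
End lebesgue_affine.

Section cutoff.
Context {R : realType}.
Implicit Types (a b s : R).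

Let pos s := Num.max 0 s.

Let pos_sqr_taylor a b :
  `|pos b ^+ 2 - pos a ^+ 2 - 2 * pos a * (b - a)| <= (b - a) ^+ 2.
Proof.
rewrite /pos ler_norml.
have a2 := sqr_ge0 a; have b2 := sqr_ge0 b; have ab2 := sqr_ge0 (b - a).
case: (leP 0 b) => hb; case: (leP 0 a) => ha;
by apply/andP; split; nra.
Qed.

(* A quadratic spline decreasing from 1 on [s <= 0] to 0 on [1 <= s]. *)
Definition cutoff s :=
  1 - 2 * pos s ^+ 2 + 4 * pos (s - 1 / 2) ^+ 2 - 2 * pos (s - 1) ^+ 2.
(** Minus the derivative of [cutoff]; the sign makes it a nonnegative weight on the transition
    zone. *)
Definition cutoff_slope s :=
  4 * pos s - 8 * pos (s - 1 / 2) + 4 * pos (s - 1).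

(** Each squared positive part has Taylor remainder at most (b - a)^2, and 8 = 2 + 4 + 2 adds up the
    coefficients of the spline. *)
Lemma cutoff_taylor a b :
  `|cutoff b - cutoff a + cutoff_slope a * (b - a)| <= 8 * (b - a) ^+ 2.
Proof.
have := pos_sqr_taylor a b.
have := pos_sqr_taylor (a - 1 / 2) (b - 1 / 2).
have := pos_sqr_taylor (a - 1) (b - 1).
rewrite (_ : b - 1 - (a - 1) = b - a); last by ring.
rewrite (_ : b - 1 / 2 - (a - 1 / 2) = b - a); last by ring.
rewrite /cutoff /cutoff_slope !ler_norml => /andP[h1 h2] /andP[h3 h4] /andP[h5 h6].
by apply/andP; split; lra.
Qed.

Lemma cutoff1 s : s <= 0 -> cutoff s = 1.
Proof. by move=> s0; rewrite /cutoff /pos !max_l; [ring|lra..]. Qed.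

Lemma cutoff0 s : 1 <= s -> cutoff s = 0.
Proof. by move=> s0; rewrite /cutoff /pos !max_r; [field|lra..]. Qed.

Lemma cutoff_ge0 s : 0 <= cutoff s.
Proof.
rewrite /cutoff /pos; case: (leP 0 s) => h1; case: (leP 0 (s - 1 / 2)) => h2;
by case: (leP 0 (s - 1)) => h3; nra.
Qed.

Lemma cutoff_le1 s : cutoff s <= 1.
Proof.
rewrite /cutoff /pos; case: (leP 0 s) => h1; case: (leP 0 (s - 1 / 2)) => h2;
by case: (leP 0 (s - 1)) => h3; nra.
Qed.

Lemma cutoff_slope0 s : s <= 0 \/ 1 <= s -> cutoff_slope s = 0.
Proof.
rewrite /cutoff_slope /pos => -[] s0; first by rewrite !max_l; [ring|lra..].
by rewrite !max_r; [field|lra..].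
Qed.

Lemma cutoff_slope_ge0 s : 0 <= cutoff_slope s.
Proof.
rewrite /cutoff_slope /pos; case: (leP 0 s) => h1;
by case: (leP 0 (s - 1 / 2)) => h2; case: (leP 0 (s - 1)) => h3; lra.
Qed.

Lemma cutoff_slope_le s : cutoff_slope s <= 4.
Proof.
rewrite /cutoff_slope /pos; case: (leP 0 s) => h1;
by case: (leP 0 (s - 1 / 2)) => h2; case: (leP 0 (s - 1)) => h3; lra.
Qed.

Let measurable_pos c : measurable_fun setT (fun s => pos (s - c)).
Proof. by apply: measurable_maxr => //; exact: measurable_funB. Qed.

Let measurable_pos0 : measurable_fun setT pos.
Proof. exact: measurable_maxr. Qed.

Lemma measurable_cutoff : measurable_fun setT cutoff.
Proof.
apply: measurable_funB; [apply: measurable_funD; [apply: measurable_funB|]|] => //;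
by apply: measurable_funM => //; apply: measurable_funX.
Qed.

Lemma measurable_cutoff_slope : measurable_fun setT cutoff_slope.
Proof.
apply: measurable_funD; first (apply: measurable_funB => //);
by apply: measurable_funM.
Qed.

End cutoff.

(** Differentiates the identity of the means of X t and Y t at t = 0. The remainders are dominated
    by t^2 E with E integrable, so no limit is exchanged with the integral: the means of A and B
    differ by at most 2 t times the mean of E, for every small t. *)
Lemma mean_eq_first_order {R : realType} {d} {T : measurableType d}
    (mu : {measure set T -> \bar R}) (X Y : R -> T -> R) (A B E : T -> R) :
  integ mu A -> integ mu B -> integ mu E ->
  (forall t, 0 < t <= 1 -> [/\ integ mu (X t), integ mu (Y t) &
    mean mu (X t) = mean mu (Y t)]) ->
  (forall t u, 0 < t <= 1 -> `|X t u - t * A u| <= t ^+ 2 * E u) ->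
  (forall t u, 0 < t <= 1 -> `|Y t u - t * B u| <= t ^+ 2 * E u) ->
  mean mu A = mean mu B.
Proof.
move=> iA iB iE XY XA YB.
set a := mean mu A; set b := mean mu B; set e := mean mu E.
have key t : 0 < t <= 1 -> `|a - b| <= 2 * t * e.
  move=> t01; have [iX iY XYt] := XY t t01; have /andP[t0 _] := t01.
  have hX : `|mean mu (X t) - t * a| <= t ^+ 2 * e.
    rewrite -!meanZ// -meanB//; last exact: integZ.
    apply: mean_norm_le => [||u]; [apply: integB => //; exact: integZ|
      exact: integZ|exact: XA].
  have hY : `|mean mu (Y t) - t * b| <= t ^+ 2 * e.
    rewrite -!meanZ// -meanB//; last exact: integZ.
    apply: mean_norm_le => [||u]; [apply: integB => //; exact: integZ|
      exact: integZ|exact: YB].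
  rewrite -(ler_pM2l t0) -{1}(gtr0_norm t0) -normrM.
  move: hX hY; rewrite XYt !ler_norml => /andP[h1 h2] /andP[h3 h4].
  by apply/andP; split; rewrite expr2 in h1 h2 h3 h4; lra.
apply/eqP; rewrite -subr_eq0 -normr_eq0; apply/negPn/negP => D0.
have D1 : 0 < `|a - b| by rewrite lt_neqAle eq_sym D0 normr_ge0.
have e0 : 0 <= e by have := key 1; rewrite ltr01 lexx => /(_ isT); lra.
set D := `|a - b| in key D1.
have S0 : 0 < D + 4 * e + 1 by lra.
(* This t lies in ]0, 1] and makes 2 t e strictly smaller than D, which contradicts [key]. *)
have := key (D / (D + 4 * e + 1)); rewrite divr_gt0// ler_pdivrMr// mul1r.
have -> : D <= D + 4 * e + 1 by lra.
move=> /(_ isT).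
have -> : 2 * (D / (D + 4 * e + 1)) * e = (2 * e * D) / (D + 4 * e + 1).
  by field; rewrite gt_eqF.
by rewrite ler_pdivlMr//; nra.
Qed.

Lemma smooth_ball_bound {R : realType} {n} (L a : R) (g : 'rV[R]_n -> R) G :
  0 <= L -> 0 <= a -> smooth L g G -> exists C : R, 0 <= C /\
  forall u, norm2 u <= a -> [/\ `|g u| <= C, forall i, `|G u ord0 i| <= C &
    forall v, norm2 v <= a -> `|g u - g v| <= C * norm2 (u - v)].
Proof.
move=> L0 a0 [h1 h2].
set D := norm2 (G 0) + L * a.
have D0 : 0 <= D by rewrite addr_ge0 ?mulr_ge0 ?norm2_ge0.
have La : 0 <= L * a by rewrite mulr_ge0.
have GD u : norm2 u <= a -> norm2 (G u) <= D.
  move=> ua; have -> : G u = G 0 + (G u - G 0) by rewrite addrC subrK.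
  apply: le_trans (norm2D _ _) _; rewrite lerD2l; apply: le_trans (h2 _ _) _.
  by rewrite subr0 ler_wpM2l.
have lip u v : norm2 u <= a -> norm2 v <= a ->
    `|g u - g v| <= (D + L * a) * norm2 (u - v).
  move=> ua va; have := h1 v u; have := dot_le_norm2 (G v) (u - v).
  have uv : norm2 (u - v) <= 2 * a.
    by apply: le_trans (norm2D _ _) _; rewrite norm2N; lra.
  have := GD v va.
  set m := norm2 (G v); set r := norm2 (u - v) in uv *; set x := g u - g v.
  set z := dot _ _ => mD h3 h4.
  have r0 : 0 <= r by exact: norm2_ge0.
  have -> : x = z + (x - z) by ring.
  apply: le_trans (ler_normD _ _) _; rewrite mulrDl lerD//.
    by apply: le_trans h3 _; rewrite ler_wpM2r.
  apply: le_trans h4 _; rewrite expr2 mulrA ler_wpM2r//.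
  have : L * r <= L * (2 * a) by rewrite ler_wpM2l.
  lra.
exists (`|g 0| + (D + L * a) * (1 + a)); split.
  by rewrite addr_ge0// mulr_ge0//; lra.
have DL : 0 <= D + L * a by lra.
have X : 0 <= (D + L * a) * a by rewrite mulr_ge0.
move=> u ua; split=> [|i|v va].
- have -> : g u = g 0 + (g u - g 0) by ring.
  apply: le_trans (ler_normD _ _) _; rewrite lerD2l.
  have z0 : norm2 (0 : 'rV[R]_n) <= a by rewrite norm2_0.
  have := lip u 0 ua z0; rewrite subr0 => H; apply: le_trans H _.
  by rewrite ler_wpM2l//; lra.
- apply: le_trans (coord_le_norm2 _ _) _; apply: le_trans (GD _ ua) _.
  by have := normr_ge0 (g 0); lra.
apply: le_trans (lip _ _ ua va) _; rewrite ler_wpM2r ?norm2_ge0//.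
by have := normr_ge0 (g 0); lra.
Qed.

(** * Integrals of bounded functions supported in a ball, and their change of variables *)

Section lebesgue_mean.
Context {R : realType} {n : nat}.
Notation lam := (lebesgue_rV R n).
Implicit Types (f : 'rV[R]_n -> R) (u v : 'rV[R]_n).

(** The indicator is a real factor of the integrand, so that restriction to a ball obeys the same
    linear rules as the smooth cutoff that approximates it. *)
Definition inball (a : R) u : R := (norm2 u <= a)%R%:R.

Lemma inball_ge0 a u : 0 <= inball a u.
Proof. exact: ler0n. Qed.

Lemma measurable_inball a : measurable_fun setT (inball a).
Proof.
rewrite (_ : inball a = \1_(@norm2 R n @^-1` `]-oo, a])); last first.
  apply/funext => u; rewrite indicE /inball; congr (nat_of_bool _)%:R.
  by apply/idP/idP => [ua|/set_mem]; rewrite ?inE /= in_itv.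
apply: measurable_indic; rewrite -[X in measurable X]setTI.
by apply: measurable_norm2 => //; exact: measurable_itv.
Qed.

Lemma integ_inball a : integ lam (inball a).
Proof.
pose b := `|a| + 1; have b0 : 0 < b by rewrite ltr_wpDl.
have [mC CE] := lebesgue_rV_cube n b0.
set C := [set x | _] in mC CE.
apply: (@integ_le _ _ _ _ _ (\1_C)) => [||u].
- exact: measurable_inball.
- apply/integrableP; split; first exact/measurable_EFinP/measurable_indic.
  under eq_integral do rewrite /= ger0_norm//.
  by rewrite integral_indic// setIT CE ltry.
rewrite ger0_norm ?inball_ge0// /inball indicE ler_nat.
case: (leP (norm2 u) a) => //= ua; rewrite mem_set//= => i.
rewrite in_itv/= -ler_norml (le_trans (coord_le_norm2 _ _))//.
by rewrite (le_trans ua)// (le_trans (ler_norm _))// lerDl.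
Qed.

Lemma integ_supp (a : R) f (C : R) : measurable_fun setT f ->
  (forall u, norm2 u <= a -> `|f u| <= C) ->
  (forall u, a < norm2 u -> f u = 0) -> integ lam f.
Proof.
move=> mf fC f0; apply: (@integ_le _ _ _ _ _ (fun u => C * inball a u)) => // [|u].
  exact/integZ/integ_inball.
rewrite /inball; case: (leP (norm2 u) a) => [/fC|/f0 ->]; first by rewrite mulr1.
by rewrite normr0 mulr0.
Qed.

Lemma ge0_integral_affine (s : R) v (f : 'rV[R]_n -> \bar R) : 0 < s ->
  measurable_fun setT f -> (forall u, 0 <= f u)%E ->
  (\int[lam]_u f (affine_rV s v u) = (s^-1 ^+ n)%:E * \int[lam]_u f u)%E.
Proof.
move=> s0 mf f0.
transitivity (\int[pushforward lam (affine_rV s v)]_x f x)%E.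
  by rewrite (ge0_integral_pushforward (measurable_affine_rV s v)).
have si0 : 0 <= s^-1 ^+ n by rewrite exprn_ge0// invr_ge0 ltW.
rewrite -(@ge0_integral_mscale _ _ _ _ _ _ (NngNum si0))//.
apply: eq_measure_integral => [|m B mB _]; first exact: measurable_affine_rV.
exact: lebesgue_rV_affine.
Qed.

(** The identity between measures gives the formula for nonnegative integrands; a signed one is
    split into its positive and negative parts. *)
Lemma mean_affine (s : R) v f : 0 < s -> integ lam f ->
  mean lam (fun u => f (affine_rV s v u)) = s^-1 ^+ n * mean lam f.
Proof.
move=> s0 hf; have mf := measurable_int _ hf.
rewrite /mean /Rintegral -[X in X * _](_ : fine (s^-1 ^+ n)%:E = _)//.
rewrite -fineM//; last exact: integrable_fin_num hf.
congr fine; rewrite integralE [X in (_ * X)%E]integralE muleBr//; last first.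
  have := integrable_pos_fin_num measurableT hf.
  by move=> /fin_num_adde_defr; apply.
congr (_ - _)%E.
  rewrite -(@ge0_integral_affine s v (EFin \o f)^\+%E)//.
    by apply: eq_integral => u _; rewrite !funeposE.
  exact: measurable_funepos.
rewrite -(@ge0_integral_affine s v (EFin \o f)^\-%E)//.
  by apply: eq_integral => u _; rewrite !funenegE.
exact: measurable_funeneg.
Qed.

End lebesgue_mean.

(** The volume factor of the dilation by 1 + t to first order; the remainder must be uniform on ]0,
    1] to fit [mean_eq_first_order]. *)
Lemma exprV1D_first_order {R : realType} (n : nat) : exists C : R, 0 <= C /\
  forall t : R, 0 < t <= 1 -> `|((1 + t)^-1) ^+ n - 1 + n%:R * t| <= t ^+ 2 * C.
Proof.
elim: n => [|n [C [C0 IH]]].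
  by exists 0; split => // t _; rewrite expr0 subrr mul0r add0r normr0 mulr0.
exists (n%:R + (1 + n%:R) + C); split; first by rewrite !addr_ge0.
move=> t /[dup] t01 /andP[t0 t1]; have := IH _ t01.
rewrite [_ ^+ n.+1]exprSr; set a := _^-1 ^+ n; set r := a - 1 + _ => hr.
have p0 : 0 < 1 + t by lra.
have -> : a * (1 + t)^-1 - 1 + n.+1%:R * t =
    n%:R * t ^+ 2 + (1 - n%:R * t) * (t ^+ 2 * (1 + t)^-1) + r * (1 + t)^-1.
  by rewrite /r -natr1; field; rewrite gt_eqF.
have k1 : (1 + t)^-1 <= 1 by rewrite invf_le1//; lra.
have k0 : 0 <= (1 + t)^-1 by rewrite invr_ge0 ltW.
have t20 : 0 <= t ^+ 2 := sqr_ge0 t.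
have n0 : 0 <= n%:R :> R by [].
rewrite !mulrDr; apply: le_trans (ler_normD _ _) _; apply: lerD.
  apply: le_trans (ler_normD _ _) _; apply: lerD.
    by rewrite ger0_norm; [rewrite mulrC|exact: mulr_ge0].
  rewrite -mulrDr normrM mulrC; apply: ler_pM => //.
    by rewrite (ger0_norm (mulr_ge0 t20 k0)) ler_piMr.
  apply: le_trans (ler_normB _ _) _; rewrite normr1 lerD2l.
  by rewrite (ger0_norm (mulr_ge0 n0 (ltW t0))) ler_piMr.
by rewrite normrM (ger0_norm k0) (le_trans _ hr)// ler_piMr.
Qed.

(** The chord bound for a convex function between t = 0 and t = 1. With t = 1/N it shows that the
    shell between the radii 1 and 1 + 1/N has volume O(1/N). *)
Lemma expr1D_le {R : realType} (n : nat) (t : R) : 0 < t <= 1 ->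
  (1 + t) ^+ n <= 1 + (2 ^+ n - 1) * t.
Proof.
move=> /andP[t0 t1]; elim: n => [|n IH].
  by rewrite !expr0 subrr mul0r addr0.
rewrite !exprSr; apply: le_trans (ler_wpM2r _ IH) _; first by lra.
have p1 : 1 <= 2 ^+ n :> R by rewrite exprn_ege1// ler1n.
set p := 2 ^+ n in p1 *.
have : 0 <= (p - 1) * t * (1 - t) by rewrite !mulr_ge0//; lra.
lra.
Qed.

(** * Integration by parts against a radial cutoff *)

Section divergence.
Context {R : realType} {n : nat}.
Notation lam := (lebesgue_rV R n).
Implicit Types (u v : 'rV[R]_n).

Lemma norm2_normalize_le1 u : norm2 (normalize_rV u) <= 1.
Proof.
rewrite /normalize_rV norm2Z ger0_norm ?invr_ge0 ?norm2_ge0//.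
have [->|u0] := eqVneq (norm2 u) 0; first by rewrite mulr0.
by rewrite mulVf.
Qed.

Lemma normalizeZ (s : R) u : 0 < s -> normalize_rV (s *: u) = normalize_rV u.
Proof.
move=> s0; rewrite /normalize_rV norm2Z gtr0_norm// scalerA invfM.
by rewrite mulrAC mulVf ?gt_eqF// mul1r.
Qed.

Lemma measurable_dotxx : measurable_fun setT (fun u => dot u u).
Proof.
apply: measurable_sum => i; apply: measurable_funM; exact: measurable_rV_coord.
Qed.

Lemma measurable_translate v : measurable_fun setT (fun u : 'rV[R]_n => u + v).
Proof.
apply/measurable_fun_rVP => i; under eq_fun do rewrite mxE.
apply: measurable_funD => //; exact: measurable_rV_coord.
Qed.

Lemma measurable_scale_rV (s : R) :
  measurable_fun setT (fun u : 'rV[R]_n => s *: u).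
Proof.
apply/measurable_fun_rVP => i; under eq_fun do rewrite mxE.
apply: measurable_funM => //; exact: measurable_rV_coord.
Qed.

(** The cutoff is taken in |u|^2, which is polynomial, so it has no singularity at the origin and
    its gradient is a multiple of u. The transition happens for |u|^2 between 1 and 1 + 1/N, hence
    inside the shell between the radii 1 and 1 + 1/N. *)
Definition ball_cutoff (N : R) u : R := cutoff (N * (dot u u - 1)).
Definition ball_cutoff_slope (N : R) u : R := cutoff_slope (N * (dot u u - 1)).

Lemma measurable_ball_cutoff N : measurable_fun setT (ball_cutoff N).
Proof.
apply: measurableT_comp (measurable_cutoff) _; apply: measurable_funM => //.
by apply: measurable_funB => //; exact: measurable_dotxx.
Qed.

Lemma measurable_ball_cutoff_slope N :
  measurable_fun setT (ball_cutoff_slope N).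
Proof.
apply: measurableT_comp (measurable_cutoff_slope) _; apply: measurable_funM => //.
by apply: measurable_funB => //; exact: measurable_dotxx.
Qed.

Lemma ball_cutoff_norm_le1 N u : `|ball_cutoff N u| <= 1.
Proof. by rewrite ger0_norm ?cutoff_ge0// cutoff_le1. Qed.

Lemma ball_cutoff_slope_norm_le4 N u : `|ball_cutoff_slope N u| <= 4.
Proof. by rewrite ger0_norm ?cutoff_slope_ge0// cutoff_slope_le. Qed.

Lemma outside_cutoff N u : 0 < N -> 1 + N^-1 < norm2 u ->
  1 <= N * (dot u u - 1).
Proof.
move=> N0 h; have i0 : 0 < N^-1 by rewrite invr_gt0.
rewrite -ler_pdivrMl// mulr1 -norm2_sqr expr2.
have : 0 <= (norm2 u - 1) * norm2 u by rewrite mulr_ge0 ?norm2_ge0//; lra.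
lra.
Qed.

Lemma ball_cutoff_out N u : 0 < N -> 1 + N^-1 < norm2 u -> ball_cutoff N u = 0.
Proof. by move=> N0 h; apply/cutoff0/outside_cutoff. Qed.

Lemma ball_cutoff_slope_out N u : 0 < N -> 1 + N^-1 < norm2 u ->
  ball_cutoff_slope N u = 0.
Proof. by move=> N0 h; apply: cutoff_slope0; right; exact: outside_cutoff. Qed.

Lemma inside_cutoff N u : 0 < N -> norm2 u <= 1 -> N * (dot u u - 1) <= 0.
Proof.
move=> N0 h; rewrite pmulr_rle0// -norm2_sqr subr_le0 expr_le1//.
exact: norm2_ge0.
Qed.

Lemma ball_cutoff_in N u : 0 < N -> norm2 u <= 1 -> ball_cutoff N u = 1.
Proof. by move=> N0 h; apply/cutoff1/inside_cutoff. Qed.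

Lemma ball_cutoff_slope_in N u : 0 < N -> norm2 u <= 1 ->
  ball_cutoff_slope N u = 0.
Proof. by move=> N0 h; apply: cutoff_slope0; left; exact: inside_cutoff. Qed.

Lemma ball_cutoff_taylor N u v :
  `|ball_cutoff N v - ball_cutoff N u +
    N * ball_cutoff_slope N u * (dot v v - dot u u)| <=
  8 * N ^+ 2 * (dot v v - dot u u) ^+ 2.
Proof.
have := cutoff_taylor (N * (dot u u - 1)) (N * (dot v v - 1)).
rewrite -/(ball_cutoff N u) -/(ball_cutoff N v) -/(ball_cutoff_slope N u).
rewrite -mulrBr (_ : dot v v - 1 - (dot u u - 1) = dot v v - dot u u); last by ring.
by rewrite exprMn !mulrA (mulrC (ball_cutoff_slope N u)).
Qed.

(* First variation of [mean lam (ball_cutoff N * g)] under the translations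
   [u + t *: e_i], which preserve [lam]. *)
Lemma mean_cutoff_grad (N L : R) (g : 'rV[R]_n -> R) G i :
  1 <= N -> 0 <= L -> smooth L g G ->
  mean lam (fun u => ball_cutoff N u * G u ord0 i) =
  mean lam (fun u => 2 * N * ball_cutoff_slope N u * (u ord0 i * g u)).
Proof.
move=> N1 L0 sm; have N0 : 0 < N by exact: lt_le_trans ltr01 N1.
have Ni : N^-1 <= 1 by rewrite invf_le1.
have mphi := measurable_ball_cutoff N.
have mom := measurable_ball_cutoff_slope N.
have phi1 := ball_cutoff_norm_le1 N.
have om4 := ball_cutoff_slope_norm_le4 N.
 (* The cutoff lives in radius 2 and a translation has length at most 1, so every integrand is
    supported in radius 3, where g is evaluated at points of norm at most 4. *)
 have [C [C0 bC]] := smooth_ball_bound L0 (ler0n R 4) sm.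
have mg : measurable_fun setT g by exact: measurable_calm (smooth_calm L0 sm).
have mG : measurable_fun setT (fun u => G u ord0 i).
  exact: measurable_calm (smooth_calm_grad i sm).
pose e : 'rV[R]_n := delta_mx ord0 i.
(* L/2 is the Taylor remainder of g. The rest is that of the cutoff times a bound of g: 49 = (1 + 2
   * 3)^2 bounds (t - 2 u_i)^2, and 4 N bounds the slope term left by the t^2 in the increment of
   |u|^2. *)
pose K := L / 2 + C * ((8 * 49) * N ^+ 2 + 4 * N).
have K1 : 0 <= C * ((8 * 49) * N ^+ 2 + 4 * N).
  by have := sqr_ge0 N; move=> ?; rewrite mulr_ge0//; lra.
have nte t : 0 < t <= 1 -> norm2 (t *: e) <= 1.
  by move=> /andP[t0 t1]; rewrite norm2Z norm2_delta mulr1 gtr0_norm.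
have far t u : 0 < t <= 1 -> 3 < norm2 u -> 1 + N^-1 < norm2 (u - t *: e).
  move=> /nte te u3; have := norm2D (u - t *: e) (t *: e).
  by rewrite subrK; lra.
have bnd3 u : norm2 u <= 3 -> `|g u| <= C.
  by move=> u3; have [] := bC u; first lra.
have iphig : integ lam (fun u => ball_cutoff N u * g u).
  apply: (@integ_supp _ _ 3 _ C) => [|u u3|u u3].
  - exact: measurable_funM.
  - by rewrite normrM -[leRHS]mul1r ler_pM// bnd3.
  - by rewrite ball_cutoff_out ?mul0r//; lra.
(* X translates g by t e_i, Y translates the cutoff by -t e_i; the means agree by invariance. To
   first order the derivative falls on g in X and on the cutoff in Y, which is the integration by
   parts. *)
apply: (@mean_eq_first_order _ _ _ lam
  (fun t u => ball_cutoff N u * g (u + t *: e) - ball_cutoff N u * g u)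
  (fun t u => ball_cutoff N (u - t *: e) * g u - ball_cutoff N u * g u) _ _
  (fun u => K * inball 3 u)).
- apply: (@integ_supp _ _ 3 _ C) => [|u u3|u u3].
  + exact: measurable_funM.
  + rewrite normrM -[leRHS]mul1r ler_pM//.
    by have [_ h _] := bC u ltac:(lra); exact: h.
  + by rewrite ball_cutoff_out ?mul0r//; lra.
- apply: (@integ_supp _ _ 3 _ (2 * N * 4 * (3 * C))) => [|u u3|u u3].
  + apply: measurable_funM; first exact: measurable_funM.
    by apply: measurable_funM => //; exact: measurable_rV_coord.
  + rewrite normrM ler_pM// normrM ler_pM//.
      by rewrite ger0_norm// mulr_ge0// ltW.
      by rewrite (le_trans (coord_le_norm2 _ _)).
    exact: bnd3.
  + by rewrite ball_cutoff_slope_out ?mulr0 ?mul0r//; lra.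
- exact/integZ/integ_inball.
- move=> t t01.
  have i1 : integ lam (fun u => ball_cutoff N u * g (u + t *: e)).
    apply: (@integ_supp _ _ 3 _ C) => [|u u3|u u3].
    - apply: measurable_funM => //.
      exact: measurableT_comp mg (measurable_translate _).
    - rewrite normrM -[leRHS]mul1r ler_pM//.
      have [] := bC (u + t *: e) => //.
      by have := norm2D u (t *: e); have := nte t t01; lra.
    - by rewrite ball_cutoff_out ?mul0r//; lra.
  have i2 : integ lam (fun u => ball_cutoff N (u - t *: e) * g u).
    apply: (@integ_supp _ _ 3 _ C) => [|u u3|u u3].
    - apply: measurable_funM => //.
      exact: measurableT_comp (@measurable_ball_cutoff N) (measurable_translate _).
    - by rewrite normrM -[leRHS]mul1r ler_pM// bnd3.
    - by rewrite ball_cutoff_out ?mul0r//; exact: far.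
  split; [exact: integB|exact: integB|].
  rewrite !meanB//; congr (_ - _).
  have := mean_affine (t *: e) ltr01 i2.
  rewrite invr1 expr1n mul1r => <-; congr mean; apply/funext => u.
  by rewrite /affine_rV scale1r addrK.
- move=> t u t01; have /andP[t0 t1] := t01; rewrite mulrCA.
  rewrite -mulrBr -mulrBr /inball.
  case: (leP (norm2 u) 3) => u3; last first.
    by rewrite ball_cutoff_out ?mul0r ?normr0 ?mulr0//; lra.
  rewrite normrM mulr1 -[leRHS]mul1r ler_pM//.
  have := sm.1 u (u + t *: e); rewrite (addrC u) addrK dotZr dot_delta.
  rewrite norm2Z norm2_delta mulr1 real_normK ?num_real// => h.
  apply: le_trans h _; rewrite mulrC ler_wpM2l ?sqr_ge0// /K lerDl//.
move=> t u t01; have /andP[t0 t1] := t01; rewrite /inball.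
case: (leP (norm2 u) 3) => u3; last first.
  rewrite (ball_cutoff_out N0 (far _ _ t01 u3)).
  rewrite ball_cutoff_out ?ball_cutoff_slope_out; try lra.
  by rewrite !(mulr0, mul0r) !subr0 normr0.
rewrite mulr1; set v := u - t *: e.
have := ball_cutoff_taylor N u v.
have -> : dot v v - dot u u = t * (t - 2 * u ord0 i).
  rewrite /v !(dotBl, dotBr, dotZl, dotZr) (dotC e u) !dot_delta mxE !eqxx.
  by rewrite mulr1; ring.
set r := _ + N * ball_cutoff_slope N u * _ => hr.
have -> : ball_cutoff N v * g u - ball_cutoff N u * g u -
    t * (2 * N * ball_cutoff_slope N u * (u ord0 i * g u)) =
   (r - N * ball_cutoff_slope N u * t ^+ 2) * g u by rewrite /r; ring.
rewrite normrM mulrC.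
have hg := bnd3 u u3.
have -> : t ^+ 2 * K = t ^+ 2 * (L / 2) + C * (t ^+ 2 * ((8 * 49) * N ^+ 2 + 4 * N)).
  by rewrite /K; ring.
apply: (@le_trans _ _ (C * (t ^+ 2 * ((8 * 49) * N ^+ 2 + 4 * N)))); last first.
  by rewrite lerDr mulr_ge0 ?sqr_ge0// divr_ge0.
apply: ler_pM => //; apply: le_trans (ler_normB _ _) _.
rewrite [leRHS]mulrDr; apply: lerD.
  apply: le_trans hr _; rewrite exprMn.
  have ui := le_trans (coord_le_norm2 u i) u3; rewrite ler_norml in ui.
  have h49 : (t - 2 * u ord0 i) ^+ 2 <= 49 by nra.
  have : 0 <= t ^+ 2 * N ^+ 2 by rewrite mulr_ge0 ?sqr_ge0.
  set a := t ^+ 2 * N ^+ 2 => a0.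
  have -> : 8 * N ^+ 2 * (t ^+ 2 * (t - 2 * u ord0 i) ^+ 2) =
     8 * (a * (t - 2 * u ord0 i) ^+ 2) by rewrite /a; ring.
  have : a * (t - 2 * u ord0 i) ^+ 2 <= a * 49 by rewrite ler_wpM2l.
  have -> : t ^+ 2 * ((8 * 49) * N ^+ 2) = (8 * 49) * a by rewrite /a; ring.
  lra.
rewrite normrM [`|N * _|]normrM (gtr0_norm N0) (ger0_norm (sqr_ge0 t)) mulrC.
rewrite ler_wpM2l ?sqr_ge0// mulrC ler_wpM2r// ltW//.
Qed.

(* First variation under the dilations [(1 + t) *: u], which leave [h] unchanged
   and scale [lam] by [(1 + t) ^+ n]. *)
Lemma mean_cutoff_radial (N : R) (h : 'rV[R]_n -> R) (H : R) : 1 <= N ->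
  measurable_fun setT h -> (forall u, `|h u| <= H) ->
  (forall (s : R) u, 0 < s -> h (s *: u) = h u) ->
  n%:R * mean lam (fun u => ball_cutoff N u * h u) =
  mean lam (fun u => 2 * N * ball_cutoff_slope N u * (dot u u * h u)).
Proof.
move=> N1 mh hH hom; have N0 : 0 < N by exact: lt_le_trans ltr01 N1.
have Ni : N^-1 <= 1 by rewrite invf_le1.
have mphi := measurable_ball_cutoff N.
have mom := measurable_ball_cutoff_slope N.
have phi1 := ball_cutoff_norm_le1 N.
have om4 := ball_cutoff_slope_norm_le4 N.
 have [C [C0 bC]] := @exprV1D_first_order R n.
have H0 : 0 <= H by exact: le_trans (hH 0).
have iphih : integ lam (fun u => ball_cutoff N u * h u).
  apply: (@integ_supp _ _ 3 _ H) => [|u u3|u u3].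
  - exact: measurable_funM.
  - by rewrite normrM -[leRHS]mul1r ler_pM.
  - by rewrite ball_cutoff_out ?mul0r//; lra.
have iB : integ lam (fun u => 2 * N * ball_cutoff_slope N u * (dot u u * h u)).
  apply: (@integ_supp _ _ 3 _ (2 * N * 4 * (9 * H))) => [|u u3|u u3].
  - apply: measurable_funM; first exact: measurable_funM.
    by apply: measurable_funM => //; exact: measurable_dotxx.
  - rewrite normrM ler_pM// normrM ler_pM//.
      by rewrite ger0_norm// mulr_ge0// ltW.
    rewrite ger0_norm ?dotxx_ge0// -norm2_sqr expr2.
    by apply: le_trans (ler_pM _ _ u3 u3) _; rewrite ?norm2_ge0//; lra.
  - by rewrite ball_cutoff_slope_out ?mulr0 ?mul0r//; lra.
(* In radius 3 with t <= 1, |u|^2 <= 9 and (2 + t)|u|^2 <= 27; these enter the Taylor bound of the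
   cutoff. C H is the remainder of the volume factor. *)
pose K := H * ((8 * (27 * 27)) * N ^+ 2 + (4 * 9) * N) + C * H.
have K1 : 0 <= H * ((8 * (27 * 27)) * N ^+ 2 + (4 * 9) * N).
  by have := sqr_ge0 N; move=> ?; rewrite mulr_ge0//; lra.
rewrite -meanZ//.
(* Composing the cutoff with an expansion makes it smaller, so both first variations carry a minus
   sign; the comparison is made between the negated sides. *)
have neg (f : 'rV[R]_n -> R) : integ lam f ->
  mean lam f = - mean lam (fun u => -1 * f u) by move=> hf; rewrite meanZ//; ring.
rewrite neg ?[RHS]neg//; last exact: integZ.
congr (- _); apply: esym.
apply: (@mean_eq_first_order _ _ _ lam
  (fun t u => ball_cutoff N ((1 + t) *: u) * h u - ball_cutoff N u * h u)
  (fun t u => ((1 + t)^-1 ^+ n - 1) * (ball_cutoff N u * h u)) _ _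
  (fun u => K * inball 3 u)).
- exact: integZ.
- exact/integZ/integZ.
- exact/integZ/integ_inball.
- move=> t t01; have /andP[t0 t1] := t01.
  have p0 : 0 < 1 + t by lra.
  have i1 : integ lam (fun u => ball_cutoff N ((1 + t) *: u) * h u).
    apply: (@integ_supp _ _ 3 _ H) => [|u u3|u u3].
    - apply: measurable_funM => //.
      exact: measurableT_comp (@measurable_ball_cutoff N) (measurable_scale_rV _).
    - by rewrite normrM -[leRHS]mul1r ler_pM.
    - rewrite ball_cutoff_out ?mul0r// norm2Z gtr0_norm//.
      by have := mulr_ge0 (ltW t0) (norm2_ge0 u); lra.
  split; [exact: integB|exact: integZ|].
  rewrite meanZ// meanB// mulrBl mul1r; congr (_ - _).
  rewrite -(mean_affine 0 p0 iphih); congr mean; apply/funext => u.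
  by rewrite /affine_rV addr0 hom.
- move=> t u t01; have /andP[t0 t1] := t01; have p0 : 0 < 1 + t by lra.
  rewrite /inball; case: (leP (norm2 u) 3) => u3; last first.
    have fu : 1 + N^-1 < norm2 u by lra.
    have fv : 1 + N^-1 < norm2 ((1 + t) *: u).
      rewrite norm2Z gtr0_norm//.
      by have := mulr_ge0 (ltW t0) (norm2_ge0 u); lra.
    rewrite (ball_cutoff_out N0 fu) (ball_cutoff_out N0 fv).
    rewrite (ball_cutoff_slope_out N0 fu).
    by rewrite !(mulr0, mul0r) !subr0 normr0.
  rewrite mulr1; set v := (1 + t) *: u; have := ball_cutoff_taylor N u v.
  have -> : dot v v - dot u u = t * ((2 + t) * dot u u).
    by rewrite /v dotZl dotZr; ring.
  set r := _ + N * ball_cutoff_slope N u * _ => hr.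
  have -> : ball_cutoff N v * h u - ball_cutoff N u * h u -
      t * (-1 * (2 * N * ball_cutoff_slope N u * (dot u u * h u)))
     = h u * (r - N * ball_cutoff_slope N u * t ^+ 2 * dot u u) by rewrite /r; ring.
  have q9 : dot u u <= 9.
    rewrite -norm2_sqr expr2.
    by apply: le_trans (ler_pM _ _ u3 u3) _; rewrite ?norm2_ge0//; lra.
  have q0 := dotxx_ge0 u; set q := dot u u in hr q9 q0 *.
  rewrite normrM.
  have -> : t ^+ 2 * K =
    H * (t ^+ 2 * ((8 * (27 * 27)) * N ^+ 2 + (4 * 9) * N)) + t ^+ 2 * (C * H).
    by rewrite /K; ring.
  apply: (@le_trans _ _
    (H * (t ^+ 2 * ((8 * (27 * 27)) * N ^+ 2 + (4 * 9) * N)))); last first.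
    by rewrite lerDl; apply: mulr_ge0; [exact: sqr_ge0|exact: mulr_ge0].
  apply: ler_pM => //; apply: le_trans (ler_normB _ _) _.
  rewrite [leRHS]mulrDr; apply: lerD.
    apply: le_trans hr _; rewrite exprMn.
    have a0 : 0 <= t ^+ 2 * N ^+ 2 by rewrite mulr_ge0 ?sqr_ge0.
    have -> : 8 * N ^+ 2 * (t ^+ 2 * ((2 + t) * q) ^+ 2) =
      8 * (t ^+ 2 * N ^+ 2 * ((2 + t) * q) ^+ 2) by ring.
    have -> : t ^+ 2 * ((8 * (27 * 27)) * N ^+ 2) =
      8 * (t ^+ 2 * N ^+ 2 * (27 * 27)) by ring.
    rewrite ler_wpM2l// ler_wpM2l//.
    have b0 : 0 <= (2 + t) * q by rewrite mulr_ge0//; lra.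
    have b27 : (2 + t) * q <= 3 * 9 by rewrite ler_pM//; lra.
    by rewrite expr2 (le_trans (ler_pM b0 b0 b27 b27))//; lra.
  rewrite normrM [`|_ * t ^+ 2|]normrM [`|N * _|]normrM.
  rewrite (gtr0_norm N0) (ger0_norm (sqr_ge0 t)) (ger0_norm q0).
  have -> : N * `|ball_cutoff_slope N u| * t ^+ 2 * q =
    t ^+ 2 * (`|ball_cutoff_slope N u| * q * N) by ring.
  rewrite ler_wpM2l ?sqr_ge0// ler_wpM2r ?(ltW N0)//.
  by rewrite ler_pM.
move=> t u t01; rewrite /inball; case: (leP (norm2 u) 3) => u3; last first.
  by rewrite ball_cutoff_out ?(mulr0, mul0r) ?subrr ?normr0//; lra.
have -> : ((1 + t)^-1 ^+ n - 1) * (ball_cutoff N u * h u) -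
    t * (-1 * (n%:R * (ball_cutoff N u * h u)))
  = ((1 + t)^-1 ^+ n - 1 + n%:R * t) * (ball_cutoff N u * h u) by ring.
rewrite normrM mulr1 /K mulrDr.
apply: (@le_trans _ _ (t ^+ 2 * C * H)); last first.
  by rewrite -[leLHS]mulrA lerDr; apply: mulr_ge0; [exact: sqr_ge0|exact: K1].
apply: ler_pM => //; first exact: bC.
by rewrite normrM -[leRHS]mul1r ler_pM.
Qed.

End divergence.

(** * From the cutoff to the indicator of the ball *)

Section divergence_ball.
Context {R : realType} {n : nat}.
Notation lam := (lebesgue_rV R n).
Implicit Types (u v : 'rV[R]_n) (f : 'rV[R]_n -> R).

Lemma measurable_inballM f : measurable_fun setT f ->
  measurable_fun setT (fun u => inball 1 u * f u).
Proof. by move=> mf; apply: measurable_funM => //; exact: measurable_inball. Qed.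

Lemma integ_inballM f (C : R) : measurable_fun setT f ->
  (forall u, norm2 u <= 1 -> `|f u| <= C) ->
  integ lam (fun u => inball 1 u * f u).
Proof.
move=> mf fC; apply: (@integ_supp _ _ 1 _ C) => [|u u1|u u1].
- exact: measurable_inballM.
- by rewrite /inball u1 mul1r fC.
- by rewrite /inball leNgt u1 mul0r.
Qed.

Section limit.
Variables (L : R) (g : 'rV[R]_n -> R) (G : 'rV[R]_n -> 'rV[R]_n) (i : 'I_n).
Hypotheses (L0 : 0 <= L) (sm : smooth L g G).

(** The boundary flux g(s) s_i extended to be constant along rays: dilations leave it unchanged, and
    its average over the ball is the average of the flux over the sphere. *)
Let h u := g (normalize_rV u) * normalize_rV u ord0 i.

Let mg : measurable_fun setT g.
Proof. exact: measurable_calm (smooth_calm L0 sm). Qed.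

Let mG : measurable_fun setT (fun u => G u ord0 i).
Proof. exact: measurable_calm (smooth_calm_grad i sm). Qed.

Let mh : measurable_fun setT h.
Proof.
apply: measurable_funM.
  exact: measurableT_comp mg (@measurable_normalize_rV _ _).
exact: measurableT_comp (measurable_rV_coord i) (@measurable_normalize_rV _ _).
Qed.

Let norm_coord u : `|normalize_rV u ord0 i| <= 1.
Proof.
by apply: le_trans (coord_le_norm2 _ _) _; exact: norm2_normalize_le1.
Qed.

(** Two errors of order 1/N. With the cutoff in place of the indicator, the two variations leave a
    shell integral of u_i g(u) - |u|^2 h(u), which vanishes on the sphere itself. Replacing the
    cutoff by the indicator costs a bounded integrand over a thin shell. *)
Lemma inball_flux_bound : exists Z : R, forall N : R, 1 <= N ->
  `|mean lam (fun u => inball 1 u * (G u ord0 i - n%:R * h u))| <= Z * N^-1.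
Proof.
have [C [C0 bC]] := smooth_ball_bound L0 (ler0n R 2) sm.
have hC u : `|h u| <= C.
  rewrite normrM -[leRHS]mulr1 ler_pM//.
  have [] := bC (normalize_rV u) => //.
  by apply: le_trans (norm2_normalize_le1 _) _; rewrite ler1n.
have n0 : 0 <= n%:R :> R by [].
pose D := C + n%:R * C.
have D0 : 0 <= D by rewrite addr_ge0 ?mulr_ge0.
pose F u := G u ord0 i - n%:R * h u.
have mF : measurable_fun setT F.
  by apply: measurable_funB => //; exact: measurable_funM.
have FD u : norm2 u <= 2 -> `|F u| <= D.
  move=> u2; apply: le_trans (ler_normB _ _) _; apply: lerD.
    by have [_ + _] := bC u u2; exact.
  by rewrite normrM ger0_norm// ler_wpM2l.
have hom (s : R) u : 0 < s -> h (s *: u) = h u.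
  by move=> s0; rewrite /h normalizeZ.
pose V2 := mean lam (@inball R n 2); pose V1 := mean lam (@inball R n 1).
exists (2 * C * n%:R * V2 + D * ((2 ^+ n - 1) * V1)) => N N1.
have N0 : 0 < N by exact: lt_le_trans ltr01 N1.
have Ni0 : 0 < N^-1 by rewrite invr_gt0.
have Ni : N^-1 <= 1 by rewrite invf_le1.
pose phi := @ball_cutoff R n N; pose om := @ball_cutoff_slope R n N.
have mphi : measurable_fun setT phi := measurable_ball_cutoff N.
have mom : measurable_fun setT om := measurable_ball_cutoff_slope N.
have phi1 u : `|phi u| <= 1 := ball_cutoff_norm_le1 N u.
have phi_out u : 2 < norm2 u -> phi u = 0.
  by move=> u2; apply: ball_cutoff_out => //; lra.
have om_out u : 2 < norm2 u -> om u = 0.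
  by move=> u2; apply: ball_cutoff_slope_out => //; lra.
have iphi f B : measurable_fun setT f -> (forall u, norm2 u <= 2 -> `|f u| <= B) ->
    integ lam (fun u => phi u * f u).
  move=> mf fB; apply: (@integ_supp _ _ 2 _ B) => [|u u2|u u2].
  - exact: measurable_funM.
  - by rewrite normrM -[leRHS]mul1r ler_pM// fB.
  - by rewrite phi_out ?mul0r.
have iom f B : measurable_fun setT f -> (forall u, norm2 u <= 2 -> `|f u| <= B) ->
    integ lam (fun u => 2 * N * om u * f u).
  move=> mf fB; apply: (@integ_supp _ _ 2 _ (2 * N * 4 * B)) => [|u u2|u u2].
  - by apply: measurable_funM => //; exact: measurable_funM.
  - rewrite normrM ler_pM//; last exact: fB.
    rewrite normrM ler_pM//; last exact: ball_cutoff_slope_norm_le4.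
    by rewrite ger0_norm// mulr_ge0// ltW.
  - by rewrite om_out ?mulr0 ?mul0r.
have q4 u : norm2 u <= 2 -> `|dot u u| <= 2 * 2.
  move=> u2; rewrite ger0_norm ?dotxx_ge0// -norm2_sqr expr2.
  by rewrite ler_pM ?norm2_ge0.
have iphiF := iphi _ _ mF FD.
have i1 : integ lam (fun u => 2 * N * om u * (u ord0 i * g u)).
  apply: (iom _ (2 * C)) => [|u u2].
    by apply: measurable_funM => //; exact: measurable_rV_coord.
  rewrite normrM ler_pM//.
    exact: le_trans (coord_le_norm2 _ _) u2.
  by have [] := bC u u2.
have i2 : integ lam (fun u => 2 * N * om u * (dot u u * h u)).
  apply: (iom _ (2 * 2 * C)) => [|u u2].
    by apply: measurable_funM => //; exact: measurable_dotxx.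
  by rewrite normrM ler_pM// q4.
have i3 : integ lam (fun u => 2 * N * om u * (dot u u * 1)).
  apply: (iom _ (2 * 2)) => [|u u2]; last by rewrite mulr1 q4.
  by apply: measurable_funM => //; exact: measurable_dotxx.
have i4 : integ lam (fun u => phi u * 1).
  by apply: (iphi _ 1) => // u _; rewrite normr1.
have step1 : `|mean lam (fun u => phi u * F u)| <= 2 * C * n%:R * V2 * N^-1.
  have -> : mean lam (fun u => phi u * F u) =
      mean lam (fun u => 2 * N * om u * (u ord0 i * g u) -
                         2 * N * om u * (dot u u * h u)).
    rewrite meanB// -(mean_cutoff_grad i N1 L0 sm) -(mean_cutoff_radial N1 mh hC hom).
    have ih : integ lam (fun u => phi u * h u) by exact: (iphi _ C).
    rewrite -meanZ// -meanB//; last exact: integZ.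
      by congr mean; apply/funext => u; rewrite /F /phi; ring.
    apply: (iphi _ C) => // u u2.
    by have [_ + _] := bC u u2; exact.
  apply: (@le_trans _ _ (mean lam (fun u => 2 * C * N^-1 *
      (2 * N * om u * (dot u u * 1))))).
    apply: mean_norm_le => [||u]; [exact: integB|exact: integZ|].
    have om0 : 0 <= om u by exact: cutoff_slope_ge0.
    rewrite -mulrBr normrM ger0_norm; last by rewrite !mulr_ge0// ltW.
    rewrite [leRHS]mulrCA; have [u1|u1] := leP (norm2 u) 1.
      by rewrite /om ball_cutoff_slope_in// !(mulr0, mul0r).
    have [uN|uN] := ltP (1 + N^-1) (norm2 u).
      by rewrite /om ball_cutoff_slope_out// !(mulr0, mul0r).
    rewrite ler_wpM2l//; first by rewrite !mulr_ge0// ltW.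
    set r := norm2 u in u1 uN *; have r0 : 0 < r by lra.
    set th := normalize_rV u.
    have uth : u = r *: th.
      by rewrite /th /normalize_rV scalerA divff ?scale1r// gt_eqF.
    have -> : u ord0 i = r * th ord0 i by rewrite uth mxE.
    rewrite mulr1 -norm2_sqr -/r /h -/th.
    (* Here u = r th with 1 < r <= 1 + 1/N. Both g u - g th and (r - 1) g th are at most C (r - 1),
       whence the constant 2 C / N. *)
    have -> : r * th ord0 i * g u - r ^+ 2 * (g th * th ord0 i) =
      th ord0 i * (r * ((g u - g th) - (r - 1) * g th)) by ring.
    have th1 : norm2 th <= 1 by exact: norm2_normalize_le1.
    have [_ _ lipu] := bC u ltac:(rewrite -/r; lra).
    have gth : `|g th| <= C by have [] := bC th ltac:(lra).
    have := lipu th ltac:(lra).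
    have -> : norm2 (u - th) = (r - 1) * norm2 th.
      rewrite {1}uth -{2}(scale1r th) -scalerBl norm2Z ger0_norm//; lra.
    move=> gu.
    rewrite normrM -[leRHS]mul1r ler_pM//; first exact: norm_coord.
    rewrite normrM (gtr0_norm r0).
    have r1 : 0 <= r - 1 by lra.
    apply: (@le_trans _ _ (r * (2 * C * (r - 1)))).
      apply: ler_wpM2l; first exact: ltW.
      apply: le_trans (ler_normB _ _) _.
      rewrite normrM (ger0_norm r1).
      have : (r - 1) * `|g th| <= (r - 1) * C by rewrite ler_wpM2l.
      have : C * ((r - 1) * norm2 th) <= C * (r - 1).
        by rewrite ler_wpM2l// ler_piMr.
      lra.
    have -> : 2 * C * N^-1 * r ^+ 2 = r * (2 * C * (N^-1 * r)) by ring.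
    apply: ler_wpM2l; first exact: ltW.
    apply: ler_wpM2l; first exact: mulr_ge0.
    by apply: le_trans (_ : N^-1 <= _); [lra|rewrite ler_peMr// ltW].
  (* The weight 2 N [om] grows with N, but the radial identity for the constant 1 evaluates its
     integral against |u|^2 as n times that of the cutoff, which is bounded by n times the volume of
     the ball of radius 2. *)
  rewrite meanZ// -(mean_cutoff_radial (h := fun=> 1) (H := 1) N1) ?normr1//.
  have : mean lam (fun u => phi u * 1) <= V2.
    apply: mean_le => // [|u]; first exact: integ_inball.
    rewrite mulr1 /inball; have [u2|u2] := leP (norm2 u) 2.
      exact: cutoff_le1.
    by rewrite phi_out.
  rewrite -/phi; set m := mean _ _ => mV.
  have -> : 2 * C * n%:R * V2 * N^-1 = 2 * C * N^-1 * (n%:R * V2) by ring.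
  apply: ler_wpM2l; last exact: ler_wpM2l.
  by rewrite !mulr_ge0// ltW.
have iF : integ lam (fun u => inball 1 u * F u).
  by apply: (@integ_inballM _ D) => // u u1; apply: FD; lra.
have iN1 : integ lam (@inball R n (1 + N^-1)) by exact: integ_inball.
have iI1 : integ lam (@inball R n 1) by exact: integ_inball.
have step2 : `|mean lam (fun u => phi u * F u) - mean lam (fun u => inball 1 u * F u)|
    <= D * ((2 ^+ n - 1) * V1) * N^-1.
  rewrite -meanB//.
  apply: (@le_trans _ _ (mean lam (fun u => D * (inball (1 + N^-1) u - inball 1 u)))).
    apply: mean_norm_le => [||u]; [exact: integB|exact/integZ/integB|].
    rewrite -mulrBl normrM mulrC /inball.
    have [u1|u1] := leP (norm2 u) 1.
      have -> : (norm2 u <= 1 + N^-1) = true by apply/idP; lra.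
      by rewrite /phi ball_cutoff_in// !subrr normr0 !mulr0.
    have [uN|uN] := leP (norm2 u) (1 + N^-1); last first.
      by rewrite /phi ball_cutoff_out// !subrr normr0 !mulr0.
    rewrite !subr0 ler_pM//; apply: FD; lra.
  rewrite meanZ; last exact: integB.
  rewrite -mulrA ler_wpM2l// meanB//.
  have -> : mean lam (@inball R n (1 + N^-1)) = (1 + N^-1) ^+ n * V1.
    have p0 : 0 < 1 + N^-1 by lra.
    have s0 : 0 < (1 + N^-1)^-1 by rewrite invr_gt0.
    have := mean_affine 0 s0 iI1; rewrite invrK => <-.
    congr mean; apply/funext => u; rewrite /affine_rV addr0 /inball norm2Z.
    by rewrite gtr0_norm// ler_pdivrMl// mulr1.
  have V0 : 0 <= V1.
    by rewrite -(mean0 lam); apply: mean_le => //; exact: integ0.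
  have := @expr1D_le R n N^-1; rewrite Ni0 Ni => /(_ isT) e.
  have : (1 + N^-1) ^+ n * V1 <= (1 + (2 ^+ n - 1) * N^-1) * V1.
    by rewrite ler_wpM2r.
  rewrite -/V1; lra.
rewrite -/(F _).
move: step1 step2; set a := mean _ _; set b := mean _ _ => s1 s2.
have -> : b = a - (a - b) by ring.
by apply: le_trans (ler_normB _ _) _; rewrite mulrDl lerD.
Qed.

Lemma inball_flux : mean lam (fun u => inball 1 u * G u ord0 i) =
  n%:R * mean lam (fun u => inball 1 u * h u).
Proof.
have [C [C0 bC]] := smooth_ball_bound L0 (ler0n R 2) sm.
have hC u : `|h u| <= C.
  rewrite normrM -[leRHS]mulr1 ler_pM//.
  have [] := bC (normalize_rV u) => //.
  by apply: le_trans (norm2_normalize_le1 _) _; rewrite ler1n.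
have ih : integ lam (fun u => inball 1 u * h u).
  by apply: (@integ_inballM _ C).
have iG : integ lam (fun u => inball 1 u * G u ord0 i).
  apply: (@integ_inballM _ C) => // u u1.
  by have [_ + _] := bC u ltac:(lra); exact.
rewrite -meanZ//; apply/eqP; rewrite -subr_eq0 -meanB//; last exact: integZ.
have [Z HZ] := inball_flux_bound.
have -> : (fun u => inball 1 u * G u ord0 i - n%:R * (inball 1 u * h u)) =
    (fun u => inball 1 u * (G u ord0 i - n%:R * h u)).
  by apply/funext => u; ring.
rewrite -normr_eq0; set a := mean _ _ in HZ *.
apply/negPn/negP => a0; have a1 : 0 < `|a| by rewrite lt_neqAle eq_sym a0 normr_ge0.
have Z0 : 0 <= Z by have := HZ 1 (lexx _); rewrite invr1 mulr1; lra.
(* For this N the bound |a| <= Z / N reads Z + |a| <= Z, which is absurd. *)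
have N1 : 1 <= Z / `|a| + 1 by rewrite lerDr divr_ge0.
have N0 : 0 < Z / `|a| + 1 by exact: lt_le_trans ltr01 N1.
have := HZ _ N1; rewrite ler_pdivlMr// mulrDr mulr1 mulrCA divff// mulr1.
lra.
Qed.

End limit.
End divergence_ball.

(** * Uniform distributions on the ball and the sphere *)

Lemma integral_mrestr {d} {T : measurableType d} {R : realType}
    (m : {measure set T -> \bar R}) (D : set T) (mD : measurable D)
    (f : T -> \bar R) : measurable_fun setT f -> (forall x, 0 <= f x)%E ->
  (\int[mrestr m mD]_x f x = \int[m]_(x in D) f x)%E.
Proof.
move=> mf f0; rewrite (@ge0_negligible_integral _ _ _ _ setT (~` D))//.
- rewrite setTD setCK; apply: eq_measure_integral => A mA AD.
  by rewrite /= /mrestr; congr (m _); apply/setIidPl.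
- exact: measurableC.
- by rewrite /= /mrestr setICl measure0.
Qed.

Section uniform.
Context {R : realType} {n : nat}.
Notation lam := (lebesgue_rV R n).
Notation B := (unif_ball R n).
Notation S := (unif_sphere R n).
Implicit Types (u s v a x y : 'rV[R]_n) (f : 'rV[R]_n -> R).

Let V := fine (lam (@unit_ball R n)).

Let V_gt0 : 0 < V.
Proof.
by rewrite fine_gt0// lebesgue_unit_ball_gt0 lebesgue_unit_ball_lty.
Qed.

Lemma ge0_integral_unif_ball (f : 'rV[R]_n -> \bar R) :
  measurable_fun setT f -> (forall u, 0 <= f u)%E ->
  (\int[B]_u f u = V^-1%:E * \int[lam]_(u in @unit_ball R n) f u)%E.
Proof.
move=> mf f0; have Vi : 0 <= V^-1 by rewrite invr_ge0 ltW.
rewrite -(integral_mrestr _ (@measurable_unit_ball R n) mf f0).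
rewrite -(@ge0_integral_mscale _ _ _ _ _ _ (NngNum Vi))//.
apply: eq_measure_integral => A mA _.
by rewrite /= unif_ballE /mscale/= /mrestr muleC.
Qed.

Lemma integral_unif_ball_EFin f : measurable_fun setT f ->
  (forall u, 0 <= f u) ->
  (\int[B]_u (f u)%:E = V^-1%:E * \int[lam]_u (inball 1 u * f u)%:E)%E.
Proof.
move=> mf f0; have mEf : measurable_fun setT (EFin \o f) by exact/measurable_EFinP.
rewrite (ge0_integral_unif_ball mEf) => [|u]; last by rewrite lee_fin.
congr (_ * _)%E; rewrite integral_mkcond; apply: eq_integral => u _.
rewrite patchE /inball; case: (leP (norm2 u) 1) => u1.
  by rewrite mem_set// mul1r.
by rewrite memNset ?mul0r// /unit_ball/= leNgt u1.
Qed.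

Lemma integ_unif_ball f (C : R) : measurable_fun setT f ->
  (forall u, norm2 u <= 1 -> `|f u| <= C) -> integ B f.
Proof.
move=> mf fC; apply/integrableP; split; first exact/measurable_EFinP.
rewrite (_ : (fun _ => _) = fun u => (`|f u|)%:E)//.
rewrite integral_unif_ball_EFin//; last exact: measurableT_comp.
have h := @integ_inballM R n (fun u => `|f u|) C.
have {}h : integ lam (fun u => inball 1 u * `|f u|).
  by apply: h => [|u u1]; [exact: measurableT_comp|rewrite normr_id fC].
by rewrite -EFin_mean// -EFinM ltry.
Qed.

Lemma mean_unif_ball f (C : R) : measurable_fun setT f ->
  (forall u, norm2 u <= 1 -> `|f u| <= C) ->
  mean B f = V^-1 * mean lam (fun u => inball 1 u * f u).
Proof.
move=> mf fC.
have ge0_case (h : 'rV[R]_n -> R) : measurable_fun setT h -> (forall u, 0 <= h u) ->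
    (forall u, norm2 u <= 1 -> `|h u| <= C) ->
    mean B h = V^-1 * mean lam (fun u => inball 1 u * h u).
  move=> mh h0 hC; apply: EFin_inj; rewrite EFin_mean; last first.
    exact: integ_unif_ball hC.
  by rewrite integral_unif_ball_EFin// EFinM EFin_mean//; exact: integ_inballM hC.
have mp : measurable_fun setT (fun u => Num.max (f u) 0).
  exact: measurable_maxr.
have mn : measurable_fun setT (fun u => Num.max (- f u) 0).
  by apply: measurable_maxr => //; exact: measurableT_comp.
have bp u : norm2 u <= 1 -> `|Num.max (f u) 0| <= C.
  move=> /fC; rewrite ler_norml => /andP[h1 h2].
  by rewrite ler_norml; case: (leP (f u) 0) => h; apply/andP; split; lra.
have bn u : norm2 u <= 1 -> `|Num.max (- f u) 0| <= C.
  move=> /fC; rewrite ler_norml => /andP[h1 h2].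
  by rewrite ler_norml; case: (leP (- f u) 0) => h; apply/andP; split; lra.
have fE u : f u = Num.max (f u) 0 - Num.max (- f u) 0.
  by case: (leP (f u) 0) => h1; case: (leP (- f u) 0) => h2; lra.
rewrite (_ : f = (fun u => Num.max (f u) 0 - Num.max (- f u) 0)); last exact/funext.
rewrite meanB; [|exact: integ_unif_ball bp|exact: integ_unif_ball bn].
rewrite !ge0_case//; [|by move=> u; rewrite le_max lexx orbT..].
rewrite -mulrBr -meanB; [|exact: integ_inballM bp|exact: integ_inballM bn].
by congr (_ * mean _ _); apply/funext => u; rewrite mulrBr.
Qed.

Lemma ge0_integral_unif_sphere (f : 'rV[R]_n -> \bar R) :
  measurable_fun setT f -> (forall u, 0 <= f u)%E ->
  (\int[S]_s f s = \int[B]_u f (normalize_rV u))%E.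
Proof. by move=> mf f0; rewrite ge0_integral_distribution. Qed.

Lemma integ_unif_sphere f (C : R) : measurable_fun setT f ->
  (forall u, norm2 u <= 1 -> `|f u| <= C) -> integ S f.
Proof.
move=> mf fC; apply/integrableP; split; first exact/measurable_EFinP.
rewrite (_ : (fun _ => _) = fun u => (`|f u|)%:E)//.
have mnf : measurable_fun setT (fun u => (`|f u|)%:E).
  by apply/measurable_EFinP; exact: measurableT_comp.
rewrite ge0_integral_unif_sphere//.
have h : integ B (fun u => `|f (normalize_rV u)|).
  apply: (@integ_bounded _ _ _ _ _ C) => [|u].
    apply: measurableT_comp => //.
    exact: measurableT_comp mf (@measurable_normalize_rV _ _).
  by rewrite normr_id fC// norm2_normalize_le1.
by rewrite -EFin_mean// ltry.
Qed.

Lemma mean_unif_sphere f (C : R) : measurable_fun setT f ->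
  (forall u, norm2 u <= 1 -> `|f u| <= C) ->
  mean S f = mean B (fun u => f (normalize_rV u)).
Proof.
move=> mf fC; have h : integ B (fun u => f (normalize_rV u)).
  apply: (@integ_bounded _ _ _ _ _ C) => [|u].
    exact: measurableT_comp mf (@measurable_normalize_rV _ _).
  by rewrite fC// norm2_normalize_le1.
by rewrite /mean /Rintegral integral_distribution//; exact/measurable_EFinP.
Qed.

(** Both sides are integrals over the ball divided by the same volume, since the sphere law is the
    image of the ball law; the factor n is the ratio of surface to volume. *)
Lemma sphere_flux (L : R) (g : 'rV[R]_n -> R) G i : 0 <= L -> smooth L g G ->
  mean B (fun u => G u ord0 i) = n%:R * mean S (fun s => g s * s ord0 i).
Proof.
move=> L0 sm; have [C [C0 bC]] := smooth_ball_bound L0 ler01 sm.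
have mg : measurable_fun setT g by exact: measurable_calm (smooth_calm L0 sm).
have mG : measurable_fun setT (fun u => G u ord0 i).
  exact: measurable_calm (smooth_calm_grad i sm).
have mgc : measurable_fun setT (fun s => g s * s ord0 i).
  by apply: measurable_funM => //; exact: measurable_rV_coord.
have bgc s : norm2 s <= 1 -> `|g s * s ord0 i| <= C.
  move=> s1; rewrite normrM -[leRHS]mulr1 ler_pM//.
    by have [] := bC s s1.
  exact: le_trans (coord_le_norm2 _ _) s1.
rewrite (@mean_unif_ball _ C)//; last by move=> u u1; have [_ + _] := bC u u1; exact.
rewrite (inball_flux i L0 sm) mulrCA; congr (_ * _).
rewrite (mean_unif_sphere mgc bgc) (@mean_unif_ball _ C)//.
  by apply: measurableT_comp mgc _; exact: measurable_normalize_rV.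
by move=> u u1; exact/bgc/norm2_normalize_le1.
Qed.

Lemma dot_cst_smooth a : smooth 0 (dot a) (fun=> a).
Proof.
split => x y; first by rewrite dotBr subrr normr0 mul0r mul0r.
by rewrite subrr norm2_0 mul0r.
Qed.

Lemma integ_sphere_coord i : integ S (fun s => s ord0 i).
Proof.
apply: (@integ_unif_sphere _ 1) => [|u u1]; first exact: measurable_rV_coord.
exact: le_trans (coord_le_norm2 _ _) u1.
Qed.

Lemma measurable_dot a : measurable_fun setT (dot a).
Proof.
apply: measurable_sum => i; apply: measurable_funM => //.
exact: measurable_rV_coord.
Qed.

Lemma integ_sphere_dot_coord a i : integ S (fun s => dot a s * s ord0 i).
Proof.
apply: (@integ_unif_sphere _ (norm2 a)) => [|u u1].
  apply: measurable_funM; [exact: measurable_dot|exact: measurable_rV_coord].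
rewrite normrM -[leRHS]mulr1 ler_pM//; last exact: le_trans (coord_le_norm2 _ _) u1.
by apply: le_trans (dot_le_norm2 _ _) _; rewrite ler_piMr ?norm2_ge0.
Qed.

(** The divergence theorem for the linear function [dot a], whose gradient is constant: the
    second-moment matrix of the sphere is the identity divided by n. *)
Lemma mean_sphere_dot_coord a i :
  n%:R * mean S (fun s => dot a s * s ord0 i) = a ord0 i.
Proof. by rewrite -(sphere_flux i (lexx _) (dot_cst_smooth a)) mean_cst. Qed.

(** The divergence theorem for the constant function 1: the sphere is centred. *)
Lemma mean_sphere_coord i : n%:R * mean S (fun s => s ord0 i) = 0.
Proof.
have sm : smooth (0 : R) (fun _ : 'rV[R]_n => 1 : R) (fun=> 0).
  split => x y; first by rewrite dotC dot0r !subrr normr0 mul0r mul0r.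
  by rewrite subrr norm2_0 mul0r.
have := sphere_flux i (lexx _) sm; rewrite mxE mean_cst => /esym.
by congr (_ * mean _ _ = _); apply/funext => s; rewrite mul1r.
Qed.

Lemma mean_sphere_dot_sqr a : n%:R * mean S (fun s => dot a s ^+ 2) = dot a a.
Proof.
have -> : (fun s => dot a s ^+ 2) =
    fun s => \sum_(i < n) a ord0 i * (dot a s * s ord0 i).
  apply/funext => s; rewrite expr2 {2}/dot mulr_sumr.
  by apply: eq_bigr => i _; rewrite mulrCA.
rewrite mean_sum => [|i]; last exact/integZ/integ_sphere_dot_coord.
rewrite mulr_sumr; apply: eq_bigr => i _.
rewrite meanZ; last exact: integ_sphere_dot_coord.
by rewrite mulrCA mean_sphere_dot_coord.
Qed.

End uniform.

(** * The zeroth-order gradient estimator *)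

Section zo_single.
Context {R : realType} {n : nat}.
Hypothesis n_gt0 : (0 < n)%N.
Notation B := (unif_ball R n).
Notation S := (unif_sphere R n).
Variables (mu L : R) (g : 'rV[R]_n -> R) (G : 'rV[R]_n -> 'rV[R]_n).
Hypotheses (mu0 : 0 < mu) (L0 : 0 <= L) (sm : smooth L g G).
Implicit Types (u s a x y : 'rV[R]_n).

Let mg : measurable_fun setT g.
Proof. exact: measurable_calm (smooth_calm L0 sm). Qed.

Let n0 : (0 : R) < n%:R. Proof. by rewrite ltr0n. Qed.

Lemma smooth_shift s : smooth L (fun x => g (x + s)) (fun x => G (x + s)).
Proof.
have E x y : y + s - (x + s) = y - x by rewrite opprD addrACA subrr addr0.
split => x y; first by have := sm.1 (x + s) (y + s); rewrite E.
by have := sm.2 (x + s) (y + s); rewrite E.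
Qed.

Lemma smooth_dilate x :
  smooth (L * mu ^+ 2) (fun u => g (x + mu *: u)) (fun u => mu *: G (x + mu *: u)).
Proof.
have E y z : x + mu *: y - (x + mu *: z) = mu *: (y - z).
  by rewrite opprD addrACA subrr add0r scalerBr.
split => y z.
  have := sm.1 (x + mu *: y) (x + mu *: z); rewrite E dotZr dotZl norm2Z.
  rewrite exprMn real_normK ?num_real// => h; apply: le_trans h _.
  by rewrite le_eqVlt; apply/orP; left; apply/eqP; ring.
have := sm.2 (x + mu *: y) (x + mu *: z).
rewrite E -scalerBr !norm2Z (gtr0_norm mu0) => h.
rewrite expr2 mulrCA -mulrA ler_wpM2l ?(ltW mu0)//.
by rewrite -[X in _ <= X]mulrA.
Qed.

Let dilate_bound x : exists C : R, forall u, norm2 u <= 1 -> `|g (x + mu *: u)| <= C.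
Proof.
have Lm : 0 <= L * mu ^+ 2 by rewrite mulr_ge0 ?sqr_ge0.
have [C [C0 bC]] := smooth_ball_bound Lm ler01 (smooth_dilate x).
by exists C => u u1; have [] := bC u u1.
Qed.

Let measurable_dilate x : measurable_fun setT (fun u => g (x + mu *: u)).
Proof.
have Lm : 0 <= L * mu ^+ 2 by rewrite mulr_ge0 ?sqr_ge0.
exact: measurable_calm (smooth_calm Lm (smooth_dilate x)).
Qed.

Let integ_dilate x : integ B (fun u => g (x + mu *: u)).
Proof.
by have [C bC] := dilate_bound x; exact: (@integ_unif_ball _ _ _ C).
Qed.

Lemma smoothingE : smoothing mu g = fun x => mean B (fun u => g (x + mu *: u)).
Proof. by apply/funext => x; rewrite /smoothing unlock. Qed.

Let Gmu x : 'rV[R]_n := \row_i mean B (fun u => G (x + mu *: u) ord0 i).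

(** Smoothing averages translates of g, each smooth with the same L. *)
Let smooth_smoothing_row : smooth L (smoothing mu g) Gmu.
Proof.
rewrite smoothingE.
by apply: (@smooth_mean _ _ _ _ B (fun u x => g (x + mu *: u))
  (fun u x => G (x + mu *: u)) L) => // u; exact: smooth_shift.
Qed.

Lemma grad_smoothing x i :
  grad (smoothing mu g) x ord0 i = mean B (fun u => G (x + mu *: u) ord0 i).
Proof. by rewrite (smooth_grad L0 smooth_smoothing_row) mxE. Qed.

Let integ_G x i : integ B (fun u => G (x + mu *: u) ord0 i).
Proof.
apply: (@integ_smooth_grad _ _ _ _ B (fun u x => g (x + mu *: u))
  (fun u x => G (x + mu *: u)) L) => // u; exact: smooth_shift.
Qed.

Lemma smooth_smoothing : smooth L (smoothing mu g) (grad (smoothing mu g)).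
Proof. by rewrite (smooth_grad L0 smooth_smoothing_row). Qed.

Lemma zo_gradE s x i : zo_grad mu g s x ord0 i =
  n%:R / mu * (g (x + mu *: s) * s ord0 i - g x * s ord0 i).
Proof. by rewrite mxE invf_div; ring. Qed.

Let integ_dilate_coord x i :
  integ S (fun s => g (x + mu *: s) * s ord0 i).
Proof.
have [C bC] := dilate_bound x; apply: (@integ_unif_sphere _ _ _ C) => [|u u1].
  by apply: measurable_funM => //; exact: measurable_rV_coord.
rewrite normrM -[leRHS]mulr1 ler_pM// ?bC//.
exact: le_trans (coord_le_norm2 _ _) u1.
Qed.

Let mean_dilate_coord x i : n%:R / mu * mean S (fun s => g (x + mu *: s) * s ord0 i) =
  grad (smoothing mu g) x ord0 i.
Proof.
have Lm : 0 <= L * mu ^+ 2 by rewrite mulr_ge0 ?sqr_ge0.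
rewrite mulrAC -(sphere_flux i Lm (smooth_dilate x)) grad_smoothing.
under [X in mean _ X / _]eq_fun do rewrite mxE.
rewrite meanZ//.
by rewrite mulrC mulrA mulVf ?mul1r// gt_eqF.
Qed.

Lemma integ_zo_grad x i : integ S (fun s => zo_grad mu g s x ord0 i).
Proof.
under eq_fun do rewrite zo_gradE.
by apply/integZ/integB => //; exact/integZ/integ_sphere_coord.
Qed.

(** The divergence theorem is applied to u |-> g(x + mu u), whose gradient carries the factor mu
    that cancels n/mu; the base value g(x) drops out because the sphere is centred. *)
Lemma mean_zo_grad x i : mean S (fun s => zo_grad mu g s x ord0 i) =
  grad (smoothing mu g) x ord0 i.
Proof.
have ic := integZ (g x) (@integ_sphere_coord R n i).
under eq_fun do rewrite zo_gradE.
rewrite meanZ; last exact: integB.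
rewrite meanB// mulrBr mean_dilate_coord meanZ; last exact: integ_sphere_coord.
have := @mean_sphere_coord R n i => /eqP; rewrite mulf_eq0 gt_eqF//= => /eqP ->.
by rewrite !mulr0 subr0.
Qed.

(** The gradient of g is a sphere average too, n E[<G x, s> s] = G x. So the difference D of the two
    gradients is (n/mu) E[r(s) s] with r the Taylor remainder, at most L mu^2 / 2; pairing D with
    itself turns this into a bound on its norm. *)
Lemma grad_smoothing_dist x :
  norm2 (grad (smoothing mu g) x - grad g x) <= n%:R * L * mu / 2.
Proof.
rewrite (smooth_grad L0 sm); set D := _ - _.
pose r s := g (x + mu *: s) - g x - dot (G x) (mu *: s).
have nm : 0 <= n%:R / mu by rewrite divr_ge0 ?(ltW n0) ?(ltW mu0).
have mr : measurable_fun setT r.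
  apply: measurable_funB; first exact: measurable_funB.
  under eq_fun do rewrite dotZr; apply: measurable_funM => //.
  exact: measurable_dot.
have br s : norm2 s <= 1 -> `|r s| <= L / 2 * mu ^+ 2.
  move=> s1; have := sm.1 x (x + mu *: s).
  rewrite (_ : x + mu *: s - x = mu *: s); last by rewrite addrC addKr.
  rewrite norm2Z (gtr0_norm mu0) => h; apply: le_trans h _.
  by rewrite ler_wpM2l ?divr_ge0// exprMn ler_piMr ?sqr_ge0// expr_le1// norm2_ge0.
have mrc i : measurable_fun setT (fun s => n%:R / mu * (r s * s ord0 i)).
  apply: measurable_funM => //; apply: measurable_funM => //.
  exact: measurable_rV_coord.
have brc i s : norm2 s <= 1 ->
    `|n%:R / mu * (r s * s ord0 i)| <= n%:R / mu * (L / 2 * mu ^+ 2).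
  move=> s1; rewrite normrM ger0_norm// ler_wpM2l// normrM -[leRHS]mulr1.
  by rewrite ler_pM ?br//; exact: le_trans (coord_le_norm2 _ _) s1.
have key i : D ord0 i =
    mean B (fun u => n%:R / mu * (r (normalize_rV u) * normalize_rV u ord0 i)).
  have -> : D ord0 i = grad (smoothing mu g) x ord0 i - G x ord0 i.
    by rewrite !mxE.
  rewrite -mean_zo_grad -(mean_sphere_dot_coord (G x) i).
  rewrite -meanZ; last exact: integ_sphere_dot_coord.
  rewrite -meanB; [|exact: integ_zo_grad|exact/integZ/integ_sphere_dot_coord].
  rewrite -(mean_unif_sphere (mrc i) (brc i)); congr mean; apply/funext => s.
  by rewrite zo_gradE /r dotZr; field; rewrite gt_eqF.
have ikey i : integ B
    (fun u => n%:R / mu * (r (normalize_rV u) * normalize_rV u ord0 i)).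
  apply: (@integ_bounded _ _ _ _ _ (n%:R / mu * (L / 2 * mu ^+ 2))) => [|u].
    exact: measurableT_comp (mrc i) (@measurable_normalize_rV _ _).
  exact/brc/norm2_normalize_le1.
have : dot D D <= norm2 D * (n%:R * L * mu / 2).
  have -> : dot D D = mean B (fun u => \sum_(i < n) D ord0 i *
      (n%:R / mu * (r (normalize_rV u) * normalize_rV u ord0 i))).
    rewrite mean_sum => [|i]; last exact: integZ.
    by apply: eq_bigr => i _; rewrite meanZ// -key.
  apply: le_trans (ler_norm _) _; apply: mean_norm_le_cst => [|u].
    by apply: integ_sum => i; exact: integZ.
  set s := normalize_rV u; have s1 : norm2 s <= 1 by exact: norm2_normalize_le1.
  have -> : \sum_(i < n) D ord0 i * (n%:R / mu * (r s * s ord0 i)) =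
      n%:R / mu * r s * dot D s.
    by rewrite mulr_sumr; apply: eq_bigr => i _; ring.
  have -> : norm2 D * (n%:R * L * mu / 2) =
      n%:R / mu * (L / 2 * mu ^+ 2) * norm2 D by field; rewrite gt_eqF.
  rewrite normrM ler_pM//.
    by rewrite normrM ger0_norm// ler_wpM2l// br.
  by apply: le_trans (dot_le_norm2 _ _) _; rewrite ler_piMr ?norm2_ge0.
rewrite -norm2_sqr expr2.
have [->|D0] := eqVneq (norm2 D) 0.
  by rewrite !mul0r !mulr_ge0 ?(ltW n0) ?(ltW mu0).
by rewrite ler_pM2l// lt_neqAle eq_sym D0 norm2_ge0.
Qed.

Lemma measurable_zo_grad x : measurable_fun setT (fun s => zo_grad mu g s x).
Proof.
apply/measurable_fun_rVP => i; under eq_fun do rewrite zo_gradE.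
have mi := @measurable_rV_coord R n i.
apply: measurable_funM => //; apply: measurable_funB; exact: measurable_funM.
Qed.

Let measurable_zo_diff x y : measurable_fun setT (fun s =>
  norm2 (zo_grad mu g s x - zo_grad mu g s y) ^+ 2).
Proof.
apply: measurable_funX; apply: measurableT_comp; first exact: measurable_norm2.
apply/measurable_fun_rVP => i.
rewrite (_ : (fun _ => _) = fun s =>
  zo_grad mu g s x ord0 i - zo_grad mu g s y ord0 i); last first.
  by apply/funext => s; rewrite !mxE.
have mz z := (measurable_fun_rVP _).1 (measurable_zo_grad z) i.
exact: measurable_funB.
Qed.

(** The difference is (n/mu) (r x - r y + mu <G x - G y, s>) s with Taylor remainders r, and the
    square of three terms is at most three times the sum of the squares. The remainders give 3
    (n/mu)^2 2 (L mu^2/2)^2, hence the 3/2. The linear term gives 3 n rather than 3 n^2 because the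
    second moment of <a, s> is |a|^2 / n. *)
Lemma zo_grad_diff x y :
  (\int[S]_s (norm2 (zo_grad mu g s x - zo_grad mu g s y) ^+ 2)%:E <=
   (3 * n%:R * L ^+ 2 * norm2 (x - y) ^+ 2 +
    3 / 2 * L ^+ 2 * n%:R ^+ 2 * mu ^+ 2)%:E)%E.
Proof.
set C := 3 / 2 * L ^+ 2 * n%:R ^+ 2 * mu ^+ 2.
pose Dl := G x - G y.
have iq : integ B (fun u => dot Dl (normalize_rV u) ^+ 2).
  apply: (@integ_bounded _ _ _ _ _ (norm2 Dl ^+ 2)) => [|u].
    apply: measurable_funX.
    exact: measurableT_comp (measurable_dot Dl) (@measurable_normalize_rV _ _).
  rewrite normrX lerXn2r ?nnegrE ?norm2_ge0//.
  apply: le_trans (dot_le_norm2 _ _) _; rewrite ler_piMr ?norm2_ge0//.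
  exact: norm2_normalize_le1.
have mq : mean B (fun u => dot Dl (normalize_rV u) ^+ 2) = n%:R^-1 * dot Dl Dl.
  rewrite -mean_sphere_dot_sqr mulrA mulVf ?gt_eqF// mul1r.
  rewrite (@mean_unif_sphere _ _ _ (norm2 Dl ^+ 2))// => [|u u1].
    by apply: measurable_funX; exact: measurable_dot.
  rewrite normrX lerXn2r ?nnegrE ?norm2_ge0//.
  by apply: le_trans (dot_le_norm2 _ _) _; rewrite ler_piMr ?norm2_ge0.
have mE : measurable_fun setT (fun s =>
    (norm2 (zo_grad mu g s x - zo_grad mu g s y) ^+ 2)%:E).
  by apply/measurable_EFinP; exact: measurable_zo_diff.
rewrite (ge0_integral_unif_sphere mE) => [|s]; last by rewrite lee_fin sqr_ge0.
apply: (@le_trans _ _ (\int[B]_u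
    (C + 3 * n%:R ^+ 2 * dot Dl (normalize_rV u) ^+ 2)%:E)%E); last first.
  have ic := integ_cst B C.
  have i3 : integ B (fun u => C + 3 * n%:R ^+ 2 * dot Dl (normalize_rV u) ^+ 2).
    by apply: integD => //; exact: integZ.
  rewrite -EFin_mean//.
  rewrite lee_fin meanD//; last exact: integZ.
  rewrite mean_cst meanZ// mq addrC lerD2r.
  have -> : 3 * n%:R ^+ 2 * (n%:R^-1 * dot Dl Dl) = 3 * n%:R * dot Dl Dl.
    by field; rewrite gt_eqF.
  rewrite -[leRHS]mulrA -norm2_sqr ler_wpM2l ?mulr_ge0 ?(ltW n0)//.
  rewrite -exprMn lerXn2r ?nnegrE ?mulr_ge0 ?norm2_ge0//; exact: sm.2.
apply: ge0_le_integral => //.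
- by move=> u _; rewrite lee_fin sqr_ge0.
- apply/measurable_EFinP.
  exact: measurableT_comp (measurable_zo_diff x y) (@measurable_normalize_rV _ _).
- apply/measurable_EFinP/measurable_funD => //.
  by apply: measurable_funM => //; exact: integ_measurable iq.
move=> u _; rewrite lee_fin; set s := normalize_rV u.
have s1 : norm2 s <= 1 by exact: norm2_normalize_le1.
move: s s1 => s s1.
pose r z := g (z + mu *: s) - g z - dot (G z) (mu *: s).
have br z : `|r z| <= L / 2 * mu ^+ 2.
  have := sm.1 z (z + mu *: s).
  rewrite (_ : z + mu *: s - z = mu *: s); last by rewrite addrC addKr.
  rewrite norm2Z (gtr0_norm mu0) => h; apply: le_trans h _.
  by rewrite ler_wpM2l ?divr_ge0// exprMn ler_piMr ?sqr_ge0// expr_le1// norm2_ge0.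
have -> : zo_grad mu g s x - zo_grad mu g s y =
    (n%:R / mu * (r x - r y + mu * dot Dl s)) *: s.
  rewrite /zo_grad -scalerBl; congr (_ *: s); rewrite /r /Dl !dotZr dotBl.
  by field; rewrite (gt_eqF n0) (gt_eqF mu0).
rewrite norm2Z exprMn real_normK ?num_real//.
set e := _ * (_ + _); apply: (@le_trans _ _ (e ^+ 2)).
  by rewrite ler_piMr ?sqr_ge0// expr_le1// norm2_ge0.
have := br x; have := br y; rewrite !ler_norml.
set b := L / 2 * mu ^+ 2 => /andP[y1 y2] /andP[x1 x2].
have -> : C = 3 * (n%:R / mu) ^+ 2 * (b ^+ 2 + b ^+ 2).
  by rewrite /C /b; field; rewrite gt_eqF.
have -> : 3 * n%:R ^+ 2 * dot Dl s ^+ 2 =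
    3 * (n%:R / mu) ^+ 2 * (mu * dot Dl s) ^+ 2 by field; rewrite gt_eqF.
rewrite /e exprMn -mulrDr -[leRHS]mulrA [leRHS]mulrCA ler_wpM2l ?sqr_ge0//.
set p := r x in x1 x2 *; set q := r y in y1 y2 *; set w := mu * _.
have p2 : p ^+ 2 <= b ^+ 2 by nra.
have q2 : q ^+ 2 <= b ^+ 2 by nra.
have := sqr_ge0 (p + q); have := sqr_ge0 (p - w); have := sqr_ge0 (q + w).
nra.
Qed.

End zo_single.

Section product_probability.
Context {d1 d2 : measure_display} {T1 : measurableType d1}
  {T2 : measurableType d2} {R : realType}.
Variables (P1 : probability T1 R) (P2 : probability T2 R).

Lemma product_probability_setT : (P1 \x P2)%E setT = 1%E.
Proof.
transitivity (P1 setT * P2 setT)%E; first by rewrite -setXTT product_measure1E.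
by rewrite !probability_setT mule1.
Qed.

HB.instance Definition _ :=
  Measure_isProbability.Build _ _ _ (P1 \x P2)%E product_probability_setT.

End product_probability.

(** * Square-integrable random vectors *)

Section second_moment.
Context {R : realType} {n : nat} {d : measure_display} {T : measurableType d}.
Variable Q : probability T R.
Implicit Types (X Y : T -> 'rV[R]_n) (a c : 'rV[R]_n).

Definition sqr_integ X :=
  measurable_fun setT X /\ integ Q (fun w => norm2 (X w) ^+ 2).

Lemma measurable_norm2_sqr {d'} {U : measurableType d'} (X : U -> 'rV[R]_n) :
  measurable_fun setT X -> measurable_fun setT (fun w => norm2 (X w) ^+ 2).
Proof.
by move=> mX; apply: measurable_funX; exact: measurableT_comp (@measurable_norm2 R n) mX.
Qed.

Lemma measurable_rVD {d'} {U : measurableType d'} (X Y : U -> 'rV[R]_n) :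
  measurable_fun setT X -> measurable_fun setT Y ->
  measurable_fun setT (fun w => X w + Y w).
Proof.
move=> /measurable_fun_rVP mX /measurable_fun_rVP mY; apply/measurable_fun_rVP.
by move=> i; under eq_fun do rewrite mxE; exact: measurable_funD.
Qed.

Lemma measurable_rVZ {d'} {U : measurableType d'} (b : R) (X : U -> 'rV[R]_n) :
  measurable_fun setT X -> measurable_fun setT (fun w => b *: X w).
Proof.
move=> /measurable_fun_rVP mX; apply/measurable_fun_rVP => i.
by under eq_fun do rewrite mxE; exact: measurable_funM.
Qed.

Lemma measurable_rVB {d'} {U : measurableType d'} (X Y : U -> 'rV[R]_n) :
  measurable_fun setT X -> measurable_fun setT Y ->
  measurable_fun setT (fun w => X w - Y w).
Proof.
move=> mX mY; under eq_fun do rewrite -scaleN1r.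
by apply: measurable_rVD => //; exact: measurable_rVZ.
Qed.

Lemma norm2D_sqr_le a c :
  norm2 (a + c) ^+ 2 <= 2 * norm2 a ^+ 2 + 2 * norm2 c ^+ 2.
Proof.
have := dotxx_ge0 (a - c); rewrite !norm2_sqr !(dotDl, dotDr, dotNl, dotNr).
by rewrite (dotC c a); lra.
Qed.

Lemma sqr_integ_cst c : sqr_integ (cst c).
Proof. by split => //; exact: (integ_cst Q (norm2 c ^+ 2)). Qed.

Lemma sqr_integD X Y : sqr_integ X -> sqr_integ Y ->
  sqr_integ (fun w => X w + Y w).
Proof.
move=> [mX iX] [mY iY]; split; first exact: measurable_rVD.
apply: (@integ_le _ _ _ _ _ (fun w => 2 * norm2 (X w) ^+ 2 + 2 * norm2 (Y w) ^+ 2)).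
- exact/measurable_norm2_sqr/measurable_rVD.
- by apply: integD; exact: integZ.
- by move=> w; rewrite ger0_norm ?sqr_ge0// norm2D_sqr_le.
Qed.

Lemma sqr_integZ (b : R) X : sqr_integ X -> sqr_integ (fun w => b *: X w).
Proof.
move=> [mX iX]; split; first exact: measurable_rVZ.
under eq_fun do rewrite norm2Z exprMn.
exact: integZ.
Qed.

Lemma sqr_integB X Y : sqr_integ X -> sqr_integ Y ->
  sqr_integ (fun w => X w - Y w).
Proof.
move=> iX iY; under eq_fun do rewrite -scaleN1r.
by apply: sqr_integD => //; exact: sqr_integZ.
Qed.

Lemma sqr_integ_coord X i : sqr_integ X -> integ Q (fun w => X w ord0 i).
Proof.
move=> [mX iX].
apply: (@integ_le _ _ _ _ _ (fun w => 1 + norm2 (X w) ^+ 2)) => [||w].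
- exact: (measurable_fun_rVP _).1 mX i.
- by apply: integD => //; exact: integ_cst.
- apply: le_trans (coord_le_norm2 _ _) _.
  by have := sqr_ge0 (norm2 (X w) - 1); have := norm2_ge0 (X w); nra.
Qed.

Lemma integ_dot a X : sqr_integ X -> integ Q (fun w => dot a (X w)).
Proof. by move=> iX; apply: integ_sum => i; exact/integZ/sqr_integ_coord. Qed.

Lemma mean_dot a X : sqr_integ X ->
  mean Q (fun w => dot a (X w)) = dot a (\row_i mean Q (fun w => X w ord0 i)).
Proof.
move=> iX; rewrite /dot mean_sum => [|i]; last exact/integZ/sqr_integ_coord.
apply: eq_bigr => i _; rewrite mxE meanZ//; exact: sqr_integ_coord.
Qed.

Lemma mean_sqrD_centered a X : sqr_integ X ->
  (forall i, mean Q (fun w => X w ord0 i) = 0) ->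
  mean Q (fun w => norm2 (a + X w) ^+ 2) =
  norm2 a ^+ 2 + mean Q (fun w => norm2 (X w) ^+ 2).
Proof.
move=> iX X0; have [mX iX2] := iX.
have -> : (fun w => norm2 (a + X w) ^+ 2) =
    (fun w => (norm2 a ^+ 2 + 2 * dot a (X w)) + norm2 (X w) ^+ 2).
  by apply/funext => w; rewrite !norm2_sqr dotxxD mulr2n; ring.
have ia : integ Q (fun w => 2 * dot a (X w)) by exact/integZ/integ_dot.
have ic := integ_cst Q (norm2 a ^+ 2).
rewrite meanD//; last exact: integD.
rewrite meanD// mean_cst meanZ ?mean_dot//; last exact: integ_dot.
rewrite (_ : (\row_i _) = 0); first by rewrite dot0r mulr0 addr0.
by apply/rowP => i; rewrite !mxE.
Qed.

End second_moment.

Section zo_stochastic.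
Context {R : realType} {n : nat} {dX : measure_display} {Xi : measurableType dX}.
Hypothesis n_gt0 : (0 < n)%N.
Variables (D : probability Xi R) (F : 'rV[R]_n -> Xi -> R) (mu L sigma : R).
Hypotheses (mu0 : 0 < mu) (L0 : 0 <= L)
  (smF : forall z, smooth L (F^~ z) (grad (F^~ z)))
  (F_int : forall x, integ D (F x)).
Notation S := (unif_sphere R n).
Let f := objective D F.
Let fmu := smoothing mu f.

Lemma objectiveE : f = fun x => mean D (F x).
Proof. by apply/funext => x; rewrite /f /objective unlock. Qed.

Lemma smooth_objective : smooth L f (grad f).
Proof.
have sm : smooth L f (fun x => \row_i mean D (fun z => grad (F^~ z) x ord0 i)).
  rewrite objectiveE.
  exact: (@smooth_mean _ _ _ _ D (fun z x => F x z) (fun z x => grad (F^~ z) x) L).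
by rewrite (smooth_grad L0 sm).
Qed.

Lemma measurable_zo_comp {d'} {U : measurableType d'} (X s : U -> 'rV[R]_n)
    (z : U -> Xi) :
  measurable_fun setT X -> measurable_fun setT s -> measurable_fun setT z ->
  measurable_fun setT (fun w => zo_grad mu (F^~ (z w)) (s w) (X w)).
Proof.
move=> mX ms mz; apply/measurable_fun_rVP => i.
under eq_fun do rewrite zo_gradE//.
have mF := measurable_caratheodory (fun x => integ_measurable (F_int x))
  (fun z => smooth_calm L0 (smF z)).
have mFc (Y : U -> 'rV[R]_n) : measurable_fun setT Y ->
    measurable_fun setT (fun w => F (Y w) (z w)).
  by move=> mY; exact: (measurableT_comp mF (measurable_fun_pair mY mz)).
have msi := (measurable_fun_rVP _).1 ms i.
apply: measurable_funM => //; apply: measurable_funB; apply: measurable_funM => //.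
  by apply: mFc; apply: measurable_rVD => //; exact: measurable_rVZ.
exact: mFc.
Qed.

Let Q : probability (Xi * 'rV[R]_n)%type R := (D \x S)%E.
Let zo x (w : Xi * 'rV[R]_n) := zo_grad mu (F^~ w.1) w.2 x.

Let measurable_zo x : measurable_fun setT (zo x).
Proof. by apply: measurable_zo_comp. Qed.

Hypothesis A1 : forall x,
  (\int[D \x S]_w (norm2 (zo x w - grad fmu x) ^+ 2)%:E <= (sigma ^+ 2)%:E)%E.

Let sqr_integ_err x : sqr_integ Q (fun w => zo x w - grad fmu x).
Proof.
split; first exact: measurable_rVB.
apply/integrableP; split.
  by apply/measurable_EFinP; apply: measurable_norm2_sqr; exact: measurable_rVB.
under eq_integral => w _ do rewrite /= ger0_norm ?sqr_ge0//.
exact: le_lt_trans (A1 x) (ltry _).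
Qed.

Let mean_err_le x : mean Q (fun w => norm2 (zo x w - grad fmu x) ^+ 2) <= sigma ^+ 2.
Proof.
have [_ iE] := sqr_integ_err x.
by rewrite -lee_fin EFin_mean//; exact: A1.
Qed.

Let sqr_integ_zo x : sqr_integ Q (zo x).
Proof.
rewrite (_ : zo x = fun w => (zo x w - grad fmu x) + cst (grad fmu x) w).
  by apply: sqr_integD => //; exact: sqr_integ_cst.
by apply/funext => w; rewrite subrK.
Qed.

(** The sample is integrated first, with the direction fixed: the estimator is linear in the
    function, so it becomes the estimator of the objective, which is unbiased. *)
Let mean_zo x i : mean Q (fun w => zo x w ord0 i) = grad fmu x ord0 i.
Proof.
have iz := sqr_integ_coord i (sqr_integ_zo x).
rewrite -(mean_zo_grad n_gt0 mu0 L0 smooth_objective) /mean /Rintegral.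
congr fine; rewrite -integral21_prod_meas1//; apply: eq_integral => s _.
rewrite /fubini_G/=; under eq_integral => z _ do rewrite zo_gradE//.
have iFs y : integ D (fun z => F y z * s ord0 i).
  by under eq_fun do rewrite mulrC; exact: integZ.
have iF2 := integB (iFs (x + mu *: s)) (iFs x).
rewrite -EFin_mean; last exact: integZ.
rewrite zo_gradE//; congr _%:E.
have mFs y : mean D (fun z => F y z * s ord0 i) = f y * s ord0 i.
  rewrite objectiveE [RHS]mulrC -meanZ//.
  by congr mean; apply/funext => z; rewrite mulrC.
by rewrite meanZ// meanB//= !mFs.
Qed.

(** Here the direction is integrated first, with the sample fixed: the bound holds for each sample
    with the same constants. *)
Let mean_zo_diff x y : mean Q (fun w => norm2 (zo x w - zo y w) ^+ 2) <=
  3 * n%:R * L ^+ 2 * norm2 (x - y) ^+ 2 +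
    3 / 2 * L ^+ 2 * n%:R ^+ 2 * mu ^+ 2.
Proof.
have [mz iz] := sqr_integB (sqr_integ_zo x) (sqr_integ_zo y).
rewrite -lee_fin EFin_mean// fubini_tonelli1//; last 2 first.
- by apply/measurable_EFinP; exact: measurable_norm2_sqr.
- by move=> w; rewrite lee_fin sqr_ge0.
set c := (X in (_ <= X%:E)%E).
have -> : c%:E = (\int[D]_z (cst c z)%:E)%E.
  by rewrite -EFin_mean ?mean_cst//; exact: integ_cst.
apply: ge0_le_integral => //.
- by move=> z _; apply: integral_ge0 => s _; rewrite lee_fin sqr_ge0.
- apply: (@measurable_fun_fubini_tonelli_F _ _ _ _ _ S
    (fun w => (norm2 (zo x w - zo y w) ^+ 2)%:E)) => [|w].
    by apply/measurable_EFinP; exact: measurable_norm2_sqr.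
  by rewrite lee_fin sqr_ge0.
- exact/measurable_EFinP.
by move=> z _; exact: (zo_grad_diff n_gt0 mu0 L0 (smF z) x y).
Qed.

(** The new error is (1 - a) times the old one plus W = a Ey + (1 - a)(Ey - Ex), which is centred,
    so the cross term disappears. Using one draw at both points is what makes Ey - Ex small. *)
Lemma acc_zom_error_step (a : R) x y v : 0 <= a <= 1 ->
  (\int[D \x S]_w (norm2 (zo y w + (1 - a) *: (v - zo x w) - grad fmu y) ^+ 2)%:E
  <= ((1 - a) ^+ 2 * norm2 (v - grad fmu x) ^+ 2 + 2 * a ^+ 2 * sigma ^+ 2 +
      2 * (1 - a) ^+ 2 * (3 * n%:R * L ^+ 2 * norm2 (y - x) ^+ 2 +
      3 / 2 * L ^+ 2 * n%:R ^+ 2 * mu ^+ 2))%:E)%E.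
Proof.
move=> /andP[a0 a1].
pose e := (1 - a) *: (v - grad fmu x).
pose Ey w := zo y w - grad fmu y; pose Ex w := zo x w - grad fmu x.
pose W w := a *: Ey w + (1 - a) *: (Ey w - Ex w).
have -> : (fun w => (norm2 (zo y w + (1 - a) *: (v - zo x w) - grad fmu y) ^+ 2)%:E)
   = (fun w => (norm2 (e + W w) ^+ 2)%:E).
  apply/funext => w; congr (norm2 _ ^+ 2)%:E; apply/rowP => i.
  by rewrite !mxE; ring.
have iEy : sqr_integ Q Ey := sqr_integ_err y.
have iEx : sqr_integ Q Ex := sqr_integ_err x.
have iE : sqr_integ Q (fun w => Ey w - Ex w) by exact: sqr_integB.
have iaE := sqr_integZ a iEy; have ibE := sqr_integZ (1 - a) iE.
have iW : sqr_integ Q W by exact: sqr_integD.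
have [_ ieW] := sqr_integD (sqr_integ_cst Q e) iW.
rewrite -[leLHS]/(\int[Q]_w (norm2 (e + W w) ^+ 2)%:E)%E -EFin_mean// lee_fin.
have mE z i : mean Q (fun w => (zo z w - grad fmu z) ord0 i) = 0.
  have iz := sqr_integ_coord i (sqr_integ_zo z).
  have ic := integ_cst Q (grad fmu z ord0 i).
  rewrite (_ : (fun _ => _) = fun w => zo z w ord0 i - grad fmu z ord0 i).
    by rewrite meanB// mean_zo mean_cst subrr.
  by apply/funext => w; move: (zo z w) (grad fmu z) => p q; rewrite !mxE.
have iEyc i := sqr_integ_coord i iEy; have iExc i := sqr_integ_coord i iEx.
rewrite mean_sqrD_centered// => [|i]; last first.
  rewrite (_ : (fun _ => _) =
    fun w => a * Ey w ord0 i + (1 - a) * (Ey w ord0 i - Ex w ord0 i)).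
    have i1 := integZ (1 - a) (integB (iEyc i) (iExc i)).
    rewrite (meanD (integZ a (iEyc i)) i1) (meanZ a (iEyc i)).
    rewrite (meanZ _ (integB (iEyc i) (iExc i))) (meanB (iEyc i) (iExc i)).
    by rewrite !mE subrr !mulr0 addr0.
  by apply/funext => w; rewrite /W; move: (Ey w) (Ex w) => p q; rewrite !mxE.
rewrite /e norm2Z exprMn real_normK ?num_real// -addrA lerD2l.
have [_ iE2] := iE; have [_ iEy2] := iEy; have [_ iW2] := iW.
apply: (@le_trans _ _ (mean Q (fun w => 2 * a ^+ 2 * norm2 (Ey w) ^+ 2 +
    2 * (1 - a) ^+ 2 * norm2 (Ey w - Ex w) ^+ 2))).
  apply: mean_le => [||w] //; first by apply: integD; exact: integZ.
  apply: le_trans (norm2D_sqr_le _ _) _.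
  rewrite !norm2Z !exprMn !real_normK ?num_real//.
  by rewrite !mulrA.
rewrite meanD; [|exact: integZ..].
rewrite !meanZ//; apply: lerD.
  by rewrite ler_wpM2l ?mean_err_le// mulr_ge0// sqr_ge0.
apply: ler_wpM2l; first by apply: mulr_ge0 => //; exact: sqr_ge0.
(* Ey - Ex is the centred version of the difference of the estimators; restoring the constant c only
   adds |c|^2 to the second moment. *)
apply: le_trans _ (mean_zo_diff y x).
pose c := grad fmu y - grad fmu x.
have -> : (fun w => norm2 (zo y w - zo x w) ^+ 2) =
    fun w => norm2 (c + (Ey w - Ex w)) ^+ 2.
  apply/funext => w; congr (norm2 _ ^+ 2); rewrite /c /Ey /Ex.
  by apply/rowP => i; rewrite !mxE; ring.
rewrite (mean_sqrD_centered c iE) => [|i]; first by rewrite lerDr sqr_ge0.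
rewrite (_ : (fun _ => _) = fun w => Ey w ord0 i - Ex w ord0 i).
  by rewrite (meanB (iEyc i) (iExc i)) !mE subrr.
by apply/funext => w; move: (Ey w) (Ex w) => p q; rewrite !mxE.
Qed.

End zo_stochastic.

(** * Conditioning on past draws *)

Section fresh.
Context {d : measure_display} {T : measurableType d} {R : realType}.
Variables (P : probability T R) (J : finType) (F : J -> set (set T)).
Hypotheses (FT : forall i, F i setT)
  (FI : forall i, setI_closed (F i))
  (Fm : forall i, F i `<=` measurable)
  (indF : mutually_independent P F).

(** A pi-system generating the information carried by the indices in K. Families are indexed by all
    of J and padded with the full set, so that intersections are taken factor by factor. *)
Definition past (K : pred J) : set (set T) :=
  [set B | exists A : J -> set T, [/\ forall i, F i (A i),
    forall i, ~~ K i -> A i = setT & B = \bigcap_i A i]].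

Lemma past_measurable K : past K `<=` measurable.
Proof.
move=> _ [A [FA _ ->]]; apply: fin_bigcap_measurable => [|i _].
  exact: finite_finset.
exact: Fm.
Qed.

Lemma past_setI_closed K : setI_closed (past K).
Proof.
move=> _ _ [A [FA AT ->]] [B [FB BT ->]]; exists (fun i => A i `&` B i); split.
- by move=> i; exact: FI.
- by move=> i Ki; rewrite AT// BT// setIT.
- by rewrite bigcapI.
Qed.

Lemma past_setT K : past K setT.
Proof.
by exists (fun=> setT); split => //; rewrite bigcapT.
Qed.

Lemma sub_past (K : pred J) a A : K a -> F a A -> past K A.
Proof.
move=> Ka FA; exists (fun i => if i == a then A else setT); split.
- by move=> i; case: eqP => [->|].
- by move=> i; case: eqP => [->|//]; rewrite Ka.
- apply/seteqP; split => [x Ax i _|x /(_ a I)]; last by rewrite eqxx.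
  by case: eqP.
Qed.

Lemma past_mono (K K' : pred J) : subpred K K' -> past K `<=` past K'.
Proof.
move=> KK' B [A [FA AT ->]]; exists A; split => // i nK'.
by apply: AT; apply: contra nK'; exact: KK'.
Qed.

(** For fixed A, the restriction of P to A and the multiple P(A) P are finite measures that agree on
    the pi-system, hence on the sigma-algebra it generates. *)
Lemma past_indep (K : pred J) a A B : ~~ K a -> F a A -> <<s past K >> B ->
  P (B `&` A) = (P B * P A)%E.
Proof.
move=> nKa FA sB; have mA := Fm FA.
have PA0 : 0 <= fine (P A) by rewrite fine_ge0.
rewrite muleC -(fineK (fin_num_measure P A mA)).
apply: (@g_sigma_algebra_measure_unique _ R T (past K) (@past_measurable K)
  (fun=> setT) (fun=> @past_setT K) _ (mrestr P mA)
  (mscale (NngNum PA0) P) (@past_setI_closed K)) => //.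
- by rewrite bigcup_const//; exists 0%N.
- move=> _ [E [FE ET ->]].
  rewrite /= /mrestr /mscale/=.
  (* The factor of index a is the full set because a lies outside K; putting A there expresses the
     intersection with A by a single family. *)
  pose E' i := if i == a then A else E i.
  have -> : \bigcap_i E i `&` A = \bigcap_(i in [set` [set: J]%SET]) E' i.
    apply/seteqP; split => [x [Ex Ax] i _|x E'x].
      by rewrite /E'; case: eqP => // _; exact: Ex.
    split => [i _|]; last by have := E'x a (finset.in_setT _); rewrite /E' eqxx.
    have := E'x i (finset.in_setT _); rewrite /E'; case: eqP => // -> _.
    by rewrite ET.
  have -> : \bigcap_i E i = \bigcap_(i in [set` [set: J]%SET]) E i.
    apply/seteqP; split => x Ex i _; first exact: Ex.
    exact: Ex (finset.in_setT _).
  rewrite !indF => [|i _|i _]; [|exact: FE|by rewrite /E'; case: eqP => // ->].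
  rewrite -EFinM; congr _%:E.
  rewrite (bigD1 a)//= [in RHS](bigD1 a)//= /E' eqxx ET// probability_setT mul1r.
  by congr (_ * _); apply: eq_bigr => i /andP[_ /negbTE ->].
- move=> _; rewrite /= /mrestr/= setTI.
  exact: le_lt_trans (probability_le1 P mA) (ltry _).
Qed.

End fresh.

Section freeze.
Context {d d1 d2 : measure_display} {T : measurableType d}
  {U : measurableType d1} {V : measurableType d2} {R : realType}.
Variables (P : probability T R) (D : probability V R).
Variables (H : T -> U) (X : T -> V).
Hypotheses (mH : measurable_fun setT H) (mX : measurable_fun setT X).
Hypothesis indep : forall A C, measurable A -> measurable C ->
  P (H @^-1` A `&` X @^-1` C) = (P (H @^-1` A) * D C)%E.

(** Independence on rectangles identifies the joint law of H and X with the product of the law of H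
    and D; Tonelli then integrates X out with H frozen. Nonnegativity replaces any integrability
    assumption. *)
Lemma integral_freeze (Psi : U * V -> \bar R) :
  measurable_fun setT Psi -> (forall z, 0 <= Psi z)%E ->
  (\int[P]_w Psi (H w, X w) = \int[P]_w \int[D]_z Psi (H w, z))%E.
Proof.
move=> mPsi Psi0.
pose Hm : {mfun T >-> U} := HB.pack H (isMeasurableFun.Build _ _ _ _ H mH).
have mHX : measurable_fun setT (fun w => (H w, X w)) by exact: measurable_fun_pair.
transitivity (\int[pushforward P (fun w => (H w, X w))]_z Psi z)%E.
  by rewrite (ge0_integral_pushforward mHX).
transitivity (\int[(distribution P Hm \x D)%E]_z Psi z)%E.
  apply: eq_measure_integral => A mA _.
  apply/esym/product_measure_unique => // B C mB mC.
rewrite fubini_tonelli1// ge0_integral_distribution//.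
- by apply: (@measurable_fun_fubini_tonelli_F _ _ _ _ _ D).
- by move=> h; exact: integral_ge0.
Qed.

End freeze.

Section freeze2.
Context {d d1 d2 d3 : measure_display} {T : measurableType d}
  {U : measurableType d1} {V : measurableType d2} {W : measurableType d3}
  {R : realType}.
Variables (P : probability T R) (D : probability V R) (E : probability W R).
Variables (H : T -> U) (X : T -> V) (Y : T -> W).
Hypotheses (mH : measurable_fun setT H) (mX : measurable_fun setT X)
  (mY : measurable_fun setT Y).
Hypothesis indepX : forall A C, measurable A -> measurable C ->
  P (H @^-1` A `&` X @^-1` C) = (P (H @^-1` A) * D C)%E.
Hypothesis indepY : forall A C, measurable A -> measurable C ->
  P ((fun w => (H w, X w)) @^-1` A `&` Y @^-1` C) =
  (P ((fun w => (H w, X w)) @^-1` A) * E C)%E.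

(** Y is integrated out with (H, X) frozen, then X with H frozen; Tonelli reassembles the two into
    one integral over the product. *)
Lemma integral_freeze2 (Psi : U * (V * W) -> \bar R) :
  measurable_fun setT Psi -> (forall z, 0 <= Psi z)%E ->
  (\int[P]_w Psi (H w, (X w, Y w)) =
   \int[P]_w \int[D \x E]_z Psi (H w, z))%E.
Proof.
move=> mPsi Psi0.
pose Phi (z : (U * V) * W) := Psi (z.1.1, (z.1.2, z.2)).
have mPhi : measurable_fun setT Phi.
  apply: (measurableT_comp mPsi); apply: measurable_fun_pair.
    exact: measurableT_comp.
  by apply: measurable_fun_pair => //; exact: measurableT_comp.
rewrite -[LHS]/(\int[P]_w Phi ((H w, X w), Y w))%E.
rewrite (integral_freeze (measurable_fun_pair mH mX) mY indepY mPhi (fun z => Psi0 _)).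
have mG : measurable_fun setT (fun p => \int[E]_z Phi (p, z))%E.
  by apply: (@measurable_fun_fubini_tonelli_F _ _ _ _ _ E Phi) => // z; exact: Psi0.
have G0 p : (0 <= \int[E]_z Phi (p, z))%E.
  by apply: integral_ge0 => z _; exact: Psi0.
rewrite (integral_freeze mH mX indepX mG G0).
apply: eq_integral => w _; rewrite fubini_tonelli1//.
exact: measurableT_comp mPsi (pair1_measurable _).
Qed.

End freeze2.

(** * The potential argument *)

Section rates.
Context {R : realType}.
Variables (m k c : R).
Hypotheses (k0 : 0 < k) (m2 : 2 <= m) (mk : k ^+ 3 <= m)
  (mck : (c * k) ^+ 3 <= m) (c_ge : 2 / (3 * k ^+ 3) + 5 / 4 <= c).

(** The inverse step size is rho t / k. Through [rho_cube], estimates on cube roots become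
    polynomial inequalities between consecutive values. *)
Definition rho (t : nat) : R := (m + t%:R) `^ (1 / 3).

Let mt0 (t : nat) : 0 < m + t%:R.
Proof. by rewrite ltr_pwDl// (lt_le_trans _ m2). Qed.

Lemma rho_gt0 t : 0 < rho t. Proof. exact: powR_gt0. Qed.

Lemma rho_cube t : rho t ^+ 3 = m + t%:R.
Proof.
rewrite /rho -powR_mulrn ?powR_ge0// -powRrM div1r mulVf ?powRr1//.
exact: ltW.
Qed.

Let ler_cube (a b : R) : 0 <= a -> 0 <= b -> a ^+ 3 <= b ^+ 3 -> a <= b.
Proof. by move=> a0 b0; rewrite ler_pXn2r. Qed.

Let rho_ge0 t : 0 <= rho t. Proof. exact/ltW/rho_gt0. Qed.

Lemma rho_mono s t : (s <= t)%N -> rho s <= rho t.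
Proof.
move=> st; apply: ler_cube => //; by rewrite !rho_cube lerD2l ler_nat.
Qed.

Lemma k_le_rho t : k <= rho t.
Proof.
apply: ler_cube => //; first exact: ltW.
by rewrite rho_cube (le_trans mk)// lerDl.
Qed.

Lemma c_gt0 : 0 < c.
Proof.
apply: lt_le_trans c_ge; rewrite ltr_wpDl ?divr_gt0//.
by rewrite divr_ge0// mulr_ge0// exprn_ge0// ltW.
Qed.

Lemma ck_le_rho t : c * k <= rho t.
Proof.
apply: ler_cube => //; first by apply: mulr_ge0; apply: ltW => //; exact: c_gt0.
by rewrite rho_cube (le_trans mck)// lerDl.
Qed.

Lemma step_sizeE t : step_size k m t = k / rho t. Proof. by []. Qed.

Lemma momentum01 t : 0 <= momentum c k m t <= 1.
Proof.
rewrite /momentum step_sizeE; set p := rho t.-1; have p0 : 0 < p by exact: rho_gt0.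
apply/andP; split; first by rewrite mulr_ge0 ?sqr_ge0// ltW// c_gt0.
have -> : c * (k / p) ^+ 2 = (c * k) * k / p ^+ 2 by field; rewrite gt_eqF.
rewrite ler_pdivrMr ?exprn_gt0// mul1r expr2; apply: ler_pM.
- by apply: mulr_ge0; apply: ltW => //; exact: c_gt0.
- exact: ltW.
- exact: ck_le_rho.
- exact: k_le_rho.
Qed.

Let p_le_2q t : rho t.+1 <= 2 * rho t.
Proof.
have q0 := rho_gt0 t; apply: ler_cube => //; first by rewrite mulr_ge0.
rewrite exprMn !rho_cube -natr1; have t0 : (0 : R) <= t%:R by [].
rewrite (_ : 2 ^+ 3 = 8); last by ring.
have := m2; lra.
Qed.

(** With p = rho (t+1) and q = rho t, the inverse step size grows by (p - q)/k, and p^3 - q^3 = 1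
    bounds 3 (p - q) p k by 2. The part 2/(3k^3) of c pays for exactly this, and the part 5/4 is the
    decay that remains. *)
Lemma momentum_decay t :
  (1 - momentum c k m t.+2) * (rho t.+1 / k) <=
  rho t / k - 5 / 4 * step_size k m t.+1.
Proof.
rewrite /momentum /= !step_sizeE.
have := p_le_2q t; have := rho_mono (leqnSn t); have := k_le_rho t.+1.
have := rho_cube t.+1; have := rho_cube t; have := rho_gt0 t; have := rho_gt0 t.+1.
set p := rho t.+1; set q := rho t; rewrite -natr1 => p0 q0 q3 p3 kp qp pq.
have pq1 : p ^+ 3 - q ^+ 3 = 1 by rewrite p3 q3; ring.
(* Twice p^3 - q^3 exceeds the left side by (p - q)(2pq + 2q^2 - p^2), which is nonnegative because
   p <= 2q. *)
have h1 : 3 * (p - q) * p ^+ 2 <= 2.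
  have two : 2 = 2 * (p ^+ 3 - q ^+ 3) :> R by rewrite pq1 mulr1.
  have : 0 <= (p - q) * (2 * p * q + 2 * q ^+ 2 - p ^+ 2).
    rewrite mulr_ge0 ?subr_ge0//; have := sqr_ge0 q.
    have : 0 <= p * (2 * q - p) by apply: mulr_ge0; [exact: ltW|rewrite subr_ge0].
    lra.
  have : 2 * (p ^+ 3 - q ^+ 3) = 3 * (p - q) * p ^+ 2 +
     (p - q) * (2 * p * q + 2 * q ^+ 2 - p ^+ 2) by ring.
  lra.
have h2 : 3 * (p - q) * p * k <= 2.
  have : 0 <= 3 * (p - q) * p * (p - k).
    apply: mulr_ge0; last by rewrite subr_ge0.
    by apply: mulr_ge0; [rewrite mulr_ge0 ?subr_ge0|exact: ltW].
  lra.
have cE : 0 <= (c - 5 / 4 - 2 / (3 * k ^+ 3)) * (3 * k ^+ 3).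
  apply: mulr_ge0; first by have := c_ge; lra.
  by apply: mulr_ge0 => //; apply: exprn_ge0; exact: ltW.
rewrite mulrBl mulrDl in cE.
have k3 : 2 / (3 * k ^+ 3) * (3 * k ^+ 3) = 2 by field; rewrite gt_eqF.
rewrite k3 in cE.
rewrite -subr_ge0.
have -> : q / k - 5 / 4 * (k / p) - (1 - c * (k / p) ^+ 2) * (p / k) =
  (3 * k ^+ 2 * p)^-1 * (c * (3 * k ^+ 3) + - (5 / 4) * (3 * k ^+ 3)
     - 3 * (p - q) * p * k) by field; rewrite !gt_eqF.
apply: mulr_ge0; last lra.
by rewrite invr_ge0; apply: mulr_ge0; [apply: mulr_ge0 => //; exact: sqr_ge0|exact: ltW].
Qed.

(** The tangent inequality for the convex function y^{4/3}, so that the bias terms telescope. In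
    cube roots it is the factorization of 3 p^4 + q^4 - 4 q p^3 by (p - q)^2. *)
Lemma rho_quartic t : rho t <= 3 / 4 * (rho t.+1 ^+ 4 - rho t ^+ 4).
Proof.
have := rho_mono (leqnSn t).
have := rho_cube t.+1; have := rho_cube t; have := rho_gt0 t; have := rho_gt0 t.+1.
set p := rho t.+1; set q := rho t; rewrite -natr1 => p0 q0 q3 p3 qp.
have pq1 : p ^+ 3 - q ^+ 3 = 1 by rewrite p3 q3; ring.
have qE : q = q * p ^+ 3 - q ^+ 4.
  by rewrite -[LHS]mulr1 -[X in q * X]pq1; ring.
have : 0 <= (p - q) ^+ 2 * (3 * p ^+ 2 + 2 * p * q + q ^+ 2).
  apply: mulr_ge0; first exact: sqr_ge0.
  have := sqr_ge0 p; have := sqr_ge0 q; have := mulr_ge0 (ltW p0) (ltW q0).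
  lra.
have -> : (p - q) ^+ 2 * (3 * p ^+ 2 + 2 * p * q + q ^+ 2) =
   3 * p ^+ 4 + q ^+ 4 - 4 * q * p ^+ 3 by ring.
lra.
Qed.

(** The inequality ln(1 + y) <= y at y = -1/x; it makes the variance terms telescope to a
    logarithm. *)
Lemma invr_le_ln t : (m + t.+1%:R)^-1 <= ln (m + t.+1%:R) - ln (m + t%:R).
Proof.
have a0 := mt0 t; have b0 := mt0 t.+1.
set x := m + t.+1%:R in b0 *; have xE : m + t%:R = x * (1 - x^-1).
  by rewrite mulrBr mulr1 divff ?gt_eqF// /x -natr1; ring.
have y0 : 0 < 1 - x^-1 by rewrite -(pmulr_rgt0 _ b0) -xE.
rewrite xE lnM ?posrE// opprD addrA subrr add0r lerNr.
by have := @le_ln1Dx R (- x^-1); apply; lra.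
Qed.

(** * Telescoping for real sequences: [g], [A], [G], [V] stand for the means of gap, squared error,
    squared gradient and squared [v] *)

Section potential.
Variables (n T : nat) (gamma L sigma mu : R) (g A G V : nat -> R).
Hypotheses (n0 : (0 < n)%N) (gamma0 : 0 < gamma) (L0 : 0 < L)
  (gamma_le : gamma <= 1 / (2 * Num.sqrt (6 * n%:R) * L)).
Let step t := step_size k m t.
Let alpha t := momentum c k m t.+1.
Hypotheses (g0 : forall t, (1 <= t <= T.+1)%N -> 0 <= g t)
  (A0 : forall t, (1 <= t <= T.+1)%N -> 0 <= A t)
  (G0 : forall t, (1 <= t <= T)%N -> 0 <= G t)
  (V0 : forall t, (1 <= t <= T)%N -> 0 <= V t).
Hypothesis descent : forall t, (1 <= t <= T)%N ->
  g t.+1 + gamma * step t / 2 * G t + gamma * step t / 4 * V t <=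
  g t + gamma * step t / 2 * A t.
Hypothesis variance : forall t, (1 <= t <= T)%N ->
  A t.+1 <= (1 - alpha t) ^+ 2 * A t + 2 * alpha t ^+ 2 * sigma ^+ 2 +
   2 * (1 - alpha t) ^+ 2 * (3 * n%:R * L ^+ 2 * ((gamma * step t) ^+ 2 * V t) +
     3 / 2 * L ^+ 2 * n%:R ^+ 2 * mu ^+ 2).
Hypothesis variance1 : A 1%N <= sigma ^+ 2.

Let gamma_sqr : 6 * n%:R * L ^+ 2 * gamma ^+ 2 <= 1 / 4.
Proof.
have nR : (0 : R) < n%:R by rewrite ltr0n.
have := gamma_le; set s := Num.sqrt (6 * n%:R) => gle.
have s0 : 0 < s by rewrite sqrtr_gt0 mulr_gt0.
have s2 : s ^+ 2 = 6 * n%:R by rewrite sqr_sqrtr// mulr_ge0.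
have h : gamma * (2 * s * L) <= 1.
  by rewrite -ler_pdivlMr//; apply: mulr_gt0 => //; exact: mulr_gt0.
have h0 : 0 <= gamma * (2 * s * L) by rewrite !mulr_ge0// ltW.
have := ler_pM h0 h0 h h; rewrite mul1r -s2.
have -> : gamma * (2 * s * L) * (gamma * (2 * s * L)) =
  4 * (s ^+ 2 * L ^+ 2 * gamma ^+ 2) by ring.
lra.
Qed.

(** The index lags by one: [Phi t] belongs to iterate t + 1, whose error has weight gamma/eta_t. The
    initial value thus has weight rho 0 = m^{1/3}, the source of the term m^{1/3} sigma^2 / k^2 in
    M. *)
Let Phi t := g t.+1 + gamma * (rho t / k) * A t.+1.

Let step_gt0 t : 0 < step t.
Proof. by rewrite /step step_sizeE divr_gt0 ?rho_gt0. Qed.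

Let potential_step t : (t < T)%N ->
  Phi t.+1 + gamma * step t.+1 / 2 * G t.+1 <= Phi t +
    gamma * (2 * c ^+ 2 * k ^+ 3 * sigma ^+ 2 * (m + t.+1%:R)^-1 +
             3 * L ^+ 2 * n%:R ^+ 2 * mu ^+ 2 / k * rho t).
Proof.
move=> tT; rewrite /Phi.
have t1 : (1 <= t.+1 <= T)%N by [].
have t2 : (1 <= t.+1 <= T.+1)%N by rewrite /= ltnS ltnW.
have := descent t1; have := variance t1; have := V0 t1; have := A0 t2.
have [a0 a1] := andP (momentum01 t.+2); have := momentum_decay t.
rewrite -/(alpha t.+1) -/(step t.+1) in a0 a1 *.
have := step_gt0 t.+1; have := rho_gt0 t.+1; have := rho_gt0 t.
have aE : alpha t.+1 = c * step t.+1 ^+ 2 by rewrite /alpha /momentum.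
have sE : step t.+1 = k / rho t.+1 by rewrite /step step_sizeE.
have pE := rho_cube t.+1; have L2 := gamma_sqr; have gm := gamma0; have kk := k0.
set p := rho t.+1 in sE pE *; set q := rho t; set a := alpha t.+1 in a0 a1 aE *.
set e := step t.+1 in sE aE *; set At := A t.+1; set At1 := A t.+2.
set Vt := V t.+1; set nR := n%:R in L2 *.
move=> q0 p0 e0 decay At0 Vt0 var desc.
have r0 : 0 < p / k by rewrite divr_gt0.
have re : p / k * e = 1 by rewrite sE; field; rewrite !gt_eqF.
have b0 : 0 <= 1 - a by lra.
have b1 : (1 - a) ^+ 2 <= 1 - a by rewrite expr2 ler_piMr//; lra.
have b2 : (1 - a) ^+ 2 <= 1 by lra.
have rb : p / k * (1 - a) ^+ 2 <= q / k - 5 / 4 * e.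
  by apply: le_trans decay; rewrite mulrC; apply: ler_wpM2r => //; exact: ltW.
have termA : p / k * ((1 - a) ^+ 2 * At) <= (q / k - 5 / 4 * e) * At.
  by rewrite mulrA; exact: ler_wpM2r.
(* a^2 / e = c^2 e^3, and e^3 = k^3 / (m + t + 1) is the reciprocal that sums to a logarithm. *)
have termS : p / k * (2 * a ^+ 2 * sigma ^+ 2) =
    2 * c ^+ 2 * k ^+ 3 * sigma ^+ 2 * (m + t.+1%:R)^-1.
  by rewrite aE sE -pE; field; rewrite !gt_eqF.
(* By [gamma_sqr] this cost is no more than what the descent yields in front of [Vt], up to the
   common factor gamma. *)
have termV : p / k * (2 * (1 - a) ^+ 2 * (3 * nR * L ^+ 2 * ((gamma * e) ^+ 2 * Vt)))
    <= e / 4 * Vt.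
  have -> : p / k * (2 * (1 - a) ^+ 2 * (3 * nR * L ^+ 2 * ((gamma * e) ^+ 2 * Vt))) =
    (p / k * e) * ((1 - a) ^+ 2 * (6 * nR * L ^+ 2 * gamma ^+ 2) * (e * Vt)) by ring.
  have -> : e / 4 * Vt = (p / k * e) * (1 * (1 / 4) * (e * Vt)) by rewrite re; field.
  rewrite re !mul1r; apply: ler_wpM2r; first by rewrite mulr_ge0// ltW.
  rewrite mul1r in L2; apply: le_trans L2; apply: ler_piMl => //.
  have nR0 : 0 <= nR by [].
  by do 2 (apply: mulr_ge0; last exact: sqr_ge0); exact: mulr_ge0.
have termM : p / k * (2 * (1 - a) ^+ 2 * (3 / 2 * L ^+ 2 * nR ^+ 2 * mu ^+ 2)) <=
    3 * L ^+ 2 * nR ^+ 2 * mu ^+ 2 / k * q.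
  have K0 : 0 <= 3 * L ^+ 2 * nR ^+ 2 * mu ^+ 2.
    by do 3 (apply: mulr_ge0; last exact: sqr_ge0).
  have -> : p / k * (2 * (1 - a) ^+ 2 * (3 / 2 * L ^+ 2 * nR ^+ 2 * mu ^+ 2)) =
    3 * L ^+ 2 * nR ^+ 2 * mu ^+ 2 * (p / k * (1 - a) ^+ 2) by field; rewrite gt_eqF.
  rewrite -[leRHS]mulrA; apply: ler_wpM2l => //; apply: le_trans rb _.
  by rewrite mulrC; lra.
have W : p / k * At1 <= (q / k - 5 / 4 * e) * At +
    2 * c ^+ 2 * k ^+ 3 * sigma ^+ 2 * (m + t.+1%:R)^-1 + e / 4 * Vt +
    3 * L ^+ 2 * nR ^+ 2 * mu ^+ 2 / k * q.
  apply: le_trans (ler_wpM2l (ltW r0) var) _.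
  move: termA termV termM; rewrite -termS.
  set X := p / k; set Y := (1 - a) ^+ 2.
  by rewrite !mulrDr => h1 h2 h3; lra.
have gW := ler_wpM2l (ltW gm) W.
(* Of the decay (5/4) gamma e At, the part (1/2) gamma e At cancels the error term of the descent;
   the remainder is discarded by its sign. *)
have := mulr_ge0 (mulr_ge0 (ltW gm) (ltW e0)) At0.
move: gW desc; set S := 2 * c ^+ 2 * _ * _ * _; set M := _ / k * q.
by rewrite !mulrDr !mulrA => h1 h2 h3; lra.
Qed.

Let potential_sum s : (s <= T)%N ->
  \sum_(1 <= t < s.+1) gamma * step t / 2 * G t + Phi s <= Phi 0 +
    gamma * (2 * c ^+ 2 * k ^+ 3 * sigma ^+ 2 * (ln (m + s%:R) - ln (m + 0%:R)) +
      3 * L ^+ 2 * n%:R ^+ 2 * mu ^+ 2 / k * (3 / 4 * (rho s ^+ 4 - rho 0 ^+ 4))).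
Proof.
elim: s => [_|s IH sT]; first by rewrite big_geq// !subrr !mulr0 addr0 mulr0 addr0 add0r.
rewrite big_nat_recr//=; have := IH (ltnW sT); have := potential_step sT.
have K1 : 0 <= 2 * c ^+ 2 * k ^+ 3 * sigma ^+ 2.
  apply: mulr_ge0; last exact: sqr_ge0.
  apply: mulr_ge0; last by apply: exprn_ge0; exact: ltW.
  by apply: mulr_ge0 => //; exact: sqr_ge0.
have K2 : 0 <= 3 * L ^+ 2 * n%:R ^+ 2 * mu ^+ 2 / k.
  apply: divr_ge0; last exact: ltW.
  by do 2 (apply: mulr_ge0; last exact: sqr_ge0); apply: mulr_ge0 => //; exact: sqr_ge0.
have := ler_wpM2l (ltW gamma0) (ler_wpM2l K1 (invr_le_ln s)).
have := ler_wpM2l (ltW gamma0) (ler_wpM2l K2 (rho_quartic s)).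
move: (\sum_(_ <= _ < _) _) (_ * G _) (Phi _) (Phi _) (Phi _).
by move=> *; lra.
Qed.

Hypotheses (T0 : (0 < T)%N) (mu0 : 0 < mu)
  (mu_le : mu <= 1 / (n%:R * (m + T%:R) `^ (2 / 3))).

Lemma acc_zom_rate : \sum_(1 <= t < T.+1) G t <=
  2 * (g 1%N / (k * gamma) + m `^ (1 / 3) * sigma ^+ 2 / k ^+ 2 +
       9 * L ^+ 2 / (4 * k ^+ 2) +
       2 * k ^+ 2 * c ^+ 2 * sigma ^+ 2 * ln (m + T%:R)) * rho T.
Proof.
set M := (_ + _); have := potential_sum (leqnn T).
have PT : 0 <= Phi T.
  have TT : (1 <= T.+1 <= T.+1)%N by rewrite leqnn.
  rewrite /Phi; apply: addr_ge0; first exact: g0.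
  apply: mulr_ge0; last exact: A0.
  by apply: mulr_ge0; [exact: ltW|apply: divr_ge0; [exact: rho_ge0|exact: ltW]].
have r0E : rho 0 = m `^ (1 / 3) by rewrite /rho mulr0n addr0.
have P0 : Phi 0 <= g 1%N + gamma * (m `^ (1 / 3) / k) * sigma ^+ 2.
  rewrite /Phi -r0E lerD2l; apply: ler_wpM2l => //.
  by apply: mulr_ge0; [exact: ltW|apply: divr_ge0; [exact: rho_ge0|exact: ltW]].
(* Step sizes decrease, so the last one may be factored out of the whole sum; this produces the
   factor rho T of the conclusion. *)
have lb : gamma * (k / rho T) / 2 * \sum_(1 <= t < T.+1) G t <=
    \sum_(1 <= t < T.+1) gamma * step t / 2 * G t.
  rewrite mulr_sumr !big_nat; apply: ler_sum => t /andP[t1 tT].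
  apply: ler_wpM2r; first by apply: G0; rewrite t1.
  rewrite ler_pM2r// ler_pM2l// /step step_sizeE ler_pM2l// lef_pV2 ?posrE ?rho_gt0//.
  by apply: rho_mono.
have lnm : 0 <= ln (m + 0%:R).
  by rewrite mulr0n addr0 ln_ge0//; have := m2; lra.
have K1 : 0 <= 2 * c ^+ 2 * k ^+ 3 * sigma ^+ 2.
  apply: mulr_ge0; last exact: sqr_ge0.
  apply: mulr_ge0; last by apply: exprn_ge0; exact: ltW.
  by apply: mulr_ge0 => //; exact: sqr_ge0.
(* The condition on mu says n mu (rho T)^2 <= 1; this is its square. *)
have bias : n%:R ^+ 2 * mu ^+ 2 * rho T ^+ 4 <= 1.
  have nR : (0 : R) < n%:R by rewrite ltr0n.
  have r2 : (m + T%:R) `^ (2 / 3) = rho T ^+ 2.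
    by rewrite /rho -powR_mulrn ?powR_ge0// -powRrM; congr (_ `^ _); field.
  have := mu_le; rewrite r2 ler_pdivlMr ?mulr_gt0 ?exprn_gt0 ?rho_gt0// => h.
  have h0 : 0 <= mu * (n%:R * rho T ^+ 2).
    by apply: mulr_ge0; [exact: ltW|apply: mulr_ge0 => //; exact: sqr_ge0].
  have := ler_pM h0 h0 h h; rewrite mul1r.
  by congr (_ <= _); ring.
have b1 : 3 * L ^+ 2 * n%:R ^+ 2 * mu ^+ 2 / k * (3 / 4 * (rho T ^+ 4 - rho 0 ^+ 4)) <=
    9 * L ^+ 2 / (4 * k).
  have r04 : 0 <= rho 0 ^+ 4 by apply: exprn_ge0.
  have K0 : 0 <= 9 * L ^+ 2 / (4 * k).
    by apply: divr_ge0; [apply: mulr_ge0 => //; exact: sqr_ge0|rewrite mulr_ge0// ltW].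
  have -> : 3 * L ^+ 2 * n%:R ^+ 2 * mu ^+ 2 / k * (3 / 4 * (rho T ^+ 4 - rho 0 ^+ 4))
   = 9 * L ^+ 2 / (4 * k) * (n%:R ^+ 2 * mu ^+ 2 * rho T ^+ 4 -
       n%:R ^+ 2 * mu ^+ 2 * rho 0 ^+ 4) by field; rewrite gt_eqF.
  have Z : 0 <= n%:R ^+ 2 * mu ^+ 2 * rho 0 ^+ 4.
    by apply: mulr_ge0 => //; apply: mulr_ge0; exact: sqr_ge0.
  by rewrite -[leRHS]mulr1; apply: ler_wpM2l => //; lra.
have l1 : 2 * c ^+ 2 * k ^+ 3 * sigma ^+ 2 * (ln (m + T%:R) - ln (m + 0%:R)) <=
   2 * c ^+ 2 * k ^+ 3 * sigma ^+ 2 * ln (m + T%:R).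
  by apply: ler_wpM2l => //; lra.
have := ler_wpM2l (ltW gamma0) (lerD l1 b1).
move=> h1 h2.
have {h1 h2} : gamma * (k / rho T) / 2 * \sum_(1 <= t < T.+1) G t <=
    gamma * k * M.
  have -> : gamma * k * M = g 1%N + gamma * (m `^ (1 / 3) / k) * sigma ^+ 2 +
     gamma * (2 * c ^+ 2 * k ^+ 3 * sigma ^+ 2 * ln (m + T%:R) + 9 * L ^+ 2 / (4 * k)).
    by rewrite /M; field; rewrite !gt_eqF.
  lra.
have rT := rho_gt0 T; set Sm := \sum_(_ <= _ < _) _ => h.
have gk : 0 < 2 * rho T / (gamma * k) by rewrite divr_gt0// mulr_gt0.
have := ler_wpM2l (ltW gk) h.
have -> : 2 * rho T / (gamma * k) * (gamma * (k / rho T) / 2 * Sm) = Sm.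
  by field; rewrite !gt_eqF.
by have -> : 2 * rho T / (gamma * k) * (gamma * k * M) = 2 * M * rho T
  by field; rewrite !gt_eqF.
Qed.

End potential.
End rates.

(** * The algorithm *)

Section draws.
Context {R : realType} {n : nat} {dO dX : measure_display}
  {Omega : measurableType dO} {Xi : measurableType dX}.
Variables (P : probability Omega R) (D : probability Xi R) (T : nat).
Variables (xi : nat -> {RV P >-> Xi}) (u : nat -> {RV P >-> 'rV[R]_n}).
Hypothesis draws : fresh_draws D T xi u.
Notation S := (unif_sphere R n).

Definition draw_system (i : 'I_T.+1 + 'I_T.+1) : set (set Omega) :=
  match i with
  | inl j => sigma_of (xi j.+1)
  | inr j => sigma_of (u j.+1)
  end.

Definition draw_index (i : 'I_T.+1 + 'I_T.+1) : nat :=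
  match i with inl j => j | inr j => j end.

(** Index j stands for draw j + 1, so the strict inequality selects the draws 1 to t, and [drawn 0]
    selects none. *)
Definition drawn (t : nat) : pred ('I_T.+1 + 'I_T.+1) :=
  fun i => (draw_index i < t)%N.

(* Omega with the sigma-algebra of the first t draws. *)
Definition draw_history (t : nat) : measurableType _ :=
  g_sigma_algebraType (past draw_system (drawn t)).

Lemma sigma_of_preimage {d'} {V : measurableType d'} (X : Omega -> V) A :
  measurable A -> sigma_of X (X @^-1` A).
Proof. by move=> mA; exists A => //; rewrite setTI. Qed.

Lemma sigma_of_setT {d'} {V : measurableType d'} (X : Omega -> V) :
  sigma_of X setT.
Proof. by exists setT => //; rewrite setTI preimage_setT. Qed.

Lemma sigma_of_setI {d'} {V : measurableType d'} (X : Omega -> V) :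
  setI_closed (sigma_of X).
Proof.
move=> _ _ [A mA <-] [B mB <-]; exists (A `&` B); first exact: measurableI.
by rewrite !setTI preimage_setI.
Qed.

Lemma sigma_of_measurable {d'} {V : measurableType d'} (X : {RV P >-> V}) :
  sigma_of X `<=` measurable.
Proof. by move=> _ [A mA <-]; rewrite setTI; exact: measurable_sfunP. Qed.

Lemma draw_system_setT i : draw_system i setT.
Proof. by case: i => j; exact: sigma_of_setT. Qed.

Lemma draw_system_setI i : setI_closed (draw_system i).
Proof. by case: i => j; exact: sigma_of_setI. Qed.

Lemma draw_system_measurable i : draw_system i `<=` measurable.
Proof. by case: i => j; exact: sigma_of_measurable. Qed.

Lemma draw_indep : mutually_independent P draw_system.
Proof. by case: draws. Qed.

Lemma past_measurable_fun (K : pred ('I_T.+1 + 'I_T.+1)) {d'}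
    {V : measurableType d'} (H : Omega -> V) :
  measurable_fun setT (H : g_sigma_algebraType (past draw_system K) -> V) ->
  measurable_fun [set: Omega] H.
Proof.
move=> mH _ A mA.
have := mH measurableT A mA.
apply: smallest_sub; first exact: sigma_algebra_measurable.
by apply: past_measurable; exact: draw_system_measurable.
Qed.

Lemma past_measurable_mono (K K' : pred ('I_T.+1 + 'I_T.+1)) {d'}
    {V : measurableType d'} (H : Omega -> V) : subpred K K' ->
  measurable_fun setT (H : g_sigma_algebraType (past draw_system K) -> V) ->
  measurable_fun setT (H : g_sigma_algebraType (past draw_system K') -> V).
Proof.
move=> KK' mH _ A mA.
have := mH measurableT A mA.
apply: smallest_sub; first exact: smallest_sigma_algebra.
apply: subset_trans (@sub_sigma_algebra _ _ _).
exact: past_mono.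
Qed.

Lemma measurable_draw_xi (K : pred ('I_T.+1 + 'I_T.+1)) (j : 'I_T.+1) :
  K (inl j) ->
  measurable_fun setT (xi j.+1 : g_sigma_algebraType (past draw_system K) -> Xi).
Proof.
move=> Kj _ A mA; rewrite setTI; apply: sub_sigma_algebra.
apply: (sub_past draw_system_setT Kj); exact: sigma_of_preimage.
Qed.

Lemma measurable_draw_u (K : pred ('I_T.+1 + 'I_T.+1)) (j : 'I_T.+1) :
  K (inr j) ->
  measurable_fun setT
    (u j.+1 : g_sigma_algebraType (past draw_system K) -> 'rV[R]_n).
Proof.
move=> Kj _ A mA; rewrite setTI; apply: sub_sigma_algebra.
apply: (sub_past draw_system_setT Kj); exact: sigma_of_preimage.
Qed.

Lemma integral_fresh_draw {d'} {U : measurableType d'} (t : nat)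
    (H : Omega -> U) (Psi : U * (Xi * 'rV[R]_n) -> \bar R) : (t <= T)%N ->
  measurable_fun setT (H : draw_history t -> U) ->
  measurable_fun setT Psi -> (forall z, 0 <= Psi z)%E ->
  (\int[P]_w Psi (H w, (xi t.+1 w, u t.+1 w)) =
   \int[P]_w \int[D \x S]_z Psi (H w, z))%E.
Proof.
move=> tT mH mPsi Psi0; have tT' : (t < T.+1)%N by [].
pose j := Ordinal tT'; have t1 : (1 <= t.+1 <= T.+1)%N by [].
have [lawxi lawu _] := draws.
apply: integral_freeze2 => //.
- exact: past_measurable_fun mH.
- move=> A C mA mC; rewrite -(lawxi t.+1 t1 _ mC).
  apply: (@past_indep _ _ _ P _ draw_system draw_system_setT draw_system_setI
    draw_system_measurable draw_indep (drawn t) (inl j)).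
  + by rewrite /drawn /= ltnn.
  + exact: sigma_of_preimage.
  + by have := mH measurableT A mA; rewrite setTI.
- move=> A C mA mC; rewrite -(lawu t.+1 t1 _ mC).
  (* The direction must be independent of H and the fresh sample jointly, so that sample is added to
     the past. *)
  pose K : pred ('I_T.+1 + 'I_T.+1) := fun i => drawn t i || (i == inl j).
  apply: (@past_indep _ _ _ P _ draw_system draw_system_setT draw_system_setI
    draw_system_measurable draw_indep K (inr j)).
  + by rewrite /K /drawn /= ltnn.
  + exact: sigma_of_preimage.
  + have mH' : measurable_fun setT (H : g_sigma_algebraType (past draw_system K) -> U).
      by apply: past_measurable_mono mH => i; rewrite /K => ->.
    have mX' := @measurable_draw_xi K j.
    have Kj : K (inl j) by rewrite /K eqxx orbT.
    have := measurable_fun_pair mH' (mX' Kj) measurableT mA.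
    by rewrite setTI.
Qed.

End draws.

(** * Adaptedness, descent and integrability along a run *)

Section acc_zom.
Context {R : realType} {n : nat} {dO dX : measure_display}
  {Omega : measurableType dO} {Xi : measurableType dX}.
Hypothesis n_gt0 : (0 < n)%N.
Variables (P : probability Omega R) (D : probability Xi R).
Variables (F : 'rV[R]_n -> Xi -> R) (mu gamma k m c L sigma : R) (T : nat)
  (x1 : 'rV[R]_n).
Let f := objective D F.
Let fmu := smoothing mu f.
Let fstar := inf (range f).
Hypotheses (mu0 : 0 < mu) (L0 : 0 < L)
  (smF : forall z, smooth L (F^~ z) (grad (F^~ z)))
  (F_int : forall x, integ D (F x))
  (A1 : forall x : 'rV[R]_n,
      (\int[D \x unif_sphere R n]_w
          (norm2 (zo_grad mu (F^~ w.1) w.2 x - grad fmu x) ^+ 2)%:E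
       <= (sigma ^+ 2)%:E)%E)
  (A3 : has_lbound (range f)).
Variables (xi : nat -> {RV P >-> Xi}) (u : nat -> {RV P >-> 'rV[R]_n}).
Hypothesis draws : fresh_draws D T xi u.
Variables (x v : nat -> Omega -> 'rV[R]_n).
Hypothesis run : forall w : Omega,
  acc_zom_run F mu gamma k m c T x1 (fun t => xi t w) (fun t => u t w)
        (fun t => x t w) (fun t => v t w).
Hypotheses (gamma0 : 0 < gamma) (k0 : 0 < k) (m2 : 2 <= m)
  (mk : k ^+ 3 <= m) (mck : (c * k) ^+ 3 <= m)
  (c_ge : 2 / (3 * k ^+ 3) + 5 / 4 <= c)
  (gamma_le1 : gamma <= m `^ (1 / 3) / (2 * L * k))
  (gamma_le2 : gamma <= 1 / (2 * Num.sqrt (6 * n%:R) * L)).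

Let L0' : 0 <= L. Proof. exact: ltW. Qed.
Let step t := step_size k m t.
Let alpha t := momentum c k m t.+1.
Let smf : smooth L f (grad f). Proof. exact: smooth_objective. Qed.
Let smfmu : smooth L fmu (grad fmu). Proof. exact: smooth_smoothing smf. Qed.

Let x_1 : x 1%N = cst x1.
Proof. by apply/funext => w; have [] := run w. Qed.

Let v_1 : v 1%N = fun w => zo_grad mu (F^~ (xi 1%N w)) (u 1%N w) x1.
Proof. by apply/funext => w; have [] := run w. Qed.

Let x_S t : (1 <= t <= T)%N ->
  x t.+1 = fun w => x t w - (gamma * step t) *: v t w.
Proof. by move=> tT; apply/funext => w; have [_ _ /(_ t tT)[]] := run w. Qed.

Let v_S t : (1 <= t <= T)%N -> v t.+1 = fun w =>
  zo_grad mu (F^~ (xi t.+1 w)) (u t.+1 w) (x t.+1 w) +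
  (1 - alpha t) *: (v t w - zo_grad mu (F^~ (xi t.+1 w)) (u t.+1 w) (x t w)).
Proof. by move=> tT; apply/funext => w; have [_ _ /(_ t tT)[]] := run w. Qed.

Let history_measurable t : (1 <= t <= T.+1)%N ->
  measurable_fun setT (x t : draw_history T xi u t -> _) /\
  measurable_fun setT (v t : draw_history T xi u t -> _).
Proof.
elim: t => [//|t IH] /andP[_ tT].
have tT1 : (t < T.+1)%N by [].
have drt : drawn (T := T) t.+1 (inl (Ordinal tT1)) by rewrite /drawn /=.
have drt' : drawn (T := T) t.+1 (inr (Ordinal tT1)) by rewrite /drawn /=.
have mxi : measurable_fun setT (xi t.+1 : draw_history T xi u t.+1 -> Xi).
  exact: measurable_draw_xi drt.
have mu_ : measurable_fun setT (u t.+1 : draw_history T xi u t.+1 -> 'rV[R]_n).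
  exact: measurable_draw_u drt'.
case: t IH tT tT1 drt drt' mxi mu_ => [_|t IH] tT tT1 drt drt' mxi mu_.
  rewrite x_1 v_1; split; first exact: measurable_cst.
  have mx1 : measurable_fun setT (cst x1 : draw_history T xi u 1 -> _).
    exact: measurable_cst.
  exact: (measurable_zo_comp mu L0' smF F_int mx1 mu_ mxi).
have [mx mv] : measurable_fun setT (x t.+1 : draw_history T xi u t.+2 -> _) /\
    measurable_fun setT (v t.+1 : draw_history T xi u t.+2 -> _).
  have tT2 : (1 <= t.+1 <= T.+1)%N by rewrite /= ltnW.
  have [mx mv] := IH tT2.
  have sub : subpred (drawn (T := T) t.+1) (drawn t.+2).
    by move=> i; rewrite /drawn => /ltnW; rewrite ltnS.
  by split; [exact: past_measurable_mono sub mx|exact: past_measurable_mono sub mv].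
have tT2 : (1 <= t.+1 <= T)%N by [].
have mx' : measurable_fun setT (x t.+2 : draw_history T xi u t.+2 -> _).
  by rewrite x_S//; apply: measurable_rVB => //; exact: measurable_rVZ.
split=> //; rewrite v_S//; apply: measurable_rVD.
  exact: (measurable_zo_comp mu L0' smF F_int mx' mu_ mxi).
apply/measurable_rVZ/measurable_rVB => //.
exact: (measurable_zo_comp mu L0' smF F_int mx mu_ mxi).
Qed.

Let measurable_x t : (1 <= t <= T.+1)%N -> measurable_fun setT (x t).
Proof. by move=> tT; exact: past_measurable_fun (history_measurable tT).1. Qed.

Let measurable_v t : (1 <= t <= T.+1)%N -> measurable_fun setT (v t).
Proof. by move=> tT; exact: past_measurable_fun (history_measurable tT).2. Qed.

Let measurable_grad_fmu : measurable_fun setT (grad fmu).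
Proof.
apply/measurable_fun_rVP => i.
exact: measurable_calm (smooth_calm_grad i smfmu).
Qed.

Let err t w := v t w - grad fmu (x t w).

Let measurable_err t : (1 <= t <= T.+1)%N -> measurable_fun setT (err t).
Proof.
move=> tT; apply: measurable_rVB; first exact: measurable_v.
exact: measurableT_comp measurable_grad_fmu (measurable_x tT).
Qed.

Let next_err_sqr (a : R)
    (p : (('rV[R]_n * 'rV[R]_n) * 'rV[R]_n) * (Xi * 'rV[R]_n)) : \bar R :=
  (norm2 (zo_grad mu (F^~ p.2.1) p.2.2 p.1.1.2 +
    (1 - a) *: (p.1.2 - zo_grad mu (F^~ p.2.1) p.2.2 p.1.1.1) -
    grad fmu p.1.1.2) ^+ 2)%:E.

Let next_err_sqr_ge0 a p : (0 <= next_err_sqr a p)%E.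
Proof. by rewrite lee_fin sqr_ge0. Qed.

Let measurable_next_err_sqr a : measurable_fun setT (next_err_sqr a).
Proof.
pose TT := ((('rV[R]_n * 'rV[R]_n) * 'rV[R]_n) * (Xi * 'rV[R]_n))%type.
have mz1 : measurable_fun setT (fun p : TT => p.2.1).
  exact: measurableT_comp measurable_fst measurable_snd.
have mz2 : measurable_fun setT (fun p : TT => p.2.2).
  exact: measurableT_comp measurable_snd measurable_snd.
have mh12 : measurable_fun setT (fun p : TT => p.1.1.2).
  exact: measurableT_comp measurable_snd (measurableT_comp measurable_fst measurable_fst).
have mh11 : measurable_fun setT (fun p : TT => p.1.1.1).
  exact: measurableT_comp measurable_fst (measurableT_comp measurable_fst measurable_fst).
have mh2 : measurable_fun setT (fun p : TT => p.1.2).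
  exact: measurableT_comp measurable_snd measurable_fst.
apply/measurable_EFinP/measurable_norm2_sqr/measurable_rVB.
  apply: measurable_rVD; first exact: (measurable_zo_comp mu L0' smF F_int).
  apply/measurable_rVZ/measurable_rVB => //.
  exact: (measurable_zo_comp mu L0' smF F_int).
exact: measurableT_comp measurable_grad_fmu mh12.
Qed.

Let integral_next_err_sqr t (H : Omega -> ('rV[R]_n * 'rV[R]_n) * 'rV[R]_n)
    (a : R) :
  (t <= T)%N -> measurable_fun setT (H : draw_history T xi u t -> _) ->
  (\int[P]_w next_err_sqr a (H w, (xi t.+1 w, u t.+1 w)) =
   \int[P]_w \int[D \x unif_sphere R n]_z next_err_sqr a (H w, z))%E.
Proof.
move=> tT mH; exact: (integral_fresh_draw draws tT mH).
Qed.

Let fstar_le y : fstar <= f y.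
Proof. by apply: ge_inf => //; exists y. Qed.

Let fstar_le_smoothing y : fstar <= fmu y.
Proof.
rewrite /fmu smoothingE -(mean_cst (unif_ball R n) fstar).
apply: mean_le => [||s]; [exact: integ_cst| |exact: fstar_le].
have Lm : 0 <= L * mu ^+ 2 by rewrite mulr_ge0 ?sqr_ge0.
have [C [C0 bC]] := smooth_ball_bound Lm ler01 (smooth_dilate mu0 smf y).
apply: (@integ_unif_ball _ _ _ C) => [|s s1]; last by have [] := bC s s1.
exact: measurable_calm (smooth_calm Lm (smooth_dilate mu0 smf y)).
Qed.

Let gap t w := fmu (x t w) - fstar.
Let grad_sqr t w := norm2 (grad fmu (x t w)) ^+ 2.
Let v_sqr t w := norm2 (v t w) ^+ 2.
Let err_sqr t w := norm2 (err t w) ^+ 2.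

Let step_gt0 t : 0 < step t.
Proof. by rewrite /step step_sizeE divr_gt0 ?rho_gt0. Qed.

Let gamma_step t : L * (gamma * step t) <= 1 / 2.
Proof.
have r0 : rho m 0 = m `^ (1 / 3) by rewrite /rho mulr0n addr0.
have := gamma_le1; rewrite -r0 ler_pdivlMr ?mulr_gt0// => h.
have mono : rho m 0 <= rho m t by apply: rho_mono.
have rt : 0 < rho m t by exact: rho_gt0.
rewrite /step step_sizeE !mulrA ler_pdivrMr//.
lra.
Qed.

(** Polarization writes -<grad, v> as half of |v - grad|^2 - |grad|^2 - |v|^2. The smoothness term
    spends half of the |v|^2 thus gained, by [gamma_step], and leaves gamma eta_t / 4. *)
Let descent_pointwise t w : (1 <= t <= T)%N ->
  gap t.+1 w + gamma * step t / 2 * grad_sqr t w +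
    gamma * step t / 4 * v_sqr t w <=
  gap t w + gamma * step t / 2 * err_sqr t w.
Proof.
move=> tT; have := smfmu.1 (x t w) (x t.+1 w).
have E : x t.+1 w - x t w = - (gamma * step t) *: v t w.
  by rewrite x_S// addrC addrA addNr add0r scaleNr.
rewrite E dotZr norm2Z normrN exprMn real_normK ?num_real// => /ler_normlW.
rewrite /gap /grad_sqr /v_sqr /err_sqr /err.
set a := gamma * step t; have a0 : 0 < a by rewrite mulr_gt0.
rewrite !norm2_sqr !(dotDl, dotDr, dotNl, dotNr) (dotC (v t w) (grad _ _)).
have := gamma_step t; rewrite -/a.
set p := dot (grad _ _) (grad _ _); set q := dot (grad _ _) (v t w).
have := dotxx_ge0 (v t w); set r := dot (v t w) (v t w) => r0 La.
have : 0 <= (1 / 2 - L * a) * (a * r).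
  by apply: mulr_ge0; [rewrite subr_ge0|apply: mulr_ge0 => //; exact: ltW].
lra.
Qed.

(** The left side is an extended real because integrability of the next error is not yet known; this
    very bound supplies it in [integ_gap_err]. *)
Let bound_mean t : (1 <= t <= T)%N -> integ P (err_sqr t) -> integ P (v_sqr t) ->
  (\int[P]_w (err_sqr t.+1 w)%:E <=
   ((1 - alpha t) ^+ 2 * mean P (err_sqr t) + 2 * alpha t ^+ 2 * sigma ^+ 2 +
    2 * (1 - alpha t) ^+ 2 *
    (3 * n%:R * L ^+ 2 * ((gamma * step t) ^+ 2 * mean P (v_sqr t)) +
     3 / 2 * L ^+ 2 * n%:R ^+ 2 * mu ^+ 2))%:E)%E.
Proof.
move=> tT ie iv.
have t2 : (1 <= t <= T.+1)%N by case/andP: tT => -> /leqW.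
have [mx mv] := history_measurable t2.
(* The iterate x_{t+1} is already a function of the first t draws, so it can be frozen while draw t
   + 1 is integrated out. *)
have mx' : measurable_fun setT (x t.+1 : draw_history T xi u t -> _).
  by rewrite x_S//; apply: measurable_rVB => //; exact: measurable_rVZ.
pose H w := ((x t w, x t.+1 w), v t w).
have mH : measurable_fun setT (H : draw_history T xi u t -> _).
  by apply: measurable_fun_pair => //; exact: measurable_fun_pair.
have tT' : (t <= T)%N by case/andP: tT.
pose NE w := (\int[D \x unif_sphere R n]_z next_err_sqr (alpha t) (H w, z))%E.
have -> : (\int[P]_w (err_sqr t.+1 w)%:E = \int[P]_w NE w)%E.
  rewrite -(integral_next_err_sqr (alpha t) tT' mH); apply: eq_integral => w _.
  by rewrite /err_sqr /err v_S.
pose a := alpha t.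
have a01 : 0 <= a <= 1 by exact: momentum01.
pose K0 := 2 * a ^+ 2 * sigma ^+ 2 +
  2 * (1 - a) ^+ 2 * (3 / 2 * L ^+ 2 * n%:R ^+ 2 * mu ^+ 2).
pose K1 := (1 - a) ^+ 2.
pose K2 := 2 * (1 - a) ^+ 2 * (3 * n%:R * L ^+ 2 * (gamma * step t) ^+ 2).
have i1 := integZ K1 ie; have i2 := integZ K2 iv; have i0 := integ_cst P K0.
have i12 := integD i1 i2; have i3 := integD i12 i0.
rewrite -/a (_ : _ + _ + _ =
  mean P (fun w => K1 * err_sqr t w + K2 * v_sqr t w + cst K0 w)); last first.
  rewrite (meanD i12 i0) (meanD i1 i2) (meanZ K1 ie) (meanZ K2 iv).
  by rewrite mean_cst /K0 /K1 /K2; ring.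
rewrite EFin_mean//; apply: ge0_le_integral => //.
- by move=> w _; apply: integral_ge0 => z _; exact: next_err_sqr_ge0.
- apply: (measurableT_comp (f := fun h =>
    (\int[D \x unif_sphere R n]_z next_err_sqr (alpha t) (h, z))%E)); last first.
    exact: past_measurable_fun mH.
  pose Q : probability (Xi * 'rV[R]_n)%type R := (D \x unif_sphere R n)%E.
  exact: (@measurable_fun_fubini_tonelli_F _ _ _ _ _ Q (next_err_sqr (alpha t))
    (@measurable_next_err_sqr (alpha t)) (@next_err_sqr_ge0 (alpha t))).
- by apply/measurable_EFinP; exact: integ_measurable i3.
move=> w _; apply: le_trans (acc_zom_error_step n_gt0 mu0 L0' smF F_int A1 _ _ _ a01) _.
rewrite lee_fin /H/= -/(err t w) -/(err_sqr t w).
have -> : norm2 (x t.+1 w - x t w) ^+ 2 = (gamma * step t) ^+ 2 * v_sqr t w.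
  by rewrite x_S// addrC addrA addNr add0r norm2N norm2Z exprMn real_normK ?num_real.
by rewrite le_eqVlt; apply/orP; left; apply/eqP; rewrite /K0 /K1 /K2; ring.
Qed.

Let measurable_err_sqr t : (1 <= t <= T.+1)%N -> measurable_fun setT (err_sqr t).
Proof. by move=> tT; exact/measurable_norm2_sqr/measurable_err. Qed.

(** The first estimator is the update with a = 1, where the old estimator has weight 0, applied to a
    constant history; the same freezing lemma reduces it to [A1]. *)
Let err_sqr1 : (\int[P]_w (err_sqr 1 w)%:E <= (sigma ^+ 2)%:E)%E.
Proof.
pose H (_ : Omega) := ((x1, x1), 0 : 'rV[R]_n).
have mH : measurable_fun setT (H : draw_history T xi u 0 -> _).
  exact: measurable_cst.
have -> : (\int[P]_w (err_sqr 1 w)%:E =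
    \int[P]_w next_err_sqr 1 (H w, (xi 1%N w, u 1%N w)))%E.
  apply: eq_integral => w _.
  by rewrite /err_sqr /err /next_err_sqr/= x_1 v_1 subrr scale0r addr0.
rewrite (integral_next_err_sqr 1 (leq0n T) mH).
rewrite -[leRHS]mule1 -(probability_setT P) -integral_cst//.
apply: ge0_le_integral => //.
- by move=> w _; apply: integral_ge0 => z _; exact: next_err_sqr_ge0.
- by rewrite /H; apply: measurable_cst.
move=> w _; apply: le_trans (A1 x1); rewrite le_eqVlt; apply/orP; left; apply/eqP.
by apply: eq_integral => z _; rewrite /next_err_sqr/= subrr scale0r addr0.
Qed.

Let integ_nonneg_le (h : Omega -> R) (b : R) : measurable_fun setT h ->
  (forall w, 0 <= h w) -> (\int[P]_w (h w)%:E <= b%:E)%E -> integ P h.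
Proof.
move=> mh h0 hb; apply/integrableP; split; first exact/measurable_EFinP.
under eq_integral => w _ do rewrite /= ger0_norm//.
exact: le_lt_trans hb (ltry _).
Qed.

Let measurable_gap t : (1 <= t <= T.+1)%N -> measurable_fun setT (gap t).
Proof.
move=> tT; apply: measurable_funB => //.
apply: measurableT_comp (measurable_x tT).
exact: measurable_calm (smooth_calm L0' smfmu).
Qed.

Let measurable_grad_sqr t : (1 <= t <= T.+1)%N ->
  measurable_fun setT (grad_sqr t).
Proof.
move=> tT; apply: measurable_norm2_sqr.
exact: measurableT_comp measurable_grad_fmu (measurable_x tT).
Qed.

Let measurable_v_sqr t : (1 <= t <= T.+1)%N -> measurable_fun setT (v_sqr t).
Proof. by move=> tT; exact/measurable_norm2_sqr/measurable_v. Qed.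

Let gap_ge0 t w : 0 <= gap t w.
Proof. by rewrite subr_ge0 fstar_le_smoothing. Qed.

Let integ_step t : (1 <= t <= T)%N -> integ P (gap t) -> integ P (err_sqr t) ->
  [/\ integ P (gap t.+1), integ P (grad_sqr t) & integ P (v_sqr t)].
Proof.
move=> tT ig ie; have t2 : (1 <= t <= T.+1)%N by case/andP: tT => -> /leqW.
have t3 : (1 <= t.+1 <= T.+1)%N by case/andP: tT.
pose b w := gap t w + gamma * step t / 2 * err_sqr t w.
have ib : integ P b by apply: integD => //; exact: integZ.
have gs0 : 0 < gamma * step t by rewrite mulr_gt0.
have p2 w : 0 <= grad_sqr t w by exact: sqr_ge0.
have p3 w : 0 <= v_sqr t w by exact: sqr_ge0.
have key w := descent_pointwise w tT.
have gs2 : 0 < gamma * step t / 2 by rewrite divr_gt0.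
have gs4 : 0 < gamma * step t / 4 by rewrite divr_gt0.
split.
- apply: (integ_le (g := b)) => // [|w]; first exact: measurable_gap.
  rewrite ger0_norm//; have := key w; rewrite -/(b w).
  have := mulr_ge0 (ltW gs2) (p2 w); have := mulr_ge0 (ltW gs4) (p3 w).
  lra.
- apply: (integ_le (g := fun w => (gamma * step t / 2)^-1 * b w)) => [||w].
  + exact: measurable_grad_sqr.
  + exact: integZ.
  rewrite ger0_norm// ler_pdivlMl//; have := key w; rewrite -/(b w).
  have := gap_ge0 t.+1 w; have := mulr_ge0 (ltW gs4) (p3 w).
  lra.
- apply: (integ_le (g := fun w => (gamma * step t / 4)^-1 * b w)) => [||w].
  + exact: measurable_v_sqr.
  + exact: integZ.
  rewrite ger0_norm// ler_pdivlMl//; have := key w; rewrite -/(b w).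
  have := gap_ge0 t.+1 w; have := mulr_ge0 (ltW gs2) (p2 w).
  lra.
Qed.

(** The two properties need each other: the descent bounds the next gap and |v_t|^2 by the present
    gap and error, and finiteness of E|v_t|^2 then makes [bound_mean] control the next error. *)
Let integ_gap_err t : (1 <= t <= T.+1)%N ->
  integ P (gap t) /\ integ P (err_sqr t).
Proof.
elim: t => [//|t IH] /andP[_ tT].
have t3 : (1 <= t.+1 <= T.+1)%N by [].
have e0 w : 0 <= err_sqr t.+1 w by exact: sqr_ge0.
have [t0|t0] := posnP t.
  subst t; split; first by rewrite /gap x_1; exact: (integ_cst P (fmu x1 - fstar)).
  exact: integ_nonneg_le (measurable_err_sqr t3) e0 err_sqr1.
have t1 : (1 <= t <= T)%N by rewrite t0.
have t2 : (1 <= t <= T.+1)%N by rewrite t0 ltnW.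
have [ig ie] := IH t2.
have [ig' _ iv] := integ_step t1 ig ie; split; first exact: ig'.
exact: integ_nonneg_le (measurable_err_sqr t3) e0 (bound_mean t1 ie iv).
Qed.

Hypotheses (T0 : (0 < T)%N)
  (mu_le : mu <= 1 / (n%:R * (m + T%:R) `^ (2 / 3))).

Let M := (fmu x1 - fstar) / (k * gamma)
          + m `^ (1 / 3) * sigma ^+ 2 / k ^+ 2
          + 9 * L ^+ 2 / (4 * k ^+ 2)
          + 2 * k ^+ 2 * c ^+ 2 * sigma ^+ 2 * ln (m + T%:R).

Lemma sum_mean_grad_smoothing_sqr :
  \sum_(1 <= t < T.+1) mean P (grad_sqr t) <= 2 * M * rho m T.
Proof.
have gap1 : mean P (gap 1) = fmu x1 - fstar.
  by rewrite /gap x_1; exact: (mean_cst P (fmu x1 - fstar)).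
rewrite /M -gap1.
have le1 t : (1 <= t <= T)%N -> (1 <= t <= T.+1)%N by case/andP => -> /leqW.
have mean_ge0 (h : Omega -> R) : (forall w, 0 <= h w) -> 0 <= mean P h.
  by move=> h0; apply: Rintegral_ge0.
apply: (acc_zom_rate k0 m2 mk mck c_ge n_gt0 gamma0 L0 gamma_le2 (mu := mu)
  (g := fun t => mean P (gap t)) (A := fun t => mean P (err_sqr t))
  (V := fun t => mean P (v_sqr t))) => //.
- by move=> t _; apply: mean_ge0 => w; exact: gap_ge0.
- by move=> t _; apply: mean_ge0 => w; exact: sqr_ge0.
- by move=> t _; apply: mean_ge0 => w; exact: sqr_ge0.
- by move=> t _; apply: mean_ge0 => w; exact: sqr_ge0.
- move=> t tT; have [ig ie] := integ_gap_err (le1 t tT).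
  have [ig' iG iv] := integ_step tT ig ie.
  rewrite -/(step t) -!meanZ// -!meanD//; try exact: integZ.
    apply: mean_le => [||w]; last exact: descent_pointwise.
    + by apply: integD; [apply: integD => //|]; exact: integZ.
    + by apply: integD => //; exact: integZ.
  by apply: integD => //; exact: integZ.
- move=> t tT; have [ig ie] := integ_gap_err (le1 t tT).
  have [ig' iG iv] := integ_step tT ig ie.
  have t3 : (1 <= t.+1 <= T.+1)%N by case/andP: tT.
  have [_ ie'] := integ_gap_err t3.
  by rewrite -lee_fin (EFin_mean ie'); exact: (bound_mean tT ie iv).
- have [_ ie'] := integ_gap_err (isT : (1 <= 1 <= T.+1)%N).
  by rewrite -lee_fin (EFin_mean ie'); exact: err_sqr1.
Qed.

Lemma mean_grad_rate :
  ((T%:R^-1)%:E * \sum_(1 <= t < T.+1) 'E_P[fun w => norm2 (grad f (x t w))]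
   <= (Num.sqrt (2 * M) * m `^ (1 / 6) / T%:R `^ (1 / 2)
       + Num.sqrt (2 * M) / T%:R `^ (1 / 3)
       + L / (2 * (m + T%:R) `^ (2 / 3)))%:E)%E.
Proof.
have m0 : 0 < m by apply: lt_le_trans m2.
have TR : (0 : R) < T%:R by rewrite ltr0n.
have nR : (0 : R) < n%:R by rewrite ltr0n.
have mT1 : 1 <= m + T%:R by have := m2; lra.
have M0 : 0 <= M.
  have s2 := sqr_ge0 sigma.
  rewrite /M; apply: addr_ge0; first apply: addr_ge0; first apply: addr_ge0.
  - by apply: divr_ge0; [rewrite subr_ge0 fstar_le_smoothing|rewrite mulr_ge0// ltW].
  - by apply: divr_ge0; [apply: mulr_ge0 => //; exact: powR_ge0|exact: sqr_ge0].
  - by apply: divr_ge0; apply: mulr_ge0 => //; exact: sqr_ge0.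
  - apply: mulr_ge0; last exact: ln_ge0.
    apply: mulr_ge0 => //; apply: mulr_ge0; last exact: sqr_ge0.
    by apply: mulr_ge0 => //; exact: sqr_ge0.
pose s := Num.sqrt (2 * M).
have s2 : s ^+ 2 = 2 * M by rewrite sqr_sqrtr// mulr_ge0.
pose a := m `^ (1 / 6); pose b := (T%:R : R) `^ (1 / 6).
have a0 : 0 < a by exact: powR_gt0.
have b0 : 0 < b by exact: powR_gt0.
have b3 : T%:R `^ (1 / 2) = b ^+ 3 :> R.
  by rewrite /b -powR_mulrn ?powR_ge0// -powRrM; congr (_ `^ _); field.
have b2 : T%:R `^ (1 / 3) = b ^+ 2 :> R.
  by rewrite /b -powR_mulrn ?powR_ge0// -powRrM; congr (_ `^ _); field.
have b6 : T%:R = b ^+ 6 :> R.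
  rewrite /b -powR_mulrn ?powR_ge0// -powRrM.
  by rewrite (_ : 1 / 6 * 6%:R = 1) ?powRr1//; field.
have a6 : m = a ^+ 6.
  rewrite /a -powR_mulrn ?powR_ge0// -powRrM.
  by rewrite (_ : 1 / 6 * 6%:R = 1) ?powRr1 ?ltW//; field.
(* After cubing, this is a^6 + b^6 <= (a + b)^6 with m = a^6 and T = b^6. *)
have rab : rho m T <= (a + b) ^+ 2.
  rewrite -(@ler_pXn2r _ 3)// ?nnegrE ?sqr_ge0//; last exact/ltW/rho_gt0.
  rewrite rho_cube// -exprM {1}b6 {1}a6.
  have -> : (a + b) ^+ (2 * 3) = a ^+ 6 + b ^+ 6 +
    (6 * a ^+ 5 * b + 15 * a ^+ 4 * b ^+ 2 + 20 * a ^+ 3 * b ^+ 3 +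
     15 * a ^+ 2 * b ^+ 4 + 6 * a * b ^+ 5) by ring.
  by rewrite lerDl !addr_ge0// !mulr_ge0// ?exprn_ge0// ltW.
(* The square root of 2 M (a + b)^2 / T, written as s (a + b) / b^3: it bounds the root mean square
   of the gradients of the smoothing, and its two summands are the first two terms of the rate. *)
pose lam := s * a / T%:R `^ (1 / 2) + s / T%:R `^ (1 / 3).
have lamE : lam = s * (a + b) / b ^+ 3.
  by rewrite /lam b2 b3; field; rewrite gt_eqF.
have lam0 : 0 <= lam.
  by rewrite lamE divr_ge0 ?mulr_ge0 ?sqrtr_ge0 ?exprn_ge0 ?addr_ge0 ?ltW.
have sumG := sum_mean_grad_smoothing_sqr.
have lam2 : T%:R^-1 * \sum_(1 <= t < T.+1) mean P (grad_sqr t) <= lam ^+ 2.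
  rewrite ler_pdivrMl//; apply: le_trans sumG _.
  apply: (@le_trans _ _ (2 * M * (a + b) ^+ 2)).
    by apply: ler_wpM2l => //; rewrite mulr_ge0.
  rewrite -s2 lamE b6 le_eqVlt; apply/orP; left; apply/eqP.
  by field; rewrite gt_eqF.
pose bias := n%:R * L * mu / 2.
have bias_le : bias <= L / (2 * (m + T%:R) `^ (2 / 3)).
  have r0 : 0 < (m + T%:R) `^ (2 / 3) by rewrite powR_gt0//; lra.
  have := mu_le; rewrite ler_pdivlMr ?mulr_gt0// => h.
  rewrite /bias invfM mulrA ler_pdivlMr//.
  have : L / 2 * (mu * (n%:R * (m + T%:R) `^ (2 / 3))) <= L / 2 * 1.
    by apply: ler_wpM2l => //; rewrite divr_ge0.
  lra.
have le1 t : (1 <= t <= T)%N -> (1 <= t <= T.+1)%N by case/andP => -> /leqW.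
have iG t : (1 <= t <= T)%N -> integ P (grad_sqr t).
  move=> tT; have [ig ie] := integ_gap_err (le1 t tT).
  by have [] := integ_step tT ig ie.
have mgf : measurable_fun setT (grad f).
  by apply/measurable_fun_rVP => i; exact: measurable_calm (smooth_calm_grad i smf).
have mfx t : (1 <= t <= T)%N -> measurable_fun setT (fun w => norm2 (grad f (x t w))).
  move=> tT; apply: measurableT_comp; first exact: measurable_norm2.
  exact: measurableT_comp mgf (measurable_x (le1 t tT)).
(* [y <= y ^+ 2 / (2 * e) + e / 2] replaces Jensen's inequality. *)
have pointwise e t w : 0 < e ->
    norm2 (grad f (x t w)) <= (2 * e)^-1 * grad_sqr t w + (e / 2 + bias).
  move=> e0; have -> : grad f (x t w) = grad fmu (x t w) -
    (grad fmu (x t w) - grad f (x t w)) by rewrite opprB addrC subrK.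
  apply: le_trans (norm2D _ _) _; rewrite norm2N addrA; apply: lerD; last first.
    exact: grad_smoothing_dist smf _.
  rewrite /grad_sqr; set y := norm2 _.
  rewrite -subr_ge0 (_ : _ - _ = (2 * e)^-1 * (y - e) ^+ 2); last first.
    by field; rewrite gt_eqF.
  by apply: mulr_ge0; [rewrite invr_ge0 mulr_ge0// ltW|exact: sqr_ge0].
have iN t : (1 <= t <= T)%N -> integ P (fun w => norm2 (grad f (x t w))).
  move=> tT; apply: (integ_le (g := fun w => (2 * 1)^-1 * grad_sqr t w + (1 / 2 + bias))).
  - exact: mfx.
  - apply: integD; first exact/integZ/iG.
    exact: (integ_cst P (1 / 2 + bias)).
  - by move=> w; rewrite ger0_norm ?norm2_ge0// pointwise.
have EE : (\sum_(1 <= t < T.+1) 'E_P[fun w => norm2 (grad f (x t w))] =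
    (\sum_(1 <= t < T.+1) mean P (fun w => norm2 (grad f (x t w))))%:E)%E.
  rewrite -sumEFin !big_nat; apply: eq_bigr => t tT.
  by rewrite unlock (EFin_mean (iN t tT)).
rewrite EE -EFinM lee_fin.
apply: (@le_trans _ _ (lam + bias)); last by rewrite /lam lerD2l.
apply/ler_addgt0Pr => e e0.
(* [lam] is only known to be nonnegative, whereas the quadratic inequality divides by its parameter.
   With parameter l the averaged bound is l/2 + l/2 + bias, and e is arbitrary. *)
pose l := lam + e; have l0 : 0 < l by rewrite ltr_wpDl.
apply: (@le_trans _ _ (T%:R^-1 * \sum_(1 <= t < T.+1)
    ((2 * l)^-1 * mean P (grad_sqr t) + (l / 2 + bias)))).
  apply: ler_wpM2l; first by rewrite invr_ge0.
  rewrite !big_nat; apply: ler_sum => t tT.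
  rewrite -meanZ; last exact: iG.
  rewrite -(mean_cst P (l / 2 + bias)) -meanD; last 2 first.
  - exact/integZ/iG.
  - exact: integ_cst.
  apply: mean_le => [||w]; first exact: iN.
    apply: integD; first exact/integZ/iG.
    exact: (integ_cst P (l / 2 + bias)).
  exact: pointwise.
rewrite big_split/= -mulr_sumr sumr_const_nat subn1/= mulrDr.
rewrite -[X in _ + T%:R^-1 * X]mulr_natl mulKf ?gt_eqF// mulrCA.
have : (2 * l)^-1 * (T%:R^-1 * \sum_(1 <= t < T.+1) mean P (grad_sqr t)) <=
    (2 * l)^-1 * l ^+ 2.
  apply: ler_wpM2l; first by rewrite invr_ge0 mulr_ge0// ltW.
  apply: le_trans lam2 _; rewrite lerXn2r ?nnegrE ?(ltW l0)//.
  by rewrite /l lerDl ltW.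
have -> : (2 * l)^-1 * l ^+ 2 = l / 2 by field; rewrite gt_eqF.
rewrite /l; lra.
Qed.

End acc_zom.

Unset Implicit Arguments.
Set Strict Implicit.

Theorem theorem3 (R : realType) (d : nat) (d_gt0 : (0 < d)%N)
    (dO dX : measure_display)
    (Omega : measurableType dO) (P : probability Omega R)
    (Xi : measurableType dX) (D : probability Xi R)
    (F : 'rV[R]_d -> Xi -> R)
    (F_diff : forall (z : Xi) (x : 'rV[R]_d), differentiable (F^~ z) x)
    (F_int : forall x : 'rV[R]_d, D.-integrable setT (EFin \o F x))
    (mu gamma k m c L sigma : R) (T : nat) (x1 : 'rV[R]_d)
    (f := objective D F) (fmu := smoothing mu f) (fstar := inf (range f))
    (sigma_gt0 : 0 < sigma)
    (A1 : forall x : 'rV[R]_d,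
      (\int[D \x unif_sphere R d]_w
          (norm2 (zo_grad mu (F^~ w.1) w.2 x - grad fmu x) ^+ 2)%:E
       <= (sigma ^+ 2)%:E)%E)
    (L_gt0 : 0 < L)
    (A2 : forall (z : Xi) (x x' : 'rV[R]_d),
      norm2 (grad (F^~ z) x - grad (F^~ z) x') <= L * norm2 (x - x'))
    (A3 : has_lbound (range f))
    (T_gt0 : (0 < T)%N)
    (xi : nat -> {RV P >-> Xi}) (u : nat -> {RV P >-> 'rV[R]_d})
    (draws : fresh_draws D T xi u)
    (x v : nat -> Omega -> 'rV[R]_d)
    (run : forall w : Omega,
      acc_zom_run F mu gamma k m c T x1 (fun t => xi t w) (fun t => u t w)
        (fun t => x t w) (fun t => v t w))
    (gamma_gt0 : 0 < gamma)
    (gamma_le : gamma <= Num.min (m `^ (1 / 3) / (2 * L * k))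
                                 (1 / (2 * Num.sqrt (6 * d%:R) * L)))
    (k_gt0 : 0 < k)
    (c_ge : 2 / (3 * k ^+ 3) + 5 / 4 <= c)
    (m_ge : Num.max 2 (Num.max (k ^+ 3) ((c * k) ^+ 3)) <= m)
    (mu_gt0 : 0 < mu)
    (mu_le : mu <= 1 / (d%:R * (m + T%:R) `^ (2 / 3)))
    (M := (fmu x1 - fstar) / (k * gamma)
          + m `^ (1 / 3) * sigma ^+ 2 / k ^+ 2
          + 9 * L ^+ 2 / (4 * k ^+ 2)
          + 2 * k ^+ 2 * c ^+ 2 * sigma ^+ 2 * ln (m + T%:R)) :
  ((T%:R^-1)%:E * \sum_(1 <= t < T.+1) 'E_P[fun w => norm2 (grad f (x t w))]
   <= (Num.sqrt (2 * M) * m `^ (1 / 6) / T%:R `^ (1 / 2)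
       + Num.sqrt (2 * M) / T%:R `^ (1 / 3)
       + L / (2 * (m + T%:R) `^ (2 / 3)))%:E)%E.
Proof.
have smF z : smooth L (F^~ z) (grad (F^~ z)).
  by apply: smooth_derive => //; exact: ltW.
move: gamma_le; rewrite le_min => /andP[gamma_le1 gamma_le2].
move: m_ge; rewrite !ge_max => /and3P[m2 mk mck].
exact: (mean_grad_rate d_gt0 mu_gt0 L_gt0 smF F_int A1 A3 draws run gamma_gt0
  k_gt0 m2 mk mck c_ge gamma_le1 gamma_le2 T_gt0 mu_le).
Qed.
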